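(* Let $p>0$ and $\phi(z)=|z|^\alpha$ with $\alpha>2$. The proper invariant subspaces of $V$ on $\mathcal{F}^\phi_p$ are precisely the spaces $$\{f\in\mathcal{F}^\phi_p:\ f^{(k)}(0)=0\text{ for }0\le k\le N-1\}=\overline{\operatorname{Span}\{z^k:\ k\ge N\}}^{\mathcal{F}^\phi_p},$$ where $N$ is a positive integer.
   Context: $dm$ is Lebesgue area measure on $\mathbb{C}$. For $0<p<\infty$, the weighted Fock space $\mathcal{F}^\phi_p$ is the set of entire functions $f$ with $\|f\|^p_{\mathcal{F}^\phi_p}=\int_{\mathbb{C}}|f(z)|^pe^{-p\phi(z)}\,dm(z)<\infty$. $V$ is the Volterra operator $Vf(z)=\int_0^zf(\zeta)\,d\zeta$. A closed subspace $\mathcal{M}\subset\mathcal{F}^\phi_p$ is invariant for $V$ if $V\mathcal{M}\subseteq\mathcal{M}$; it is proper if $\mathcal{M}\ne\{0\}$ and $\mathcal{M}\ne\mathcal{F}^\phi_p$. *)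

(* Defs.v *)
From HB Require Import structures.
From mathcomp Require Import all_boot all_order all_algebra.
From mathcomp Require Import complex.
From mathcomp Require Import all_classical all_reals all_analysis.

Set Implicit Arguments.
Unset Strict Implicit.
Unset Printing Implicit Defensive.

Import Order.TTheory GRing.Theory Num.Theory.
Import numFieldNormedType.Exports.

(* [classical_set_scope] is opened last so that [f^`(k)] denotes the iterated
   derivative of a function and not the formal derivative of a polynomial. *)
Local Open Scope ring_scope.
Local Open Scope complex_scope.
Local Open Scope classical_set_scope.

(* Complex functions are typed [R[i]^o -> R[i]^o]: [R[i]^o] is the normed space
   C over the field C itself, so that [derivable f z 1] is complex
   differentiability at [z] and [f^`(k)] is the k-th complex derivative.  The
   real-valued modulus is [Normc.normc]. *)

Section Generic.
Variables (K : fieldType) (V : lmodType K).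

Definition linear_span (S : set V) : set V :=
  [set v | exists (n : nat) (c : 'I_n -> K) (u : 'I_n -> V),
     (forall i, S (u i)) /\ v = \sum_(i < n) c i *: u i].

End Generic.

Section ComplexFunctions.
Variable R : realType.
Local Notation C := R[i]^o.

Definition entire (f : C -> C) : Prop := forall z : C, derivable f z 1.

Definition area_integral (h : C -> \bar R) : \bar R :=
  (\int[lebesgue_measure \x lebesgue_measure]_(w in [set: R * R])
     h (w.1 +i* w.2)%C)%E.

(* Integral of [f] along the segment from [a] to [b], parametrized by
   t |-> a + t (b - a) on [0, 1], real and imaginary parts separately. *)
Definition segment_integral (a b : C) (f : C -> C) : C :=
  let g (t : R) : R[i] := f (a + t%:C * (b - a)) in
  (b - a) * ((\int[lebesgue_measure]_(t in `[0, 1]) complex.Re (g t))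
             +i* (\int[lebesgue_measure]_(t in `[0, 1]) complex.Im (g t)))%C.

(* For entire [f] the integral from 0 to [z] does not depend on the path. *)
Definition volterra (f : C -> C) : C -> C := fun z => segment_integral 0 z f.

Definition monomial (k : nat) : C -> C := fun z => z ^+ k.

End ComplexFunctions.

Section Fock.
Variables (R : realType) (p : R) (phi : R[i]^o -> R).
Local Notation C := R[i]^o.

Definition fock_normp (f : C -> C) : \bar R :=
  area_integral (fun z => (Normc.normc (f z) `^ p * expR (- p * phi z))%:E).

(* Only a quasi-norm when p < 1. *)
Definition fock_norm (f : C -> C) : \bar R := (fock_normp f `^ p^-1)%E.

Definition fock : set (C -> C) :=
  [set f | entire f /\ (fock_normp f < +oo)%E].

Definition fock_closure (S : set (C -> C)) : set (C -> C) :=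
  [set f | fock f /\
     forall e : R, 0 < e -> exists2 g, S g & (fock_norm (f - g)%R < e%:E)%E].

Definition closed_subspace (M : set (C -> C)) : Prop :=
  [/\ M `<=` fock, submod_closed [in M] & fock_closure M `<=` M].

Definition proper_invariant_subspace (M : set (C -> C)) : Prop :=
  [/\ closed_subspace M,
      (forall f, M f -> M (volterra f)),
      M <> [set 0] & M <> fock].

Definition fock_vanishing (N : nat) : set (C -> C) :=
  [set f | fock f /\ forall k : nat, (k < N)%N -> f^`(k) 0 = 0].

End Fock.

Definition radial_power (R : realType) (alpha : R) : R[i]^o -> R :=
  fun z => Normc.normc z `^ alpha.

(* Main.v *)
(* In the basis z^k / k! the operator V is a shift.  Let f in M have its first nonzero Taylor
   coefficient at order N.  Membership in the Fock space bounds the coefficients of f in this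
   basis by omega(k) = k!^(1 - 1/alpha) alpha^(k/alpha) times a power of k.  As 1 - 1/alpha > 1/2,
   the discrete convolution of omega with itself, without its end terms, is o(omega): hence the
   formal power series c with c(V) f = z^N satisfies bounds of the same type, and after finitely
   many further applications of V, which absorb the powers of k, the partial sums of c(V) f
   converge in norm.  So M contains all z^k with k large; by density of polynomials it contains
   all functions vanishing to a high order, and subtracting multiples of the functions V^j f lowers
   this order down to N.

   The analytic input is local: integrals of |f|^p over small squares dominate pointwise values,
   which gives the growth of Fock functions, the boundedness of V, and, together with dilations
   f(rz), r -> 1, the density of polynomials. *)
Require Import Defs.
From HB Require Import structures.
From mathcomp Require Import all_boot all_order all_algebra.
From mathcomp Require Import complex separable cyclic cyclotomic.
From mathcomp Require Import all_classical all_reals all_analysis.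
From mathcomp Require Import measurable_realfun.
From mathcomp Require Import ring lra.

Set Implicit Arguments.
Unset Strict Implicit.
Unset Printing Implicit Defensive.

Import Order.TTheory GRing.Theory Num.Theory.
Import numFieldNormedType.Exports.

Local Open Scope ring_scope.
Local Open Scope complex_scope.
Local Open Scope classical_set_scope.

(** * Affine change of variables for Lebesgue integrals on the line *)

Section RealSubstitution.
Variable R : realType.
Local Notation mu := (@lebesgue_measure R).

(** The exponent enters through s = 1 - 1/alpha: consecutive quotients of omega grow like k^s. In
    the convolution about n interior terms occur, and by log-convexity each is at most a constant
    times omega(n) n^(-2s), so that 2s > 1 makes their sum small against omega(n). In the recursion
    for c the earlier coefficients then enter with a small factor from some index on, and c inherits
    the bound of f.

    The norm is only a quasi-norm for p < 1. To treat all p alike, infinite sums are estimated on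
    coefficients, turned into a pointwise bound by exp(|z|^alpha) over a power of 1 + |z|, and
    integrated only then. Each passage between norm, growth and coefficients loses a power of |z| or
    k, which is affordable since each application of V gains a factor k^s.

    Complex analysis is done on squares instead of discs: the sides are segments, a quarter turn
    permutes them, and a varying size sweeps the plane in Cartesian coordinates, so that Tonelli
    alone turns Cauchy's formula into an area mean. The number 2 pi i appears only as a contour
    integral of modulus at least 1. *)

Definition affine (a c : R) (x : measurableTypeR R) : measurableTypeR R := a * x + c.

Lemma measurable_affine (a c : R) : measurable_fun setT (affine a c).
Proof.
apply: measurable_funD; last exact: measurable_cst.
by apply: measurable_funM; [exact: measurable_cst|exact: measurable_id].
Qed.

Definition affine_measure (a c : R) : {measure set (measurableTypeR R) -> \bar R} :=
  mscale (NngNum (normr_ge0 a))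
    (measure_function_pushforward__canonical__measure_function_Measure
      mu (measurable_affine a c)).

(** Uniqueness of the measure that gives half-open intervals their length. The sign of [a] decides
    at which end the preimage of []p, q]] is closed. *)
Lemma lebesgue_measure_affine (a c : R) (A : set (measurableTypeR R)) :
  a != 0 -> measurable A -> mu A = affine_measure a c A.
Proof.
move=> a0 mA; apply: (@lebesgue_measure_unique R (affine_measure a c)) => // _ [[p q]] _ <-.
rewrite /affine_measure/=.
rewrite /mscale/= /pushforward lebesgue_measure_itv/= lte_fin.
have [a_gt0|a_lt0|a_eq0] := ltrgtP a 0; last by rewrite a_eq0 eqxx in a0.
- have -> : affine a c @^-1` `]p, q] = `[(q - c) / a, (p - c) / a[%classic.
    rewrite /affine; apply/seteqP; split => x /=; rewrite !in_itv/= ltr_ndivlMr// ler_ndivrMr//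
      [x * a]mulrC ltrBlDr lerBrDr => /andP[-> ->]//.
  rewrite lebesgue_measure_itv/= lte_fin ltr_nM2r ?invr_lt0// ltrD2r ltr0_norm//.
  case: ifPn => pq; last by rewrite mule0.
  by rewrite -!EFinB -EFinM; congr (_%:E); field.
- have -> : affine a c @^-1` `]p, q] = `](p - c) / a, (q - c) / a]%classic.
    rewrite /affine; apply/seteqP; split => x /=; rewrite !in_itv/= ler_pdivlMr// ltr_pdivrMr//
      [x * a]mulrC ltrBlDr lerBrDr => /andP[-> ->]//.
  rewrite lebesgue_measure_itv/= lte_fin ltr_pM2r ?invr_gt0// ltrD2r gtr0_norm//.
  case: ifPn => pq; last by rewrite mule0.
  by rewrite -!EFinB -EFinM; congr (_%:E); field.
Qed.

Lemma ge0_integral_affine (a c : R) (D : set R) (f : R -> \bar R) : a != 0 ->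
  measurable D -> measurable_fun D f -> (forall x, D x -> (0 <= f x)%E) ->
  (\int[mu]_(x in D) f x =
   `|a|%:E * \int[mu]_(x in [set x | D (a * x + c)%R]) f (a * x + c)%R)%E.
Proof.
move=> a0 mD mf f0.
have ma := measurable_affine a c.
transitivity ((\int[affine_measure a c]_(x in D) f x)%E).
  by apply: eq_measure_integral => A mA AD; exact: lebesgue_measure_affine.
rewrite [LHS](ge0_integral_mscale
  (measure_function_pushforward__canonical__measure_function_Measure
    mu (measurable_affine a c)) mD (NngNum (normr_ge0 a)) mf f0).
by rewrite ge0_integral_pushforward// => x /set_mem/f0.
Qed.

Lemma integral_affine (a c : R) (D : set R) (f : R -> R) : a != 0 ->
  measurable D -> mu.-integrable D (EFin \o f) ->
  \int[mu]_(x in D) f x =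
   `|a| * \int[mu]_(x in [set x | D (a * x + c)%R]) f (a * x + c)%R.
Proof.
move=> a0 mD intf; rewrite /Rintegral.
have mf : measurable_fun (D : set R) (EFin \o f) := measurable_int _ intf.
pose g x := (f (a * x + c))%:E.
have mD' : measurable [set x | D (a * x + c)%R].
  by rewrite -[X in measurable X]setTI; exact: (measurable_affine a c).
have Ep : (\int[mu]_(x in D) (EFin \o f)^\+ x =
   `|a|%:E * \int[mu]_(x in [set x | D (a * x + c)%R]) (g^\+ x))%E.
  rewrite (ge0_integral_affine c a0)//; last exact: measurable_funepos.
  by congr (_ * _)%E; apply: eq_integral => x _; rewrite !funeposE.
have En : (\int[mu]_(x in D) (EFin \o f)^\- x =
   `|a|%:E * \int[mu]_(x in [set x | D (a * x + c)%R]) (g^\- x))%E.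
  rewrite (ge0_integral_affine c a0)//; last exact: measurable_funeneg.
  by congr (_ * _)%E; apply: eq_integral => x _; rewrite !funenegE.
have fp : (\int[mu]_(x in D) (EFin \o f)^\+ x)%E \is a fin_num.
  by apply: integrable_fin_num => //; exact: integrable_funepos.
have fn : (\int[mu]_(x in D) (EFin \o f)^\- x)%E \is a fin_num.
  by apply: integrable_fin_num => //; exact: integrable_funeneg.
have na : `|a| != 0 by rewrite normr_eq0.
(* Finiteness passes from a non-zero multiple back to the integral, so both parts of the substituted
   function have finite integrals and may be subtracted. *)
have h (X : \bar R) : (0 <= X)%E -> (`|a|%:E * X \is a fin_num)%E -> X \is a fin_num.
  case: X => [r| |] //= _; rewrite mulry gtr0_sg ?mul1e// normr_gt0 //.
have fp' : (\int[mu]_(x in [set x | D (a * x + c)%R]) (g^\+ x))%E \is a fin_num.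
  by apply: h; [exact: integral_ge0|rewrite -Ep].
have fn' : (\int[mu]_(x in [set x | D (a * x + c)%R]) (g^\- x))%E \is a fin_num.
  by apply: h; [exact: integral_ge0|rewrite -En].
rewrite integralE [in RHS]integralE -/g Ep En.
by rewrite -(fineK fp') -(fineK fn') -!EFinM -!EFinB /= mulrBr.
Qed.

End RealSubstitution.

(** * The real-valued modulus, limits with real epsilons, and complex differentiability *)

Section ComplexModulus.
Variable R : realType.
Local Notation C := R[i]^o.
Local Notation N := (@Normc.normc R).
Implicit Types (z w h d : C) (f g : C -> C).

Lemma norm_normc z : `|z| = (N z)%:C.
Proof. by rewrite normc_def; case: z. Qed.

Lemma normc_ge0 z : 0 <= N z.
Proof. by case: z => a b; rewrite /Normc.normc sqrtr_ge0. Qed.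

Lemma normc_real (x : R) : N x%:C = `|x|.
Proof. by rewrite /Normc.normc/= expr0n addr0 sqrtr_sqr. Qed.

Lemma normc_eq0 z : (N z == 0) = (z == 0).
Proof.
apply/eqP/eqP => [/Normc.eq0_normc//|->].
exact: Normc.normc0.
Qed.

Lemma normc_gt0 z : (0 < N z) = (z != 0).
Proof. by rewrite lt_neqAle normc_ge0 andbT eq_sym normc_eq0. Qed.

Lemma normcD z w : N (z + w) <= N z + N w.
Proof. exact: le_normcD. Qed.

Lemma normcNC z : N (- z) = N z.
Proof. exact: normcN. Qed.

Lemma normcB z w : N (z - w) = N (w - z).
Proof. by rewrite -normcNC opprB. Qed.

Lemma normc_triangle v z w : N (z - w) <= N (z - v) + N (v - w).
Proof. by apply: le_trans (normcD _ _); rewrite addrA subrK. Qed.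

Lemma normcX z n : N (z ^+ n) = N z ^+ n.
Proof.
elim: n => [|n IH]; first by rewrite !expr0 Normc.normc1.
by rewrite !exprS Normc.normcM IH.
Qed.

Lemma normc_sum (I : Type) (r : seq I) (P : pred I) (F : I -> C) :
  N (\sum_(i <- r | P i) F i) <= \sum_(i <- r | P i) N (F i).
Proof.
elim/big_ind2 : _ => //; first by rewrite Normc.normc0.
by move=> x1 x2 y1 y2 h1 h2; apply: le_trans (normcD _ _) _; apply: lerD.
Qed.

Lemma normr_Re_le z : `|complex.Re z| <= N z.
Proof.
case: z => a b /=; rewrite -sqrtr_sqr ler_wsqrtr// lerDl sqr_ge0//.
Qed.

Lemma normr_Im_le z : `|complex.Im z| <= N z.
Proof.
case: z => a b /=; rewrite -sqrtr_sqr ler_wsqrtr// lerDr sqr_ge0//.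
Qed.

Lemma normc_le_ReIm z : N z <= `|complex.Re z| + `|complex.Im z|.
Proof.
case: z => a b /=; rewrite -[leRHS]ger0_norm ?addr_ge0// -sqrtr_sqr ler_wsqrtr//.
by rewrite sqrrD !real_normK ?num_real// lerD2r lerDl mulrn_wge0 ?mulr_ge0.
Qed.

Lemma dist_normc_le z w : `|N z - N w| <= N (z - w).
Proof.
rewrite ler_norml; apply/andP; split.
  rewrite lerNl opprB lerBlDr -[leRHS]addrC -lerBlDl.
  by rewrite lerBlDl normcB; apply: le_trans (normcD _ _); rewrite addrC subrK.
by rewrite lerBlDr; apply: le_trans (normcD _ _); rewrite subrK.
Qed.

Lemma real_complexM (x y : R) : (x * y)%:C = x%:C * y%:C :> C.
Proof. exact: rmorphM. Qed.
Lemma real_complexB (x y : R) : (x - y)%:C = x%:C - y%:C :> C.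
Proof. exact: rmorphB. Qed.
Lemma real_complexD (x y : R) : (x + y)%:C = x%:C + y%:C :> C.
Proof. exact: rmorphD. Qed.

(** The norm of [R[i]^o] takes values in [R[i]], so the epsilons of its topology are complex.
    Positive ones are real, which lets the lemmas below state neighbourhoods and limits with real
    radii. *)
Lemma gt0_complexP (e : R[i]) : 0 < e -> exists2 r : R, 0 < r & e = r%:C.
Proof.
by case: e => a b; rewrite ltcE/= => /andP[/eqP -> a0]; exists a.
Qed.

Lemma nbhsC_P z (P : set C) :
  nbhs z P <-> exists2 d : R, 0 < d & forall w, N (w - z) < d -> P w.
Proof.
split=> [/nbhs_normP [e /= e0 eP]|[d d0 dP]].
  have [r r0 er] := gt0_complexP e0; exists r => // w wz; apply: eP => /=.
  by rewrite er distrC norm_normc ltcR.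
apply: (proj2 (nbhs_normP z P)); exists d%:C => /=; first by rewrite ltcR.
by move=> w /=; rewrite distrC norm_normc ltcR; exact: dP.
Qed.

Lemma nbhsR_P (t : R) (P : set R) :
  nbhs t P <-> exists2 d : R, 0 < d & forall u, `|u - t| < d -> P u.
Proof.
split=> [/nbhs_normP [e /= e0 eP]|[d d0 dP]].
  by exists e => // w wz; apply: eP => /=; rewrite distrC.
by apply: (proj2 (nbhs_normP t P)); exists d => //= w /=; rewrite distrC; exact: dP.
Qed.

Lemma cvgC_P (T : Type) (F : set_system T) (FF : Filter F) (f : T -> C) (l : C) :
  f @ F --> l <-> forall e : R, 0 < e -> \forall x \near F, N (f x - l) < e.
Proof.
split=> [/cvgrPdistC_lt h e e0|h].
  have /h : 0 < e%:C by rewrite ltcR.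
  by apply: filterS => x; rewrite norm_normc ltcR.
apply/cvgrPdistC_lt => e /gt0_complexP[r r0 ->].
by have := h r r0; apply: filterS => x; rewrite norm_normc ltcR.
Qed.

Lemma continuousC_P f z : {for z, continuous f} <->
  forall e : R, 0 < e -> exists2 d : R, 0 < d & forall w, N (w - z) < d -> N (f w - f z) < e.
Proof.
have E := @cvgC_P _ (nbhs z) _ f (f z).
split=> [/E h e /h /nbhsC_P//|h].
by apply/E => e /h ?; apply/nbhsC_P.
Qed.

Lemma continuous_real_complex : continuous (fun t : R => t%:C : C).
Proof.
move=> t; apply/(@cvgC_P _ (nbhs t)) => e e0; apply/nbhsR_P; exists e => // u.
by rewrite -real_complexB normc_real.
Qed.

Lemma continuous_Re : continuous (fun z : C => complex.Re z : R).
Proof.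
move=> z; apply/(@cvgrPdistC_lt _ _ _ (nbhs z)) => e e0; apply/nbhsC_P; exists e => // w wz.
by apply: le_lt_trans wz; rewrite -raddfB normr_Re_le.
Qed.

Lemma continuous_Im : continuous (fun z : C => complex.Im z : R).
Proof.
move=> z; apply/(@cvgrPdistC_lt _ _ _ (nbhs z)) => e e0; apply/nbhsC_P; exists e => // w wz.
by apply: le_lt_trans wz; rewrite -raddfB normr_Im_le.
Qed.

Lemma continuous_normc : continuous (fun z : C => N z).
Proof.
move=> z; apply/(@cvgrPdistC_lt _ _ _ (nbhs z)) => e e0; apply/nbhsC_P; exists e => // w wz.
by apply: le_lt_trans wz; rewrite dist_normc_le.
Qed.

(** The derivative as a first-order expansion: free of quotients, so that [h = 0] is no exception
    and the estimate can be used directly along segments. *)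
Definition cderiv f z d := forall e : R, 0 < e -> exists2 r : R, 0 < r &
  forall h, N h < r -> N (f (z + h) - f z - h * d) <= e * N h.

Lemma cderiv_is_derive f z d : cderiv f z d <-> is_derive z (1 : C) f d.
Proof.
have key : (fun h : C => h^-1 *: (f (h *: (1 : C) + z) - f z)) @ 0^' --> d <-> cderiv f z d.
  split=> [/cvgC_P h e e0|h].
    have /nbhsC_P[r r0 rP] := h _ e0; exists r => // k kr.
    have [->|k0] := eqVneq k 0; first by rewrite addr0 subrr mul0r subr0 Normc.normc0 mulr0.
    have /= := rP k; rewrite subr0 => /(_ kr k0)/ltW.
    rewrite -[k *: 1]/(k * 1) -[k^-1 *: _]/(k^-1 * _) mulr1 => H.
    have -> : f (z + k) - f z - k * d = k * (k^-1 * (f (k + z) - f z) - d).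
      by rewrite mulrBr mulrA mulfV// mul1r [k + z]addrC.
    by rewrite Normc.normcM mulrC ler_wpM2r ?normc_ge0.
  apply/cvgC_P => e e0; have e20 : 0 < e / 2 by rewrite divr_gt0.
  have [r r0 rP] := h _ e20; apply/nbhsC_P; exists r => // k; rewrite subr0 => kr k0.
  rewrite -[k *: 1]/(k * 1) -[k^-1 *: _]/(k^-1 * _) mulr1.
  have -> : k^-1 * (f (k + z) - f z) - d = k^-1 * (f (z + k) - f z - k * d).
    by rewrite [RHS]mulrBr mulrA mulVf// mul1r [k + z]addrC.
  rewrite Normc.normcM Normc.normcV; apply: (@le_lt_trans _ _ (e / 2)); last first.
    by rewrite ltr_pdivrMr// ltr_pMr// ltr1n.
  by rewrite mulrC ler_pdivrMr ?normc_gt0//; exact: rP.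
split=> [/key h|h].
  apply: DeriveDef; last exact/cvg_lim.
  by apply/cvg_ex; exists d.
by apply/key; have := @ex_derive _ _ _ _ _ _ _ h; rewrite /derivable => /cvgP; have := @derive_val _ _ _ _ _ _ _ h; rewrite /derive => ->.
Qed.

Lemma derivable_cderiv f z : derivable f z 1 -> cderiv f z (f^`() z).
Proof. by move=> df; apply/cderiv_is_derive; rewrite derive1E; exact: derivableP. Qed.

Lemma cderiv_derivable f z d : cderiv f z d -> derivable f z 1.
Proof. by move=> /cderiv_is_derive h; exact: ex_derive. Qed.

Lemma cderiv_derive1 f z d : cderiv f z d -> f^`() z = d.
Proof. by move=> /cderiv_is_derive h; rewrite derive1E derive_val. Qed.

Lemma cderiv_continuous f z d : cderiv f z d -> {for z, continuous f}.
Proof.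
move=> fd; apply/continuousC_P => e e0.
have [r r0 rP] := fd 1 ltr01; pose K := 1 + N d.
have K0 : 0 < K by rewrite ltr_pwDl// normc_ge0.
exists (Num.min r (e / K)); first by rewrite lt_min r0 divr_gt0.
move=> w; rewrite lt_min => /andP[wr we].
have := rP _ wr; rewrite mul1r [z + _]addrC subrK => H.
have -> : f w - f z = (f w - f z - (w - z) * d) + (w - z) * d by rewrite subrK.
apply: le_lt_trans (normcD _ _) _; rewrite Normc.normcM.
apply: (@le_lt_trans _ _ (N (w - z) * K)); last by rewrite -ltr_pdivlMr.
by rewrite /K mulrDr mulr1 lerD2r.
Qed.

End ComplexModulus.

(** * Integrals of complex functions over the unit interval *)

Section PathIntegral.
Variable R : realType.
Local Notation C := R[i]^o.
Local Notation N := (@Normc.normc R).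
Local Notation mu := (@lebesgue_measure R).
Local Notation I01 := (`[0%R, 1%R]%classic : set (measurableTypeR R)).
Implicit Types (g h : R -> C).

Definition path_integrable g := mu.-integrable I01 (EFin \o (fun t => complex.Re (g t)))
  /\ mu.-integrable I01 (EFin \o (fun t => complex.Im (g t))).

Definition path_integral g : C :=
  (\int[mu]_(t in I01) complex.Re (g t)) +i* (\int[mu]_(t in I01) complex.Im (g t)).

Lemma continuous_path_integrable g :
  (forall t, 0 <= t <= 1 -> {for t, continuous g}) -> path_integrable g.
Proof.
move=> cg; split; apply: continuous_compact_integrable => //;
  try exact: segment_compact;
  apply: continuous_in_subspaceT => t /[1!inE]/=; rewrite in_itv/= => t01;
  apply: (continuous_comp (cg t t01)).
- exact: continuous_Re.
- exact: continuous_Im.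
Qed.

Lemma complex_ReM (z w : C) : complex.Re (z * w) = complex.Re z * complex.Re w - complex.Im z * complex.Im w.
Proof. by case: z; case: w. Qed.
Lemma complex_ImM (z w : C) : complex.Im (z * w) = complex.Re z * complex.Im w + complex.Im z * complex.Re w.
Proof. by case: z; case: w. Qed.

Lemma path_integral_linear (c : C) g h : path_integrable g -> path_integrable h ->
  path_integrable (fun t => c * g t + h t) /\
  path_integral (fun t => c * g t + h t) = c * path_integral g + path_integral h.
Proof.
move=> [g1 g2] [h1 h2].
have mI : measurable I01 by [].
pose x := complex.Re c; pose y := complex.Im c.
have Z (k : R) (f : R -> R) : mu.-integrable I01 (EFin \o f) -> mu.-integrable I01 (EFin \o (fun t => k * f t)).
  by move=> fi; exact: (integrableZl mI k fi).
have D (f1 f2 : R -> R) : mu.-integrable I01 (EFin \o f1) -> mu.-integrable I01 (EFin \o f2) ->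
    mu.-integrable I01 (EFin \o (fun t => f1 t + f2 t)).
  by move=> i1 i2; exact: (integrableD mI i1 i2).
have ReE t : complex.Re (c * g t + h t) = x * complex.Re (g t) + (- y) * complex.Im (g t) + complex.Re (h t).
  by rewrite raddfD/= complex_ReM mulNr.
have ImE t : complex.Im (c * g t + h t) = x * complex.Im (g t) + y * complex.Re (g t) + complex.Im (h t).
  by rewrite raddfD/= complex_ImM.
have ReE' := funext ReE; have ImE' := funext ImE.
have iR := D _ _ (Z x _ g1) (Z (- y) _ g2).
have iI := D _ _ (Z x _ g2) (Z y _ g1).
split; [by split; rewrite ?ReE' ?ImE'; exact: D|].
rewrite /path_integral ReE' ImE' (RintegralD mI iR h1) (RintegralD mI iI h2).
rewrite (RintegralD mI (Z x _ g1) (Z (- y) _ g2)) (RintegralD mI (Z x _ g2) (Z y _ g1)) !RintegralZl//.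
apply/eqP; rewrite eq_complex; apply/andP; split; apply/eqP;
 rewrite raddfD/= ?complex_ReM ?complex_ImM/= -/x -/y; ring.
Qed.

(** Real and imaginary parts are bounded separately; this is the origin of the factor 2 in the
    contour estimates. *)
Lemma path_integral_bound g : path_integrable g ->
  forall K, (forall t, 0 <= t <= 1 -> N (g t) <= K) -> N (path_integral g) <= 2 * K.
Proof.
move=> [g1 g2] K gK; apply: le_trans (normc_le_ReIm _) _ => /=.
have mI : measurable I01 by [].
have mu1 : mu I01 = 1%E by rewrite lebesgue_measure_itv/= lte01 sube0.
have B (f : R -> R) : mu.-integrable I01 (EFin \o f) -> (forall t, 0 <= t <= 1 -> `|f t| <= K) ->
  `|\int[mu]_(t in I01) f t| <= K.
  move=> fi fK; apply: le_trans (le_normr_Rintegral mI fi) _.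
  have : \int[mu]_(t in I01) `|f t| <= \int[mu]_(t in I01) K.
    apply: le_Rintegral => //.
    - by have := integrable_norm fi.
    - apply: (@continuous_compact_integrable _ (cst K)); first exact: segment_compact.
      by apply: continuous_subspaceT => x; exact: cst_continuous.
  by rewrite Rintegral_cst// [X in fine X](_ : _ = 1%E) ?mulr1//; exact: mu1.
rewrite mulr_natl mulr2n; apply: lerD; apply: B => // t t01; apply: le_trans (gK t t01).
- exact: normr_Re_le.
- exact: normr_Im_le.
Qed.


Lemma eq_path_integral g h : (forall t, 0 <= t <= 1 -> g t = h t) ->
  path_integral g = path_integral h.
Proof.
by move=> gh; rewrite /path_integral; congr (_ +i* _); apply: eq_Rintegral => t;
  rewrite inE/= in_itv/= => /gh ->.
Qed.

Lemma path_integral_affine (g : R -> C) (a c : R) (D : set (measurableTypeR R)) :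
  a != 0 -> measurable D -> [set x | D (a * x + c)] = I01 ->
  mu.-integrable D (EFin \o (fun t => complex.Re (g t))) ->
  mu.-integrable D (EFin \o (fun t => complex.Im (g t))) ->
  (\int[mu]_(t in D) complex.Re (g t)) +i* (\int[mu]_(t in D) complex.Im (g t)) =
  `|a|%:C * path_integral (fun t => g (a * t + c)) :> C.
Proof.
move=> a0 mD DE iR iI; rewrite (integral_affine c a0 mD iR) (integral_affine c a0 mD iI) DE.
by rewrite /path_integral; apply/eqP; rewrite eq_complex/= !mul0r subr0 addr0 !eqxx.
Qed.

Lemma path_integral_rev g : path_integrable g ->
  path_integral (fun t => g (1 - t)) = path_integral g.
Proof.
move=> [gR gI]; rewrite {2}/path_integral (@path_integral_affine g (-1) 1)//.
- rewrite normrN1 mul1r; apply: eq_path_integral => t _.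
  by rewrite mulN1r addrC.
- apply/seteqP; split => x /=; rewrite !in_itv/=; lra.
Qed.

(** Both halves are rescaled to [[0, 1]], so that bisecting a segment becomes an identity between
    segment integrals, as the subdivision of triangles requires. *)
Lemma path_integral_split g : path_integrable g ->
  path_integral g = 2^-1%:C * path_integral (fun t => g (2^-1 * t)) +
    2^-1%:C * path_integral (fun t => g (2^-1 * t + 2^-1)).
Proof.
move=> [gR gI].
have h2 : (2^-1 : R) != 0 by rewrite invr_eq0 pnatr_eq0.
have n2 : `|2^-1 : R| = 2^-1 by rewrite ger0_norm// invr_ge0.
have sl : `[0%R, 2^-1%R]%classic `<=` I01.
  by move=> x /=; rewrite !in_itv/=; lra.
have sr : `]2^-1%R, 1%R]%classic `<=` I01.
  by move=> x /=; rewrite !in_itv/=; lra.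
have sr' : `[2^-1%R, 1%R]%classic `<=` I01.
  by move=> x /=; rewrite !in_itv/=; lra.
have B (f : R -> R) : mu.-integrable I01 (EFin \o f) ->
  \int[mu]_(t in I01) f t = \int[mu]_(t in `[0%R, 2^-1%R]) f t + \int[mu]_(t in `[2^-1%R, 1%R]) f t.
  move=> fi; rewrite -(@Rintegral_itv_obnd_cbnd _ 2^-1 (BRight 1) f); last exact: integrableS fi.
  by rewrite -(@Rintegral_itvB _ f (BLeft 0) (BRight 1) 2^-1)//= ?bnd_simp ?invr_ge0 ?ler0n ?invf_le1 ?ler1n// addrC subrK.
rewrite {1}/path_integral !B//.
have L := @path_integral_affine g 2^-1 0 `[0%R, 2^-1%R]%classic h2.
have RR := @path_integral_affine g 2^-1 2^-1 `[2^-1%R, 1%R]%classic h2.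
transitivity ((\int[mu]_(t in `[0%R, 2^-1%R]) complex.Re (g t)) +i* (\int[mu]_(t in `[0%R, 2^-1%R]) complex.Im (g t))
  + (\int[mu]_(t in `[2^-1%R, 1%R]) complex.Re (g t)) +i* (\int[mu]_(t in `[2^-1%R, 1%R]) complex.Im (g t)) : C).
  by [].
rewrite L ?RR ?n2 //; try (by apply: integrableS gR); try (by apply: integrableS gI).
- by congr (_ * _ + _); apply: eq_path_integral => t _; rewrite addr0.
- apply/seteqP; split => x /=; rewrite !in_itv/=; lra.
- apply/seteqP; split => x /=; rewrite !in_itv/=; lra.
Qed.

End PathIntegral.

(** * Segment integrals and the fundamental theorem of calculus *)

Section SegmentIntegral.
Variable R : realType.
Local Notation C := R[i]^o.
Local Notation N := (@Normc.normc R).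
Local Notation S := (@segment_integral R).
Implicit Types (a b z w : C) (f g h : C -> C).

Definition segment_continuous a b f :=
  forall t : R, 0 <= t <= 1 -> {for a + t%:C * (b - a), continuous f}.

Lemma continuous_segment_continuous a b f : continuous f -> segment_continuous a b f.
Proof. by move=> cf t _; exact: cf. Qed.

Lemma continuous_line a b : continuous (fun t : R => a + t%:C * (b - a) : C).
Proof.
move=> t; apply: cvgD; first exact: cvg_cst.
by apply: cvgM; [exact: continuous_real_complex|exact: cvg_cst].
Qed.

Lemma segment_path_integrable a b f : segment_continuous a b f ->
  path_integrable (fun t => f (a + t%:C * (b - a))).
Proof.
move=> cf; apply: continuous_path_integrable => t t01.
exact: (continuous_comp (continuous_line (x := t)) (cf t t01)).
Qed.

Lemma segment_integralE a b f :
  S a b f = (b - a) * path_integral (fun t => f (a + t%:C * (b - a))).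
Proof. by []. Qed.

Lemma segment_integral_linear (c : C) a b f g :
  segment_continuous a b f -> segment_continuous a b g ->
  S a b (fun z => c * f z + g z) = c * S a b f + S a b g.
Proof.
move=> /segment_path_integrable cf /segment_path_integrable cg.
by rewrite !segment_integralE (path_integral_linear c cf cg).2 mulrDr mulrCA.
Qed.

Lemma eq_segment_integral a b f g :
  (forall t : R, 0 <= t <= 1 -> f (a + t%:C * (b - a)) = g (a + t%:C * (b - a))) ->
  S a b f = S a b g.
Proof. by move=> fg; rewrite !segment_integralE (eq_path_integral fg). Qed.

Lemma segment_integral_bound a b f K : segment_continuous a b f ->
  (forall t : R, 0 <= t <= 1 -> N (f (a + t%:C * (b - a))) <= K) ->
  N (S a b f) <= 2 * N (b - a) * K.
Proof.
move=> /segment_path_integrable cf fK; rewrite segment_integralE Normc.normcM.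
rewrite [2 * _]mulrC -mulrA ler_wpM2l ?normc_ge0//.
exact: path_integral_bound.
Qed.

Lemma segment_integral_rev a b f : segment_continuous a b f -> S b a f = - S a b f.
Proof.
move=> /segment_path_integrable cf; rewrite !segment_integralE.
rewrite -(path_integral_rev cf) -mulNr opprB; congr (_ * _).
apply: eq_path_integral => t _; congr f.
rewrite real_complexB; ring.
Qed.

Lemma segment_integral_split a b f : segment_continuous a b f ->
  S a b f = S a (2^-1%:C * (a + b)) f + S (2^-1%:C * (a + b)) b f.
Proof.
move=> /segment_path_integrable cf; rewrite !segment_integralE.
rewrite (path_integral_split cf) mulrDr !mulrA.
have h2 : (2^-1%:C : C) * 2 = 1.
  have -> : (2 : C) = (2 : R)%:C by rewrite rmorphMn.
  by rewrite -real_complexM mulVf// pnatr_eq0.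
have e1 : 2^-1%:C * (a + b) - a = (b - a) * 2^-1%:C.
  by rewrite -[X in _ - X]mul1r -h2; ring.
have e2 : b - 2^-1%:C * (a + b) = (b - a) * 2^-1%:C.
  by rewrite -[X in X - _]mul1r -h2; ring.
rewrite e1 e2; congr (_ * _ + _ * _); apply: eq_path_integral => t _; congr f.
  by rewrite real_complexM; ring.
rewrite real_complexD real_complexM -[X in X + _ = _]mul1r -[X in _ = _ + X]mul1r -{1}h2; ring.
Qed.

Lemma is_derive_eps (F : R -> R) (x d : R) :
  (forall e : R, 0 < e -> exists2 r : R, 0 < r &
    forall k, `|k| < r -> `|F (x + k) - F x - k * d| <= e * `|k|) ->
  is_derive x 1 F d.
Proof.
move=> h.
have key : (fun k : R => k^-1 *: (F (k *: (1 : R) + x) - F x)) @ 0^' --> d.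
  apply/(@cvgrPdistC_le _ _ _ (0^')) => e e0.
  have [r r0 rP] := h _ e0; apply/nbhsR_P; exists r => // k; rewrite subr0 => kr k0.
  rewrite -[k *: 1]/(k * 1) -[k^-1 *: _]/(k^-1 * _) mulr1.
  have -> : k^-1 * (F (k + x) - F x) - d = k^-1 * (F (x + k) - F x - k * d).
    by rewrite [RHS]mulrBr mulrA mulVf// mul1r [k + x]addrC.
  by rewrite normrM normfV mulrC ler_pdivrMr ?normr_gt0//; exact: rP.
apply: DeriveDef; last exact/cvg_lim.
by apply/cvg_ex; exists d.
Qed.

(** The real fundamental theorem applies to [Q (h (l t))] for every additive, real-homogeneous,
    continuous [Q] bounded by the modulus. The two instances are the real and the imaginary part. *)
Lemma segment_FTC a b h h' :
  (forall t : R, 0 <= t <= 1 -> cderiv h (a + t%:C * (b - a)) (h' (a + t%:C * (b - a)))) ->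
  segment_continuous a b h' -> S a b h' = h b - h a.
Proof.
move=> dh ch'; have ih' := segment_path_integrable ch'.
pose l (t : R) : C := a + t%:C * (b - a).
(* The summand 0 only fits the integrand to the shape of [path_integral_linear]. *)
have -> : S a b h' = path_integral (fun t => (b - a) * h' (l t) + 0).
  have i0 : path_integrable (fun _ : R => 0 : C).
    by apply: continuous_path_integrable => t _; exact: cst_continuous.
  have -> : S a b h' = (b - a) * path_integral (fun t => h' (l t)) by [].
  rewrite (path_integral_linear (b - a) ih' i0).2.
  have : N (path_integral (fun _ : R => 0 : C)) <= 2 * 0.
    by apply: path_integral_bound => // t _; rewrite Normc.normc0.
  rewrite mulr0 => H.
  have : N (path_integral (fun _ : R => 0 : C)) == 0 by rewrite eq_le H normc_ge0.
  by rewrite normc_eq0 => /eqP ->; rewrite addr0.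
have cl : segment_continuous a b (fun z => (b - a) * h' z + 0).
  by move=> t t01; exact: (cvgD (cvgM (cvg_cst (b - a)) (ch' t t01)) (cvg_cst 0)).
have step (Q : C -> R) (Qadd : forall x y, Q (x + y) = Q x + Q y) (QZ : forall (k : R) x, Q (k%:C * x) = k * Q x)
   (Qle : forall z, `|Q z| <= N z) (cQ : continuous Q) :
   \int[lebesgue_measure]_(t in `[0%R, 1%R]) Q ((b - a) * h' (l t) + 0) = Q (h b) - Q (h a).
  have Qopp x : Q (- x) = - Q x.
    by have := QZ (-1) x; rewrite mulN1r rmorphN1 mulN1r.
  have dQ (t : R) : 0 <= t <= 1 -> is_derive t (1 : R) (fun t : R => Q (h (l t))) (Q ((b - a) * h' (l t) + 0)).
    move=> t01; apply: is_derive_eps => e e0; rewrite addr0.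
    pose K := 1 + N (b - a).
    have K0 : 0 < K by rewrite ltr_pwDl// normc_ge0.
    have [r r0 rP] := dh t t01 _ (divr_gt0 e0 K0).
    exists (r / K); first by rewrite divr_gt0.
    move=> k; rewrite ltr_pdivlMr// => kr.
    have lk : l (t + k) = l t + k%:C * (b - a).
      by rewrite /l real_complexD; ring.
    have nk : N (k%:C * (b - a)) <= `|k| * K.
      by rewrite Normc.normcM normc_real ler_wpM2l// lerDr.
    have := rP _ (le_lt_trans nk kr); rewrite -/(l t) -lk.
    rewrite -mulrA -QZ -!Qopp -!Qadd => H.
    apply: le_trans (Qle _) _; apply: le_trans H _.
    apply: (@le_trans _ _ (e / K * (`|k| * K))); first by rewrite ler_wpM2l// divr_ge0 ?ltW.
    by rewrite mulrCA -mulrA mulVf ?gt_eqF// mulr1 mulrC.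
  have cF (t : R) : 0 <= t <= 1 -> {for t, continuous (fun t : R => Q (h (l t)))}.
    move=> t01; apply: continuous_comp (cQ _).
    apply: (continuous_comp (continuous_line (x := t))).
    exact: cderiv_continuous (dh t t01).
  rewrite /Rintegral (@continuous_FTC2 _ _ (fun t : R => Q (h (l t))) 0 1)//.
  - have -> : l 1 = b by rewrite /l mul1r addrC subrK.
    by have -> : l 0 = a by rewrite /l mul0r addr0.
  - apply: continuous_in_subspaceT => t /[1!inE]/=; rewrite in_itv/= => t01.
    exact: (continuous_comp (continuous_comp (continuous_line (x := t)) (cl t t01)) (cQ _)).
  - split.
    + move=> t; rewrite in_itv/= => /andP[t0 t1]; have h0 : 0 <= t <= 1 by rewrite !ltW.
      exact: (@ex_derive _ _ _ _ _ _ _ (dQ t h0)).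
    + by apply: cvg_at_right_filter; apply: cF; rewrite lexx ler01.
    + by apply: cvg_at_left_filter; apply: cF; rewrite lexx ler01.
  - move=> t; rewrite in_itv/= => /andP[t0 t1]; have h0 : 0 <= t <= 1 by rewrite !ltW.
    by rewrite derive1E (@derive_val _ _ _ _ _ _ _ (dQ t h0)).
have ReZ (k : R) (x : C) : complex.Re (k%:C * x) = k * complex.Re x.
  by rewrite complex_ReM/= mul0r subr0.
have ImZ (k : R) (x : C) : complex.Im (k%:C * x) = k * complex.Im x.
  by rewrite complex_ImM/= mul0r addr0.
rewrite /path_integral (step (@complex.Re R))//; first last.
- exact: continuous_Re.
- exact: normr_Re_le.
- by move=> *; rewrite raddfD.
rewrite (step (@complex.Im R))//; first last.
- exact: continuous_Im.
- exact: normr_Im_le.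
- by move=> *; rewrite raddfD.
by case: (h b) => ? ?; case: (h a).
Qed.

End SegmentIntegral.

(** * Goursat's theorem for triangles *)

Section Goursat.
Variable R : realType.
Local Notation C := R[i]^o.
Local Notation N := (@Normc.normc R).
Local Notation S := (@segment_integral R).
Implicit Types (f h : C -> C).

Lemma geometric_small (e : R) : 0 < e -> exists n : nat, 2^-1 ^+ n < e.
Proof.
move=> e0.
have /cvgrPdist_lt/(_ _ e0)[n _ /(_ n (leqnn n))] : (fun n => 2^-1 ^+ n : R) @ \oo --> 0.
  by apply: cvg_expr; rewrite ger0_norm ?invr_ge0// invf_lt1// ltr1n.
rewrite sub0r normrN ger0_norm ?exprn_ge0 ?invr_ge0// => ne.
by exists n.
Qed.

Lemma le0_of_geometric (a c : R) : (forall n, a <= c * 2^-1 ^+ n) -> a <= 0.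
Proof.
move=> h; rewrite leNgt; apply/negP => a0.
have c0 : 0 < c by have := h 0%N; rewrite expr0 mulr1; exact: lt_le_trans.
have [n] := geometric_small (divr_gt0 a0 c0).
by rewrite ltr_pdivlMr// mulrC ltNge h.
Qed.

Lemma le0_of_eps (a c : R) : (forall e, 0 < e -> a <= c * e) -> a <= 0.
Proof. by move=> h; apply: (@le0_of_geometric a c) => n; apply: h; rewrite exprn_gt0// invr_gt0. Qed.

(** The intervals of radius [2^-1 ^+ n] about [x n] are nested, and the limit is the supremum of
    their left ends. The rate is kept because the bisection and the summation of power series both
    use it. *)
Lemma nested_limit (x : nat -> R) :
  (forall n, `|x n.+1 - x n| <= 2^-1 ^+ n.+1) ->
  exists l, forall n, `|x n - l| <= 2^-1 ^+ n.
Proof.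
move=> hx; pose q (n : nat) : R := 2^-1 ^+ n.
have qS n : q n = q n.+1 + q n.+1.
  by rewrite /q exprS; lra.
have q0 n : 0 <= q n by rewrite exprn_ge0 ?invr_ge0.
have lo n m : (n <= m)%N -> x n - q n <= x m - q m /\ x m + q m <= x n + q n.
  elim: m => [|m IH]; first by rewrite leqn0 => /eqP ->.
  rewrite leq_eqVlt => /predU1P[->//|]; rewrite ltnS => /IH[h1 h2].
  by have := hx m; rewrite ler_norml -/(q _) => /andP[]; have := qS m; split; lra.
have lohi n m : x n - q n <= x m + q m.
  have [h1 _] := lo n _ (leq_maxl n m); have [_ h2] := lo m _ (leq_maxr n m).
  by have := q0 (maxn n m); lra.
pose E := [set y | exists n, y = x n - q n].
have hE : has_sup E.
  by split; [exists (x 0 - q 0), 0%N|exists (x 0 + q 0) => _ [n ->]; exact: lohi].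
exists (sup E) => n; rewrite ler_norml; apply/andP; split.
  rewrite lerBrDl -lerBrDr opprK; apply: ge_sup; first by case: hE.
  by move=> _ [m ->]; exact: lohi.
rewrite lerBlDr -lerBlDl; apply: ub_le_sup; last by exists n.
by case: hE.
Qed.

Definition triangle_integral f (a b c : C) := S a b f + S b c f + S c a f.

Lemma triangle_integral_exact f h (a b c : C) :
  (forall z, cderiv h z (f z)) -> continuous f -> triangle_integral f a b c = 0.
Proof.
move=> dh cf; rewrite /triangle_integral.
by rewrite !(@segment_FTC _ _ _ h)//; do ?[by move=> t _; exact: cf]; ring.
Qed.

Definition simplex (x y : R) := [/\ 0 <= x, 0 <= y & x + y <= 1].

Lemma simplex_convex (x y x' y' t : R) : simplex x y -> simplex x' y' -> 0 <= t <= 1 ->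
  simplex (x + t * (x' - x)) (y + t * (y' - y)).
Proof.
move=> [x0 y0 xy] [x'0 y'0 xy'] /andP[t0 t1].
have t1' : 0 <= 1 - t by rewrite subr_ge0.
split.
- by have := mulr_ge0 t0 x'0; have := mulr_ge0 t1' x0; lra.
- by have := mulr_ge0 t0 y'0; have := mulr_ge0 t1' y0; lra.
have h1 : 0 <= t * (1 - (x' + y')) by rewrite mulr_ge0// subr_ge0.
have h2 : 0 <= (1 - t) * (1 - (x + y)) by rewrite mulr_ge0// subr_ge0.
lra.
Qed.

Section Bisection.
Variables (f : C -> C) (a u v : C).
Let pt (x y : R) : C := a + x%:C * u + y%:C * v.
Hypothesis df : forall x y, simplex x y -> exists d, cderiv f (pt x y) d.

Let cf x y : simplex x y -> {for pt x y, continuous f}.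
Proof. by move=> /df[d]; exact: cderiv_continuous. Qed.

Let pt_line x y x' y' (t : R) :
  pt x y + t%:C * (pt x' y' - pt x y) = pt (x + t * (x' - x)) (y + t * (y' - y)).
Proof. by rewrite /pt !(real_complexD, real_complexB, real_complexM); ring. Qed.

Let cs x y x' y' : simplex x y -> simplex x' y' -> segment_continuous (pt x y) (pt x' y') f.
Proof.
by move=> s s' t t01; rewrite pt_line; apply: cf; exact: simplex_convex.
Qed.

Let pt_mid x y x' y' : 2^-1%:C * (pt x y + pt x' y') = pt (2^-1 * (x + x')) (2^-1 * (y + y')).
Proof.
rewrite /pt !(real_complexD, real_complexM).
have h2 : (2^-1%:C : C) * 2 = 1.
  have -> : (2 : C) = (2 : R)%:C by rewrite rmorphMn.
  by rewrite -real_complexM mulVf// pnatr_eq0.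
by rewrite -[X in _ = X + _ + _]mul1r -h2; ring.
Qed.

(** A triangle of the subdivision is coded by one corner in simplex coordinates and a signed leg
    [s.2], parallel to both axes; a negative leg codes the inverted triangle in the centre. *)
Let T (s : R * R * R) := triangle_integral f (pt s.1.1 s.1.2) (pt (s.1.1 + s.2) s.1.2) (pt s.1.1 (s.1.2 + s.2)).
Let inv (s : R * R * R) := [/\ simplex s.1.1 s.1.2, simplex (s.1.1 + s.2) s.1.2 & simplex s.1.1 (s.1.2 + s.2)].

Let child (s : R * R * R) (k : 'I_4) : R * R * R :=
  let l := 2^-1 * s.2 in
  match val k with
  | 0%N => (s.1.1, s.1.2, l)
  | 1%N => (s.1.1 + l, s.1.2, l)
  | 2%N => (s.1.1, s.1.2 + l, l)
  | _ => (s.1.1 + l, s.1.2 + l, - l)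
  end.

Let inv_child s k : inv s -> inv (child s k).
Proof.
case: s => [[x y] l] [] /= [? ? ?] [? ? ?] [? ? ?].
by case: k => [[|[|[|[|j]]]] jlt] //=; split; split; rewrite /=; lra.
Qed.

(** The edges between the central child and the three others are traversed in both directions and
    cancel. *)
Let T_child s : inv s -> T s = \sum_(k < 4) T (child s k).
Proof.
case: s => [[x y] l] /[dup] i0 [] /= s1 s2 s3.
rewrite !big_ord_recl big_ord0 /T /triangle_integral /child/=.
have [_ s4 s5] := inv_child (Ordinal (isT : (0 < 4)%N)) i0.
have [s6 _ _] := inv_child (Ordinal (isT : (3 < 4)%N)) i0.
rewrite /child/= in s4 s5 s6.
rewrite (segment_integral_split (cs s1 s2)) (segment_integral_split (cs s2 s3)) (segment_integral_split (cs s3 s1)).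
rewrite !pt_mid.
have -> : 2^-1 * (x + (x + l)) = x + 2^-1 * l by lra.
have -> : 2^-1 * (y + y) = y by lra.
have -> : 2^-1 * (x + l + x) = x + 2^-1 * l by lra.
have -> : 2^-1 * (y + (y + l)) = y + 2^-1 * l by lra.
have -> : 2^-1 * (x + x) = x by lra.
have -> : 2^-1 * (y + l + y) = y + 2^-1 * l by lra.
have -> : x + 2^-1 * l + 2^-1 * l = x + l by lra.
have -> : y + 2^-1 * l + 2^-1 * l = y + l by lra.
have -> : x + 2^-1 * l - 2^-1 * l = x by lra.
have -> : y + 2^-1 * l - 2^-1 * l = y by lra.
rewrite (segment_integral_rev (cs s4 s6)) (segment_integral_rev (cs s6 s5)) (segment_integral_rev (cs s5 s4)).
move: (pt x y) (pt (x + l) y) (pt x (y + l)) (pt (x + 2^-1 * l) y) (pt x (y + 2^-1 * l))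
  (pt (x + 2^-1 * l) (y + 2^-1 * l)) => p1 p2 p3 p4 p5 p6.
move: (@segment_integral R) => I.
by ring.
Qed.

(** Some child carries at least a quarter of the integral. The chosen triangles shrink to a point
    where [f] is differentiable; once the affine part of [f] there is removed, the integrand is [e]
    times the diameter, and diameter and perimeter both halve at each step, which beats the factor
    4. *)
Lemma goursat : triangle_integral f a (a + u) (a + v) = 0.
Proof.
have [step stepP] : {step : R * R * R -> R * R * R & forall s, inv s ->
    [/\ inv (step s), `|(step s).2| = 2^-1 * `|s.2|, `|(step s).1.1 - s.1.1| <= 2^-1 * `|s.2|,
       `|(step s).1.2 - s.1.2| <= 2^-1 * `|s.2| & N (T s) <= 4 * N (T (step s))]}.
  apply: (@choice _ _ (fun s s' => inv s -> [/\ inv s', `|s'.2| = 2^-1 * `|s.2|,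
      `|s'.1.1 - s.1.1| <= 2^-1 * `|s.2|, `|s'.1.2 - s.1.2| <= 2^-1 * `|s.2| & N (T s) <= 4 * N (T s')])) => s.
  (* Outside the invariant any value will do, and [s] serves as default. *)
  have [i_s|?] := pselect (inv s); last by exists s.
  have [k kP] : exists k, N (T s) <= 4 * N (T (child s k)).
    apply: contrapT => /forallNP H.
    have : N (T s) < N (T s).
      rewrite {1}(T_child i_s); apply: le_lt_trans (normc_sum _ _ _) _.
      have H' k : N (T (child s k)) < 4^-1 * N (T s).
        by rewrite -ltr_pdivrMl ?invr_gt0// invrK; have /negP := H k; rewrite -ltNge.
      have aux (X y1 y2 y3 y4 : R) : y1 < 4^-1 * X -> y2 < 4^-1 * X -> y3 < 4^-1 * X ->
        y4 < 4^-1 * X -> y1 + (y2 + (y3 + (y4 + 0))) < X by lra.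
      by rewrite !big_ord_recl big_ord0; apply: aux; exact: H'.
    by rewrite ltxx.
  exists (child s k) => _.
  have n2 : `|2^-1 * s.2| = 2^-1 * `|s.2| by rewrite normrM ger0_norm// invr_ge0.
  have g2 : 0 <= 2^-1 * `|s.2| by rewrite mulr_ge0// invr_ge0.
  split => //; first exact: inv_child.
  - by case: k {kP} => [[|[|[|[|j]]]] jlt] //=; rewrite ?normrN n2.
  - by case: k {kP} => [[|[|[|[|j]]]] jlt] //=; rewrite ?subrr ?normr0// addrC addrA addNr add0r n2.
  - by case: k {kP} => [[|[|[|[|j]]]] jlt] //=; rewrite ?subrr ?normr0// addrC addrA addNr add0r n2.
pose s n := iter n step (0, 0, 1).
have sS n : s n.+1 = step (s n) by [].
have i_s n : inv (s n).
  elim: n => [|n IH]; last by rewrite sS; have [] := stepP _ IH.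
  by split; split; rewrite /=; lra.
have ls n : `|(s n).2| = 2^-1 ^+ n.
  elim: n => [|n IH]; first by rewrite /= normr1.
  by rewrite sS; have [_ -> _ _ _] := stepP _ (i_s n); rewrite IH exprS.
have [x xP] : exists x, forall n, `|(s n).1.1 - x| <= 2^-1 ^+ n.
  apply: nested_limit => n; rewrite exprS -ls sS; by have [] := stepP _ (i_s n).
have [y yP] : exists x, forall n, `|(s n).1.2 - x| <= 2^-1 ^+ n.
  apply: nested_limit => n; rewrite exprS -ls sS; by have [] := stepP _ (i_s n).
have Ts n : N (T (s 0%N)) <= 4 ^+ n * N (T (s n)).
  elim: n => [|n IH]; first by rewrite expr0 mul1r.
  apply: le_trans IH _; rewrite exprSr -mulrA ler_wpM2l ?exprn_ge0// sS.
  by have [] := stepP _ (i_s n).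
have sxy : simplex x y.
  split.
  - rewrite -oppr_le0; apply: (@le0_of_geometric _ 1) => n.
    by have [[h _ _] _ _] := i_s n; move: (xP n) h; rewrite ler_norml => /andP[];
      move: (s n).1.1 (2^-1 ^+ n) => *; lra.
  - rewrite -oppr_le0; apply: (@le0_of_geometric _ 1) => n.
    by have [[_ h _] _ _] := i_s n; move: (yP n) h; rewrite ler_norml => /andP[];
      move: (s n).1.2 (2^-1 ^+ n) => *; lra.
  - rewrite -subr_le0; apply: (@le0_of_geometric _ 2) => n.
    by have [[_ _ h] _ _] := i_s n; move: (xP n) (yP n) h; rewrite !ler_norml => /andP[+ +] /andP[];
      move: (s n).1.1 (s n).1.2 (2^-1 ^+ n) => *; lra.
have [d dP] := df sxy.
pose D := N u + N v + 1.
have D1 : 1 <= D by rewrite lerDr addr_ge0 ?normc_ge0.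
have D0 : 0 < D by exact: lt_le_trans D1.
(* With [q = 2^-n] each side contributes at most [4 q^2 D^2 e]; three sides and the factor [4^n]
   give [12 D^2 e], which leaves room below 48. *)
suff H e : 0 < e -> N (T (s 0%N)) <= 48 * D ^+ 2 * e.
  have := le0_of_eps H => H'.
  have /eqP : N (T (s 0%N)) == 0 by rewrite eq_le H' normc_ge0.
  move=> /Normc.eq0_normc; rewrite /T/= /pt !add0r.
  by rewrite !mul0r !addr0 !mul1r.
move=> e0; have [r r0 rP] := dP e e0.
have [n nP] := geometric_small (divr_gt0 r0 (mulr_gt0 (ltr0n R 4%N) D0)).
apply: le_trans (Ts n) _.
pose q : R := 2^-1 ^+ n; have q0 : 0 < q by rewrite exprn_gt0// invr_gt0.
have qE : 4 ^+ n * (q * q) = 1.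
  by rewrite /q -expr2 -exprM mulnC exprM -exprMn -[X in _ = X](expr1n _ n); congr (_ ^+ _); lra.
(* The affine approximation of [f] at the limit point. It has a quadratic primitive, hence integral
   0 over every triangle, and only the error [E] remains. *)
pose A z := f (pt x y) + (z - pt x y) * d.
pose E z := f z - A z.
have cA : continuous A.
  move=> z; have cz : {for z, continuous (fun x0 : C => x0 - pt x y)}.
    exact: (cvgB cvg_id (cvg_cst (pt x y))).
  exact: (cvgD (cvg_cst (f (pt x y))) (cvgM cz (cvg_cst d))).
have [is1 is2 is3] := i_s n.
have TA : triangle_integral A (pt (s n).1.1 (s n).1.2) (pt ((s n).1.1 + (s n).2) (s n).1.2) (pt (s n).1.1 ((s n).1.2 + (s n).2)) = 0.
  apply: (@triangle_integral_exact _ (fun z => (f (pt x y) - pt x y * d) * z + 2^-1%:C * d * z ^+ 2)) => // z.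
  move=> e' e'0; pose K := N (2^-1%:C * d) + 1.
  have K0 : 0 < K by rewrite ltr_wpDl ?normc_ge0.
  exists (e' / K); first by rewrite divr_gt0.
  move=> h; rewrite ltr_pdivlMr// => hK.
  have -> : (f (pt x y) - pt x y * d) * (z + h) + 2^-1%:C * d * (z + h) ^+ 2 -
     ((f (pt x y) - pt x y * d) * z + 2^-1%:C * d * z ^+ 2) - h * A z = 2^-1%:C * d * h * h.
    have h2 : (2^-1%:C : C) * 2 = 1.
      have -> : (2 : C) = (2 : R)%:C by rewrite rmorphMn.
      by rewrite -real_complexM mulVf// pnatr_eq0.
    have -> : forall (F P d c z h : C), (F - P * d) * (z + h) + c * d * (z + h) ^+ 2 -
       ((F - P * d) * z + c * d * z ^+ 2) - h * (F + (z - P) * d) =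
       (c * 2) * (d * z * h) - d * z * h + c * d * h * h by move=> *; ring.
    by rewrite h2 mul1r subrr add0r.
  rewrite Normc.normcM ler_wpM2r ?normc_ge0// Normc.normcM mulrC.
  by apply: ltW; apply: le_lt_trans hK; rewrite ler_wpM2l ?normc_ge0// lerDl.
have cE x1 y1 : simplex x1 y1 -> {for pt x1 y1, continuous E}.
  by move=> h; exact: (cvgB (cf h) (cA (pt x1 y1))).
have nu (k : R) : N (k%:C * u) <= `|k| * D.
  by rewrite Normc.normcM normc_real ler_wpM2l// /D; have := normc_ge0 v; lra.
have nuv (k k' : R) z : `|k| <= z -> `|k'| <= z -> N (k%:C * u + k'%:C * v) <= z * D.
  move=> kz kz'; apply: le_trans (normcD _ _) _; rewrite !Normc.normcM !normc_real /D !mulrDr.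
  rewrite -[leLHS]addr0; apply: lerD; last by rewrite mulr1; apply: le_trans kz.
  by apply: lerD; apply: ler_wpM2r => //; exact: normc_ge0.
have side x1 y1 x2 y2 : simplex x1 y1 -> simplex x2 y2 ->
   `|x1 - x| <= 2 * q -> `|x2 - x| <= 2 * q -> `|y1 - y| <= 2 * q -> `|y2 - y| <= 2 * q ->
   `|x2 - x1| <= q -> `|y2 - y1| <= q ->
   N (S (pt x1 y1) (pt x2 y2) f - S (pt x1 y1) (pt x2 y2) A) <= 2 * (q * D) * (e * (2 * q * D)).
  move=> s1 s2 hx1 hx2 hy1 hy2 hx hy.
  have -> : S (pt x1 y1) (pt x2 y2) f - S (pt x1 y1) (pt x2 y2) A = S (pt x1 y1) (pt x2 y2) E.
    have := @segment_integral_linear _ (-1) (pt x1 y1) (pt x2 y2) A f (continuous_segment_continuous cA) (cs s1 s2).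
    rewrite mulN1r addrC => <-; apply: eq_segment_integral => t _.
    by rewrite /E mulN1r addrC.
  apply: le_trans.
    apply: (@segment_integral_bound _ _ _ _ (e * (2 * q * D))).
      by move=> t t01; rewrite pt_line; apply: cE; exact: simplex_convex.
    move=> t t01; rewrite pt_line.
    set x3 := x1 + _; set y3 := y1 + _.
    have cvx (p1 p2 p : R) : `|p1 - p| <= 2 * q -> `|p2 - p| <= 2 * q -> `|p1 + t * (p2 - p1) - p| <= 2 * q.
      move=> h1 h2; have -> : p1 + t * (p2 - p1) - p = (1 - t) * (p1 - p) + t * (p2 - p) by ring.
      case/andP: t01 => t0 t1; apply: le_trans (ler_normD _ _) _.
      rewrite !normrM (ger0_norm t0) (@ger0_norm _ (1 - t)) ?subr_ge0//.
      have : t * `|p2 - p| <= t * (2 * q) by rewrite ler_wpM2l.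
      have : (1 - t) * `|p1 - p| <= (1 - t) * (2 * q) by rewrite ler_wpM2l ?subr_ge0.
      lra.
    have nz : N (pt x3 y3 - pt x y) <= 2 * q * D.
      have -> : pt x3 y3 - pt x y = (x3 - x)%:C * u + (y3 - y)%:C * v.
        by rewrite /pt !real_complexB; ring.
      by apply: nuv; apply: cvx.
    have := rP (pt x3 y3 - pt x y).
    rewrite [_ + (_ - _)]addrC subrK /E /A => H.
    have -> : f (pt x3 y3) - (f (pt x y) + (pt x3 y3 - pt x y) * d) =
       f (pt x3 y3) - f (pt x y) - (pt x3 y3 - pt x y) * d by ring.
    apply: le_trans (H _) _; last by rewrite ler_wpM2l// ltW.
    apply: le_lt_trans nz _; move: nP; rewrite -/q ltr_pdivlMr ?mulr_gt0//; apply: le_lt_trans.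
    have qD : 0 < q * D by rewrite mulr_gt0.
    by lra.
  rewrite ler_wpM2r//; first by rewrite mulr_ge0 ?ltW// !mulr_gt0.
  rewrite ler_wpM2l//.
  have -> : pt x2 y2 - pt x1 y1 = (x2 - x1)%:C * u + (y2 - y1)%:C * v.
    by rewrite /pt !real_complexB; ring.
  exact: nuv.
have q2 : q <= 2 * q by lra.
have lq := ls n; rewrite -/q in lq.
have xq := xP n; have yq := yP n; rewrite -/q in xq yq.
have tq p1 p (k : R) : `|p1 - p| <= q -> `|k| = q -> `|p1 + k - p| <= 2 * q.
  by move=> h1 h2; rewrite addrAC; apply: le_trans (ler_normD _ _) _; rewrite h2; lra.
have HT : N (T (s n)) <= 3 * (2 * (q * D) * (e * (2 * q * D))).
  rewrite -[T (s n)]subr0 -TA /T /triangle_integral.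
  set S1 := S _ _ f; set S2 := S _ _ f; set S3 := S _ _ f.
  set A1 := S _ _ A; set A2 := S _ _ A; set A3 := S _ _ A.
  have -> : S1 + S2 + S3 - (A1 + A2 + A3) = (S1 - A1) + (S2 - A2) + (S3 - A3).
    by move: S1 S2 S3 A1 A2 A3 => ? ? ? ? ? ?; ring.
  have h1 : N (S1 - A1) <= 2 * (q * D) * (e * (2 * q * D)).
    apply: side => //; try exact: tq; try exact: (le_trans _ q2).
    - by rewrite addrC addKr lq.
    - by rewrite subrr normr0 ltW.
  have h2 : N (S2 - A2) <= 2 * (q * D) * (e * (2 * q * D)).
    apply: side => //; try exact: tq; try exact: (le_trans _ q2).
    - by rewrite opprD addrA subrr add0r normrN lq.
    - by rewrite addrC addKr lq.
  have h3 : N (S3 - A3) <= 2 * (q * D) * (e * (2 * q * D)).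
    apply: side => //; try exact: tq; try exact: (le_trans _ q2).
    - by rewrite subrr normr0 ltW.
    - by rewrite opprD addrA subrr add0r normrN lq.
  have -> (B : R) : 3 * B = B + B + B by ring.
  by apply: le_trans (normcD _ _) (lerD (le_trans (normcD _ _) (lerD h1 h2)) h3).
apply: (@le_trans _ _ (4 ^+ n * (3 * (2 * (q * D) * (e * (2 * q * D)))))).
  by rewrite ler_wpM2l// exprn_ge0.
have -> : 4 ^+ n * (3 * (2 * (q * D) * (e * (2 * q * D)))) = (4 ^+ n * (q * q)) * (12 * D ^+ 2 * e) by ring.
rewrite qE mul1r; have : 0 <= D ^+ 2 * e by rewrite mulr_ge0 ?exprn_ge0 ?ltW.
lra.
Qed.

End Bisection.
End Goursat.

(** * Goursat's theorem with an exceptional vertex *)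

Section Cauchy.
Variable R : realType.
Local Notation C := R[i]^o.
Local Notation N := (@Normc.normc R).
Local Notation S := (@segment_integral R).
Implicit Types (f g h : C -> C).

Lemma half_complex : (2^-1%:C : C) + 2^-1%:C = 1.
Proof. by rewrite -real_complexD -[RHS]/(1%:C); congr (_%:C); lra. Qed.

(** Differentiability may fail at the vertex [w]. Halving the two sides at [w] cuts off two
    triangles that avoid [w], so the integral is unchanged when the triangle shrinks towards [w];
    there [g] is bounded by continuity and the perimeter tends to 0. *)
Lemma goursat_vertex g (w b c : C) : continuous g ->
  (forall z, z != w -> exists d, cderiv g z d) ->
  (forall t : R, 0 <= t <= 1 -> b + t%:C * (c - b) != w) ->
  triangle_integral g w b c = 0.
Proof.
move=> cg dg bcw; pose u := b - w; pose v := c - w.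
(* If the combination of [u] and [v] vanished, the point of the opposite side with weights
   proportional to [x] and [y] would be [w]. *)
have nz (x y : R) : 0 <= x -> 0 <= y -> 0 < x + y -> w + x%:C * u + y%:C * v != w.
  move=> x0 y0 xy; apply/eqP => /eqP; rewrite -addrA addrC -subr_eq0 addrK => /eqP E.
  have t01 : 0 <= y / (x + y) <= 1.
    by apply/andP; split; [rewrite divr_ge0// ltW|rewrite ler_pdivrMr// mul1r lerDr].
  have /eqP := bcw _ t01; apply.
  have xyc : ((x + y)%:C : C) != 0.
    by apply/eqP => /(congr1 (@complex.Re R))/=; apply/eqP; rewrite gt_eqF.
  apply: (mulfI xyc).
  have -> : b = u + w by rewrite /u subrK.
  have -> : c = v + w by rewrite /v subrK.
  have E2 : (x + y)%:C * (y / (x + y))%:C = y%:C :> C.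
    by rewrite -real_complexM mulrC mulfVK// gt_eqF.
  rewrite mulrDr mulrA E2.
  rewrite real_complexD; transitivity (x%:C * u + y%:C * v + (x%:C + y%:C) * w); first by ring.
  by rewrite E add0r.
have step (p q : C) : (forall x y : R, 0 <= x -> 0 <= y -> 0 < x + y -> w + x%:C * p + y%:C * q != w) ->
    triangle_integral g w (w + p) (w + q) = triangle_integral g w (w + 2^-1%:C * p) (w + 2^-1%:C * q).
  move=> pq; have scg x y : segment_continuous x y g by exact: continuous_segment_continuous.
  have z1 : triangle_integral g (w + 2^-1%:C * p) (w + p) (w + q) = 0.
    have := @goursat _ g (w + 2^-1%:C * p) (2^-1%:C * p) (2^-1%:C * - p + q).
    have -> : w + 2^-1%:C * p + 2^-1%:C * p = w + p.
      by rewrite -addrA -mulrDl half_complex mul1r.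
    have -> : w + 2^-1%:C * p + (2^-1%:C * - p + q) = w + q by ring.
    apply => x y [x0 y0 xy1]; apply: dg.
    have -> : w + 2^-1%:C * p + x%:C * (2^-1%:C * p) + y%:C * (2^-1%:C * - p + q) =
              w + (2^-1 * (1 + x - y))%:C * p + y%:C * q.
      by rewrite !(real_complexM, real_complexD, real_complexB); ring.
    by apply: pq; lra.
  have z2 : triangle_integral g (w + 2^-1%:C * p) (w + q) (w + 2^-1%:C * q) = 0.
    have := @goursat _ g (w + 2^-1%:C * p) (q - 2^-1%:C * p) (2^-1%:C * q - 2^-1%:C * p).
    have -> : w + 2^-1%:C * p + (q - 2^-1%:C * p) = w + q by ring.
    have -> : w + 2^-1%:C * p + (2^-1%:C * q - 2^-1%:C * p) = w + 2^-1%:C * q by ring.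
    apply => x y [x0 y0 xy1]; apply: dg.
    have -> : w + 2^-1%:C * p + x%:C * (q - 2^-1%:C * p) + y%:C * (2^-1%:C * q - 2^-1%:C * p) =
              w + (2^-1 * (1 - x - y))%:C * p + (x + 2^-1 * y)%:C * q.
      by rewrite !(real_complexM, real_complexD, real_complexB); ring.
    by apply: pq; lra.
  transitivity (triangle_integral g w (w + 2^-1%:C * p) (w + 2^-1%:C * q) +
     triangle_integral g (w + 2^-1%:C * p) (w + p) (w + q) +
     triangle_integral g (w + 2^-1%:C * p) (w + q) (w + 2^-1%:C * q)); last first.
    by rewrite z1 z2 !addr0.
  rewrite /triangle_integral (segment_integral_split (scg w (w + p))) (segment_integral_split (scg (w + q) w)).
  have -> : 2^-1%:C * (w + (w + p)) = w + 2^-1%:C * p.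
    by rewrite !mulrDr addrA -mulrDl half_complex mul1r.
  have -> : 2^-1%:C * (w + q + w) = w + 2^-1%:C * q.
    by rewrite [w + q + w]addrC !mulrDr addrA -mulrDl half_complex mul1r.
  rewrite (segment_integral_rev (scg (w + 2^-1%:C * p) (w + q))).
  rewrite (segment_integral_rev (scg (w + 2^-1%:C * p) (w + 2^-1%:C * q))).
  move: (w + 2^-1%:C * p) (w + 2^-1%:C * q) (w + p) (w + q) => p1 p2 p3 p4.
  by move: (@segment_integral R) => I; ring.
have Tn n : triangle_integral g w b c = triangle_integral g w (w + (2^-1 ^+ n)%:C * u) (w + (2^-1 ^+ n)%:C * v).
  elim: n => [|n ->]; first by rewrite expr0 !mul1r /u /v ![w + (_ - w)]addrC !subrK.
  rewrite step; first by rewrite exprS real_complexM -!mulrA.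
  move=> x y x0 y0 xy; rewrite !mulrA -!real_complexM.
  have q0 : 0 < 2^-1 ^+ n :> R by rewrite exprn_gt0// invr_gt0.
  by apply: nz; rewrite -?mulrDl ?mulr_gt0 ?mulr_ge0// ltW.
pose K := N (g w) + 1; pose D := N u + N v + 1.
have K0 : 0 < K by rewrite ltr_wpDl ?normc_ge0.
have D0 : 0 < D by rewrite ltr_wpDl// addr_ge0 ?normc_ge0.
(* Three sides, each of length at most [q * D], with the factor 2 of the segment bound and [K]
   bounding [g] near [w]. *)
suff H e : 0 < e -> N (triangle_integral g w b c) <= (6 * D * K) * e.
  have /eqP : N (triangle_integral g w b c) == 0 by rewrite eq_le (le0_of_eps H) normc_ge0.
  by move=> /Normc.eq0_normc.
move=> e0; have [r r0 rP] := (continuousC_P g w).1 (cg w) 1 ltr01.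
have er : 0 < Num.min e (r / D) by rewrite lt_min e0 divr_gt0.
have [n] := geometric_small er; rewrite lt_min => /andP[ne nr].
rewrite (Tn n).
have q0 : 0 < 2^-1 ^+ n :> R by rewrite exprn_gt0// invr_gt0.
move: (2^-1 ^+ n) q0 ne nr => q q0 qe; rewrite ltr_pdivlMr// => qr.
have bd (x y x' y' : R) : 0 <= x <= 1 -> 0 <= y <= 1 -> x + y <= 1 -> 0 <= x' <= 1 -> 0 <= y' <= 1 -> x' + y' <= 1 ->
  N (S (w + x%:C * (q%:C * u) + y%:C * (q%:C * v)) (w + x'%:C * (q%:C * u) + y'%:C * (q%:C * v)) g) <= 2 * (q * D) * K.
  move=> /andP[x0 x1] /andP[y0 y1] xy /andP[x'0 x'1] /andP[y'0 y'1] xy'.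
  have nuv (k k' : R) : `|k| <= 1 -> `|k'| <= 1 -> N (k%:C * (q%:C * u) + k'%:C * (q%:C * v)) <= q * D.
    move=> h1 h2; apply: le_trans (normcD _ _) _; rewrite !Normc.normcM !normc_real (gtr0_norm q0) /D.
    have : `|k| * (q * N u) <= q * N u by rewrite ler_piMl// mulr_ge0 ?normc_ge0// ltW.
    have : `|k'| * (q * N v) <= q * N v by rewrite ler_piMl// mulr_ge0 ?normc_ge0// ltW.
    by move: (N u) (N v) => *; lra.
  apply: le_trans.
    apply: (@segment_integral_bound _ _ _ _ K); first exact: continuous_segment_continuous.
    move=> t /andP[t0 t1]; set z := _ + t%:C * _.
    have -> : g z = (g z - g w) + g w by rewrite subrK.
    apply: le_trans (normcD _ _) _; rewrite addrC lerD2l ltW//; apply: rP.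
    have -> : z - w = (x + t * (x' - x))%:C * (q%:C * u) + (y + t * (y' - y))%:C * (q%:C * v).
      by rewrite /z !(real_complexM, real_complexD, real_complexB); ring.
    apply: le_lt_trans qr; apply: nuv.
      have h1 : 0 <= t * x' by rewrite mulr_ge0.
      have h2 : t * x' <= t by rewrite ler_piMr.
      have h3 : 0 <= (1 - t) * x by rewrite mulr_ge0// subr_ge0.
      have h4 : (1 - t) * x <= 1 - t by rewrite ler_piMr// subr_ge0.
      by rewrite ler_norml; apply/andP; split; lra.
    have h1 : 0 <= t * y' by rewrite mulr_ge0.
    have h2 : t * y' <= t by rewrite ler_piMr.
    have h3 : 0 <= (1 - t) * y by rewrite mulr_ge0// subr_ge0.
    have h4 : (1 - t) * y <= 1 - t by rewrite ler_piMr// subr_ge0.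
    by rewrite ler_norml; apply/andP; split; lra.
  apply: ler_wpM2r; first exact: ltW.
  rewrite ler_wpM2l//.
  have -> : (w + x'%:C * (q%:C * u) + y'%:C * (q%:C * v)) - (w + x%:C * (q%:C * u) + y%:C * (q%:C * v)) =
     (x' - x)%:C * (q%:C * u) + (y' - y)%:C * (q%:C * v) by rewrite !real_complexB; ring.
  by apply: nuv; rewrite ler_norml; apply/andP; split; lra.
have b1 := bd 0 0 1 0; have b2 := bd 1 0 0 1; have b3 := bd 0 1 0 0.
rewrite !(mul0r, mul1r, addr0, lexx, ler01, ler0n) !(add0r, lexx, ler01) in b1 b2 b3.
apply: (@le_trans _ _ (3 * (2 * (q * D) * K))); last first.
  have -> : 3 * (2 * (q * D) * K) = 6 * D * K * q by ring.
  by apply: ler_wpM2l (ltW qe); rewrite ltW// mulr_gt0// mulr_gt0.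
have -> (B : R) : 3 * B = B + B + B by ring.
rewrite /triangle_integral.
by apply: le_trans (normcD _ _) (lerD (le_trans (normcD _ _) (lerD (b1 _ _ _ _ _ _) (b2 _ _ _ _ _ _))) (b3 _ _ _ _ _ _)).
Qed.

End Cauchy.

(** * Integrals over the boundary of a square *)

Section SquareContour.
Variable R : realType.
Local Notation C := R[i]^o.
Local Notation N := (@Normc.normc R).
Local Notation S := (@segment_integral R).
Local Notation I := ('i%C : C).
Implicit Types (f g h : C -> C).

(** The corners of the square of half-side [r] about 0, counterclockwise from the lower right. Side
    [j] is the right-hand side turned by ['i ^+ j]. *)
Definition vertex (r : R) (j : nat) : C := r%:C * (I ^+ j * (1 - I)).

Definition square_integral (r : R) f : C := \sum_(j < 4) S (vertex r j) (vertex r j.+1) f.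

Lemma normc_I : N I = 1.
Proof. by rewrite /Normc.normc/= expr0n/= add0r expr1n sqrtr1. Qed.

Lemma II : I * I = -1 :> C.
Proof. by rewrite -expr2; exact: sqr_i. Qed.

Lemma vertexS r j : vertex r j.+1 = r%:C * (I ^+ j * (1 + I)).
Proof. by rewrite /vertex exprSr -!mulrA mulrBr mulr1 II opprK [I + 1]addrC. Qed.

Lemma side_point r j (t : R) : vertex r j + t%:C * (vertex r j.+1 - vertex r j) =
  r%:C * (I ^+ j * (1 + (2 * t - 1)%:C * I)).
Proof.
rewrite vertexS /vertex; have -> : (2 * t - 1)%:C = t%:C + t%:C - 1 :> C.
  by rewrite -real_complexD -[1 : C]/(1%:C) -real_complexB; congr (_%:C); lra.
by ring.
Qed.

Lemma normc_side_point r j (t : R) : 0 < r -> 0 <= t <= 1 ->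
  r <= N (vertex r j + t%:C * (vertex r j.+1 - vertex r j)) <= 2 * r.
Proof.
move=> r0 /andP[t0 t1]; rewrite side_point !Normc.normcM normcX normc_I expr1n mul1r normc_real gtr0_norm//.
have -> : 1 + (2 * t - 1)%:C * I = 1 +i* (2 * t - 1) :> C.
  by apply/eqP; rewrite eq_complex/=; apply/andP; split; apply/eqP; ring.
apply/andP; split.
  rewrite ler_pMr//; apply: le_trans (normr_Re_le _) => /=; by rewrite normr1.
rewrite [leRHS]mulrC; apply: ler_wpM2l; first exact: ltW.
apply: le_trans (normc_le_ReIm _) _ => /=; rewrite normr1.
have : `|2 * t - 1| <= 1 by rewrite ler_norml; apply/andP; split; lra.
by lra.
Qed.

(** The contour lies in [r <= N z]. This class is stable under sums and products and contains the
    Cauchy kernel at every [w] with [N w < r]. *)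
Definition outer_continuous (r : R) f := forall z, r <= N z -> {for z, continuous f}.

Lemma continuous_outer r f : continuous f -> outer_continuous r f.
Proof. by move=> cf z _; exact: cf. Qed.

Lemma outer_continuous_side r f j : 0 < r -> outer_continuous r f ->
  segment_continuous (vertex r j) (vertex r j.+1) f.
Proof. by move=> r0 cf t t01; apply: cf; have /andP[] := normc_side_point j r0 t01. Qed.

Lemma square_integral_linear r (c : C) f g : 0 < r -> outer_continuous r f -> outer_continuous r g ->
  square_integral r (fun z => c * f z + g z) = c * square_integral r f + square_integral r g.
Proof.
move=> r0 cf cg; rewrite /square_integral mulr_sumr -big_split/=; apply: eq_bigr => j _.
by apply: segment_integral_linear; exact: outer_continuous_side.
Qed.

Lemma eq_square_integral r f g : 0 < r -> (forall z, r <= N z -> f z = g z) ->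
  square_integral r f = square_integral r g.
Proof.
move=> r0 fg; apply: eq_bigr => j _; apply: eq_segment_integral => t t01.
by apply: fg; have /andP[] := normc_side_point j r0 t01.
Qed.

(** The constant is 4 sides times 2 from the segment bound times [4 * r], the bound that the
    triangle inequality gives for the length of a side. *)
Lemma square_integral_bound r f K : 0 < r -> outer_continuous r f ->
  (forall (j : 'I_4) (t : R), 0 <= t <= 1 ->
     N (f (vertex r j + t%:C * (vertex r j.+1 - vertex r j))) <= K) ->
  N (square_integral r f) <= 32 * r * K.
Proof.
move=> r0 cf fK.
have K0 : 0 <= K.
  by apply: le_trans (normc_ge0 _) (fK ord0 0 _); rewrite lexx ler01.
have h (j : 'I_4) : N (S (vertex r j) (vertex r j.+1) f) <= 8 * r * K.
  apply: le_trans.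
    apply: (@segment_integral_bound _ _ _ _ K); first exact: outer_continuous_side.
    exact: fK.
  apply: ler_wpM2r => //.
  have -> : vertex r j.+1 - vertex r j = (vertex r j.+1 + 0%:C * (vertex r j.+2 - vertex r j.+1)) - (vertex r j + 0%:C * (vertex r j.+1 - vertex r j)).
    by rewrite !mul0r !addr0.
  have h0 : (0 <= 0 :> R) && (0 <= 1 :> R) by rewrite lexx ler01.
  apply: (@le_trans _ _ (2 * (2 * r + 2 * r))); last by lra.
  apply: ler_wpM2l => //; apply: le_trans (normcD _ _) _; rewrite normcNC.
  by apply: lerD; [have /andP[] := normc_side_point j.+1 r0 h0|have /andP[] := normc_side_point j r0 h0].
apply: le_trans (normc_sum _ _ _) _.
apply: (@le_trans _ _ (\sum_(j < 4) 8 * r * K)); first by apply: ler_sum.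
by rewrite sumr_const card_ord -mulr_natl; lra.
Qed.

Lemma bounded_on_sides r f : 0 < r -> outer_continuous r f -> exists K,
  forall (j : 'I_4) (t : R), 0 <= t <= 1 ->
     N (f (vertex r j + t%:C * (vertex r j.+1 - vertex r j))) <= K.
Proof.
move=> r0 cf.
have /choice[K KP] (j : 'I_4) : exists K, forall t : R, 0 <= t <= 1 ->
     N (f (vertex r j + t%:C * (vertex r j.+1 - vertex r j))) <= K.
  have [] := @EVT_max R (fun t => N (f (vertex r j + t%:C * (vertex r j.+1 - vertex r j)))) 0 1 ler01.
    apply: continuous_in_subspaceT => t /[1!inE]/=; rewrite in_itv/= => t01.
    have ct := outer_continuous_side (j := j) r0 cf t01.
    exact: (continuous_comp (continuous_comp (continuous_line (x := t)) ct) (@continuous_normc R _)).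
  by move=> c _ cP; exists (N (f (vertex r j + c%:C * (vertex r j.+1 - vertex r j)))) => t t01; apply: cP; rewrite in_itv.
exists (\sum_(j < 4) `|K j|) => j t t01; apply: le_trans (KP j t t01) _.
by apply: le_trans (ler_norm _) _; rewrite (bigD1 j)//= lerDl sumr_ge0.
Qed.

Lemma outer_continuousV r (w : C) : N w < r -> outer_continuous r (fun z => (z - w)^-1).
Proof.
move=> wr z rz; have zw : z - w != 0.
  by rewrite subr_eq0; apply: contraTneq wr => <-; rewrite -leNgt.
exact: (cvgV zw (cvgB cvg_id (cvg_cst w))).
Qed.

Lemma outer_continuousM r f g : outer_continuous r f -> outer_continuous r g ->
  outer_continuous r (fun z => f z * g z).
Proof. by move=> cf cg z rz; exact: (cvgM (cf z rz) (cg z rz)). Qed.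

Lemma outer_continuousD r f g : outer_continuous r f -> outer_continuous r g ->
  outer_continuous r (fun z => f z + g z).
Proof. by move=> cf cg z rz; exact: (cvgD (cf z rz) (cg z rz)). Qed.

Lemma outer_continuous_cst r (c : C) : outer_continuous r (fun=> c).
Proof. by move=> z rz; exact: cst_continuous. Qed.

Lemma outer_continuousXV r n : 0 < r -> outer_continuous r (fun z => z^-1 ^+ n).
Proof.
move=> r0; elim: n => [|n IH]; first exact: (outer_continuous_cst (c := 1)).
have := @outer_continuousV r 0; rewrite Normc.normc0 => /(_ r0) cV.
have -> : (fun z : C => z^-1 ^+ n.+1) = (fun z => (z - 0)^-1 * z^-1 ^+ n).
  by apply/funext => z; rewrite subr0 -exprS.
exact: outer_continuousM cV IH.
Qed.

Lemma cderivV (z : C) : z != 0 -> cderiv (fun z => z^-1) z (- z^-1 ^+ 2).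
Proof.
move=> z0; apply/cderiv_is_derive; apply: DeriveDef.
  by apply: (@derivableV _ _ id z 1 z0); exact: derivable_id.
rewrite (@deriveV _ _ id z 1 z0) ?derive_id; last exact: derivable_id.
by rewrite exprVn -[LHS]/(_ * _) mulr1.
Qed.

Lemma cderiv_powV (z : C) n : z != 0 -> cderiv (fun z => z^-1 ^+ n.+1) z (- n.+1%:R * z^-1 ^+ n.+2).
Proof.
move=> z0; have /cderiv_is_derive h := cderivV z0; apply/cderiv_is_derive.
have -> : - n.+1%:R * z^-1 ^+ n.+2 = n.+1%:R * z^-1 ^+ n *: - z^-1 ^+ 2.
  by rewrite -[_ *: _]/(_ * _) mulNr mulrN -!mulrA -exprD addn2.
have -> : (fun z : C => z^-1 ^+ n.+1) = (fun z : C => z^-1) ^+ n.+1.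
  by apply/funext => x; rewrite exprfctE.
exact: is_deriveX.
Qed.

Lemma natC_neq0 n : (n.+1%:R : C) != 0.
Proof. by rewrite pnatr_eq0. Qed.

(** The integrand has a primitive on each side, and the boundary values telescope around the closed
    contour. *)
Lemma square_integral_powV r n : 0 < r -> square_integral r (fun z => z^-1 ^+ n.+2) = 0.
Proof.
move=> r0.
have E (j : nat) : S (vertex r j) (vertex r j.+1) (fun z => z^-1 ^+ n.+2) =
   (- n.+1%:R^-1) * (vertex r j.+1)^-1 ^+ n.+1 - (- n.+1%:R^-1) * (vertex r j)^-1 ^+ n.+1.
  apply: (@segment_FTC _ _ _ (fun z => (- n.+1%:R^-1) * z^-1 ^+ n.+1)).
    move=> t t01; have /andP[h _] := normc_side_point j r0 t01.
    set z := _ + _; have z0 : z != 0 by rewrite -normc_gt0; exact: lt_le_trans h.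
    have /cderiv_is_derive H := @cderiv_powV z n z0; apply/cderiv_is_derive.
    have -> : z^-1 ^+ n.+2 = (- n.+1%:R^-1) *: (- n.+1%:R * z^-1 ^+ n.+2).
      by rewrite -[_ *: _]/(_ * _) mulrA mulNr mulrN opprK mulVf ?mul1r// natC_neq0.
    exact: (@is_deriveZ _ _ _ _ (- n.+1%:R^-1) z 1 _ H).
  by apply: outer_continuous_side => //; exact: outer_continuousXV.
rewrite /square_integral !big_ord_recl big_ord0 !E/=.
have -> : vertex r (bump 0 (bump 0 (bump 0 0))).+1 = vertex r 0.
  rewrite /vertex /bump/= expr0 !exprS expr0 mulr1; congr (_ * (_ * _)).
  by rewrite !mulrA II mulN1r mulNr II opprK.
rewrite /bump/=; move: (vertex r 0) (vertex r 1) (vertex r 2) (vertex r 3) => a b c d.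
ring.
Qed.

(** A lower bound stands in for the value 2 pi i. On every side the imaginary part of the integrand
    is [2 / (1 + T^2)] with [T] in [[-1, 1]], hence at least 1. *)
Lemma square_integral_V r : 0 < r -> 1 <= N (square_integral r (fun z => z^-1)).
Proof.
move=> r0.
pose T (t : R) : R := 2 * t - 1.
have iE (t : R) : (1 + (T t)%:C * I)^-1 * (2 * I) = (2 * T t / (1 + T t ^+ 2)) +i* (2 / (1 + T t ^+ 2)) :> C.
  have p : 1 + T t ^+ 2 != 0 :> R by rewrite gt_eqF// ltr_pwDl// sqr_ge0.
  have nz : 1 + (T t)%:C * I != 0 :> C.
    by apply/eqP => /(congr1 (@complex.Re R)) /=/eqP; rewrite mul0r mulr0 subr0 addr0 oner_eq0.
  apply: (mulfI nz); rewrite mulrA mulfV// mul1r.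
  apply/eqP; rewrite eq_complex; apply/andP; split; apply/eqP; rewrite /=; field; exact: p.
pose G : R -> C := fun t => (1 + (T t)%:C * I)^-1 * (2 * I).
(* The factor [r * 'i ^+ j] of the side cancels between [dz] and [z^-1], so all four sides give the
   same integral. *)
have GE (j : nat) : S (vertex r j) (vertex r j.+1) (fun z => z^-1) = path_integral G.
  have rn : r%:C != 0 :> C by rewrite -normc_gt0 normc_real normr_gt0 gt_eqF.
  have In : I ^+ j != 0 :> C by rewrite -normc_gt0 normcX normc_I expr1n.
  rewrite segment_integralE.
  have cs : segment_continuous (vertex r j) (vertex r j.+1) (fun z => z^-1).
    apply: outer_continuous_side => // z rz.
    by have := @outer_continuousXV r 1 r0 z rz.
  have i1 := segment_path_integrable cs.
  have i0 : path_integrable (fun _ : R => 0 : C).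
    by apply: continuous_path_integrable => t _; exact: cst_continuous.
  have p0 : path_integral (fun _ : R => 0 : C) = 0.
    have : N (path_integral (fun _ : R => 0 : C)) <= 2 * 0.
      by apply: path_integral_bound => // t _; rewrite Normc.normc0.
    rewrite mulr0 => H.
    have : N (path_integral (fun _ : R => 0 : C)) == 0 by rewrite eq_le H normc_ge0.
    by rewrite normc_eq0 => /eqP.
  have := (path_integral_linear (vertex r j.+1 - vertex r j) i1 i0).2.
  rewrite p0 addr0 => <-; apply: eq_path_integral => t _; rewrite side_point addr0.
  have -> : vertex r j.+1 - vertex r j = r%:C * I ^+ j * (2 * I) by rewrite vertexS /vertex; ring.
  have aux (a b c X : C) : a != 0 -> b != 0 -> a * b * c * (a * (b * X))^-1 = X^-1 * c.
    move=> a0 b0; rewrite !invfM; transitivity ((a * a^-1) * (b * b^-1) * (X^-1 * c)).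
      by move: (a^-1) (b^-1) (X^-1) => *; ring.
    by rewrite !mulfV// !mul1r.
  exact: aux.
have H : 1 <= \int[lebesgue_measure]_(t in `[0%R, 1%R]) complex.Im (G t).
  have iG : path_integrable G.
    apply: continuous_path_integrable => t _.
    have nz (u : R) : 1 + (T u)%:C * I != 0 :> C.
      by apply/eqP => /(congr1 (@complex.Re R)) /=/eqP; rewrite mul0r mulr0 subr0 addr0 oner_eq0.
    have cT : {for t, continuous (fun t => 1 + (T t)%:C * I : C)}.
      have cT' : {for t, continuous T}.
        exact: (cvgB (cvgM (cvg_cst (2 : R)) cvg_id) (cvg_cst (1 : R))).
      have cT2 := continuous_comp cT' (@continuous_real_complex R (T t)).
      exact: (cvgD (cvg_cst (1 : C)) (cvgM cT2 (cvg_cst I))).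
    exact: (cvgM (cvgV (nz t) cT) (cvg_cst (2 * I))).
  have mu1 : lebesgue_measure (`[0%R, 1%R]%classic : set (measurableTypeR R)) = 1%E.
    by rewrite lebesgue_measure_itv/= lte01 sube0.
  have : \int[lebesgue_measure]_(t in `[0%R, 1%R]) (1 : R) <= \int[lebesgue_measure]_(t in `[0%R, 1%R]) complex.Im (G t).
    apply: le_Rintegral => //.
    - apply: (@continuous_compact_integrable _ (cst 1)); first exact: segment_compact.
      by apply: continuous_subspaceT => x; exact: cst_continuous.
    - by have [] := iG.
    move=> t; rewrite /mkset in_itv/= => /andP[t0 t1].
    suff : 1 <= complex.Im (G t) by []; rewrite [G t]iE/=.
    have T1 : T t ^+ 2 <= 1.
      rewrite -subr_ge0; have -> : 1 - T t ^+ 2 = (1 - T t) * (1 + T t) by ring.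
      by apply: mulr_ge0; rewrite /T; lra.
    rewrite ler_pdivlMr ?mul1r; last by rewrite ltr_pwDl// sqr_ge0.
    lra.
  by rewrite Rintegral_cst// [X in fine X](_ : _ = 1%E) ?mulr1//; exact: mu1.
rewrite /square_integral !big_ord_recl big_ord0 !GE addr0.
apply: le_trans (normr_Im_le _); rewrite !raddfD/=.
by rewrite ger0_norm; lra.
Qed.

End SquareContour.

(** * Cauchy's formula and the Taylor expansion of entire functions *)

Section CauchyExpansion.
Variable R : realType.
Local Notation C := R[i]^o.
Local Notation N := (@Normc.normc R).
Local Notation S := (@segment_integral R).
Implicit Types (f g : C -> C) (w z : C).

Definition entire_cderiv f := forall z, exists d, cderiv f z d.

Lemma entireP f : entire f <-> entire_cderiv f.
Proof.
split=> [ef z|ef z]; first by exists (f^`() z); exact: derivable_cderiv.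
by have [d] := ef z; exact: cderiv_derivable.
Qed.

Lemma entire_continuous f : entire_cderiv f -> continuous f.
Proof. by move=> ef z; have [d] := ef z; exact: cderiv_continuous. Qed.

Lemma cderiv_local f g z d (r : R) : 0 < r -> (forall h, N h < r -> g (z + h) = f (z + h)) ->
  cderiv f z d -> cderiv g z d.
Proof.
move=> r0 gf df e e0; have [s s0 sP] := df e e0.
exists (Num.min r s); first by rewrite lt_min r0.
move=> h; rewrite lt_min => /andP[hr hs]; rewrite gf//.
have -> : g z = f z by have := gf 0; rewrite addr0; apply; rewrite Normc.normc0.
exact: sP.
Qed.

(** With [d] the derivative at [w] the quotient is continuous everywhere and differentiable off [w],
    exactly the situation of [goursat_vertex]. *)
Definition difference_quotient f w (d : C) : C -> C :=
  fun z => if z == w then d else (z - w)^-1 * (f z - f w).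

Lemma difference_quotient_cderiv f w d z : entire_cderiv f -> z != w ->
  exists d', cderiv (difference_quotient f w d) z d'.
Proof.
move=> ef zw.
have zw' : z - w != 0 by rewrite subr_eq0.
have d1 : derivable (fun z : C => (z - w)^-1) z (1 : C).
  by apply: (@derivableV _ _ (fun z : C => z - w) z 1 zw'); apply: derivableB; [exact: derivable_id|exact: derivable_cst].
have d2 : derivable (fun z : C => f z - f w) z (1 : C).
  by apply: derivableB; [have [?] := ef z; exact: cderiv_derivable|exact: derivable_cst].
have /derivable_cderiv H := derivableM d1 d2.
exists (((fun z0 : C => (z0 - w)^-1) * (fun z0 : C => f z0 - f w))^`() z).
apply: (cderiv_local (r := N (z - w)) _ _ H); first by rewrite normc_gt0; exact: zw'.
move=> h hr; rewrite /difference_quotient; case: eqP => // E.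
move: hr; suff -> : h = - (z - w) by rewrite normcNC ltxx.
by rewrite -E; ring.
Qed.

Lemma difference_quotient_continuous f w d : entire_cderiv f -> cderiv f w d ->
  continuous (difference_quotient f w d).
Proof.
move=> ef dw z; have [->|zw] := eqVneq z w; last first.
  by have [d'] := difference_quotient_cderiv d ef zw; exact: cderiv_continuous.
apply/continuousC_P => e e0; have e20 : 0 < e / 2 by rewrite divr_gt0.
have [r r0 rP] := dw _ e20; exists r => // x xr.
rewrite {2}/difference_quotient eqxx /difference_quotient; case: eqP => [_|/eqP xw].
  by rewrite subrr Normc.normc0.
have xw0 : x - w != 0 by rewrite subr_eq0.
have := rP _ xr; rewrite [w + _]addrC subrK => H.
have -> : (x - w)^-1 * (f x - f w) - d = (x - w)^-1 * (f x - f w - (x - w) * d).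
  by rewrite [RHS]mulrBr mulrA mulVf// mul1r.
rewrite Normc.normcM Normc.normcV mulrC; apply: (@le_lt_trans _ _ (e / 2)).
  by rewrite ler_pdivrMr ?normc_gt0.
by rewrite ltr_pdivrMr// ltr_pMr// ltr1n.
Qed.

(** The square is cut into four triangles with common vertex [w]; the integrals along the spokes
    cancel. *)
Lemma square_integral_quotient r f w d : 0 < r -> N w < r -> entire_cderiv f -> cderiv f w d ->
  square_integral r (difference_quotient f w d) = 0.
Proof.
move=> r0 wr ef dw; set g := difference_quotient f w d.
have cg : continuous g by exact: difference_quotient_continuous.
have T0 (j : nat) : S (vertex r j) (vertex r j.+1) g = S w (vertex r j.+1) g - S w (vertex r j) g.
  have : triangle_integral g w (vertex r j) (vertex r j.+1) = 0.
    apply: goursat_vertex => // [z zw|t t01]; first exact: difference_quotient_cderiv.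
    apply: contraTneq wr => <-; rewrite -leNgt.
    by have /andP[] := normc_side_point j r0 t01.
  rewrite /triangle_integral (segment_integral_rev (a := w) (b := vertex r j.+1)); last exact: continuous_segment_continuous.
  move: (S w (vertex r j) g) (S w (vertex r j.+1) g) (S (vertex r j) (vertex r j.+1) g) => a b c E.
  have -> : c = a + c - b + (b - a) by ring.
  by rewrite E add0r.
rewrite /square_integral !big_ord_recl big_ord0 !T0 /bump/=.
have -> : vertex r 4 = vertex r 0.
  rewrite /vertex expr0 !exprS expr0 mulr1; congr (_ * (_ * _)).
  by rewrite !mulrA II mulN1r mulNr II opprK.
move: (S w (vertex r 0) g) (S w (vertex r 1) g) (S w (vertex r 2) g) (S w (vertex r 3) g) => a b c e.
ring.
Qed.

Definition cauchy_coef r f k := square_integral r (fun z => f z * z^-1 ^+ k.+1).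

(** What is left of the Cauchy integral after [n] terms of the geometric series of [(z - w)^-1]. It
    is formed with [f z - f w], so that for [n = 0] it is the difference quotient, of integral 0. *)
Definition cauchy_remainder f w n : C -> C :=
  fun z => w ^+ n * (z^-1 ^+ n * ((z - w)^-1 * (f z - f w))).

Lemma cauchy_remainder_continuous r f w n : 0 < r -> N w < r -> continuous f ->
  outer_continuous r (cauchy_remainder f w n).
Proof.
move=> r0 wr cf; apply: outer_continuousM; first exact: outer_continuous_cst.
apply: outer_continuousM; first exact: outer_continuousXV.
apply: outer_continuousM; first exact: outer_continuousV.
apply: outer_continuousD; first exact: continuous_outer.
exact: outer_continuous_cst.
Qed.

(** Iteration of [(z - w)^-1 = z^-1 + w * z^-1 * (z - w)^-1]. The terms carrying [f w] are integrals
    of negative powers, which vanish except for the first; that one gives the left-hand side, where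
    2 pi i remains unevaluated. *)
Lemma cauchy_expansion r f w n : 0 < r -> N w < r -> entire_cderiv f ->
  f w * square_integral r (fun z => z^-1) =
  \sum_(k < n.+1) w ^+ k * cauchy_coef r f k + square_integral r (cauchy_remainder f w n.+1).
Proof.
move=> r0 wr ef; have cf := entire_continuous ef.
pose P k := square_integral r (fun z : C => z^-1 ^+ k.+1).
have step k : square_integral r (cauchy_remainder f w k) =
    w ^+ k * cauchy_coef r f k + (- (f w * w ^+ k) * P k + square_integral r (cauchy_remainder f w k.+1)).
  have cX m := outer_continuousXV (n := m) r0.
  have cR m := cauchy_remainder_continuous (n := m) r0 wr cf.
  rewrite -square_integral_linear// -square_integral_linear//; last 2 first.
  - by apply: outer_continuousM => //; exact: continuous_outer.
  - by apply: outer_continuousD => //; apply: outer_continuousM => //; exact: outer_continuous_cst.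
  apply: eq_square_integral => // z rz.
  have z0 : z != 0 by rewrite -normc_gt0; exact: lt_le_trans rz.
  have zw : z - w != 0 by rewrite subr_eq0; apply: contraTneq wr => <-; rewrite -leNgt.
  rewrite /cauchy_remainder.
  have E : (z - w)^-1 = z^-1 + w * z^-1 * (z - w)^-1.
    apply: (mulfI zw); rewrite mulfV// mulrDr [_ * (_ / (z - w))]mulrCA mulfV// mulr1 -mulrDl subrK mulfV//.
  rewrite [in LHS]E !exprS; move: (z^-1) ((z - w)^-1) (z^-1 ^+ k) (w ^+ k) => *; ring.
have [d dw] := ef w.
have H0 : square_integral r (cauchy_remainder f w 0) = 0.
  rewrite -(square_integral_quotient r0 wr ef dw); apply: eq_square_integral => // z rz.
  rewrite /cauchy_remainder /difference_quotient !expr0 !mul1r ifN//.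
  by apply: contraTneq wr => <-; rewrite -leNgt.
have P0 : P 0%N = square_integral r (fun z => z^-1).
  by apply: eq_square_integral => // z _; rewrite expr1.
elim: n => [|n IH].
  rewrite big_ord_recl big_ord0 addr0 -P0.
  have E := step 0%N; rewrite H0 !expr0 mulr1 mul1r in E.
  by rewrite -[LHS]addr0 {}E /= expr0 mul1r; ring.
rewrite IH [in RHS]big_ord_recr/= (step n.+1) /P square_integral_powV// mulr0 add0r addrA//.
Qed.

Definition psum (a : nat -> C) (n : nat) (w : C) : C := \sum_(k < n) a k * w ^+ k.

(** The remainder carries the factor [(w / z)^n]. At this stage the coefficients may still depend on
    the size [r] of the contour. *)
Lemma cauchy_taylor f r : 0 < r -> entire_cderiv f -> exists a : nat -> C,
  forall w, N w <= r / 2 -> exists K, forall n, N (f w - psum a n w) <= K * (N w / r) ^+ n.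
Proof.
move=> r0 ef; have cf := entire_continuous ef.
pose kap := square_integral r (fun z : C => z^-1).
have k1 : 1 <= N kap by exact: square_integral_V.
have k0 : kap != 0 by rewrite -normc_gt0; exact: lt_le_trans k1.
have [M MP] := bounded_on_sides r0 (continuous_outer (r := r) cf).
exists (fun k => cauchy_coef r f k / kap) => w wr.
have wr' : N w < r by apply: le_lt_trans wr _; rewrite ltr_pdivrMr// ltr_pMr// ltr1n.
(* The contour bound [32 * r], the bound [2 / r] of the Cauchy kernel for [N w <= r / 2], and a
   bound of [f z - f w] on the sides. *)
pose K := 32 * r * (2 / r * (M + N (f w))).
have M0 : 0 <= M by apply: le_trans (normc_ge0 _) (MP ord0 0 _); rewrite lexx ler01.
(* The additional [N (f w)] covers [n = 0], where the partial sum is empty. *)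
exists (K + N (f w)) => -[|n].
  rewrite /psum big_ord0 subr0 expr0 mulr1 lerDr.
  by rewrite !mulr_ge0// ?invr_ge0 ?addr_ge0 ?normc_ge0// ltW.
have x0 : 0 <= N w / r by rewrite divr_ge0 ?normc_ge0// ltW.
have -> : f w - psum (fun k => cauchy_coef r f k / kap) n.+1 w = square_integral r (cauchy_remainder f w n.+1) / kap.
  apply: (mulIf k0); rewrite mulfVK// mulrBl (cauchy_expansion n r0 wr' ef) /psum mulr_suml.
  rewrite [X in X + _ - _](_ : _ = \sum_(k < n.+1) cauchy_coef r f k / kap * w ^+ k * kap); last first.
    by apply: eq_bigr => k _; rewrite mulrC mulrAC mulfVK.
  by rewrite addrC addKr.
rewrite Normc.normcM Normc.normcV ler_pdivrMr ?(lt_le_trans _ k1)//.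
apply: (@le_trans _ _ (K * (N w / r) ^+ n.+1)); last first.
  rewrite -[leLHS]mulr1; apply: ler_pM => //.
  - by rewrite !mulr_ge0// ?invr_ge0 ?addr_ge0 ?normc_ge0 ?exprn_ge0// ltW.
  - by rewrite ler_wpM2r ?exprn_ge0// lerDl normc_ge0.
rewrite /K -mulrA; apply: square_integral_bound => //.
  exact: cauchy_remainder_continuous.
move=> j t t01; have := MP j t t01; have /andP[] := normc_side_point j r0 t01.
set z := _ + _ => rz _ fM.
have E : w ^+ n.+1 * z^-1 ^+ n.+1 = (w / z) ^+ n.+1 by rewrite [RHS]exprMn.
rewrite /cauchy_remainder [w ^+ _ * _]mulrA E Normc.normcM normcX Normc.normcM Normc.normcV mulrC.
apply: ler_pM; rewrite ?normc_ge0 ?exprn_ge0 ?mulr_ge0 ?invr_ge0 ?normc_ge0//.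
  rewrite Normc.normcM Normc.normcV; apply: ler_pM; rewrite ?invr_ge0 ?normc_ge0//; last first.
    by apply: le_trans (normcD _ _) _; rewrite normcNC lerD2r.
  have h : r / 2 <= N (z - w).
    have := normc_triangle w z 0; rewrite !subr0; move: wr rz; move: (N w) (N z) (N (z - w)) => *; lra.
  rewrite -[X in _ <= X]invrK lef_pV2 ?posrE ?invf_div//.
    by apply: lt_le_trans h; rewrite divr_gt0.
  by rewrite divr_gt0.
apply: lerXn2r; rewrite ?nnegrE ?mulr_ge0 ?invr_ge0 ?normc_ge0//.
  exact: ltW.
apply: ler_wpM2l; rewrite ?normc_ge0// lef_pV2// posrE//.
exact: lt_le_trans rz.
Qed.

End CauchyExpansion.

(** * Everywhere convergent power series *)

Section PowerSeries.
Variable R : realType.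
Local Notation C := R[i]^o.
Local Notation N := (@Normc.normc R).
Implicit Types (f g : C -> C) (w z : C) (a b : nat -> C).

Lemma psumS a n w : psum a n.+1 w = psum a n w + a n * w ^+ n.
Proof. by rewrite /psum big_ord_recr. Qed.

Lemma cvgC_seqP (u : nat -> C) (l : C) : u @ \oo --> l <->
  forall e : R, 0 < e -> exists n0, forall n, (n0 <= n)%N -> N (u n - l) < e.
Proof.
have E := @cvgC_P R _ (\oo) _ u l.
split=> [/E h e /h [n0 _ n0P]|h]; first by exists n0 => n n0n; apply: n0P.
by apply/E => e /h [n0 n0P]; exists n0.
Qed.

Lemma cvgC_dist_le (u : nat -> C) (l c : C) (B : R) m : u @ \oo --> l ->
  (forall n, (m <= n)%N -> N (u n - c) <= B) -> N (l - c) <= B.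
Proof.
move=> /cvgC_seqP ul uB; rewrite leNgt; apply/negP => Bl.
have [n0 n0P] := ul _ (eq_ind_r (fun b : bool => b) Bl (subr_gt0 B (N (l - c)))).
have h1 := n0P _ (leq_maxl n0 m); have h2 := uB _ (leq_maxr n0 m).
have := normc_triangle (u (maxn n0 m)) l c; rewrite [N (l - u _)]normcB.
move: h1 h2; move: (N (u _ - l)) (N (u _ - c)) (N (l - c)) => *; lra.
Qed.

Lemma cvgC_geometric (u : nat -> C) (l : C) (K : R) :
  (forall n, N (u n - l) <= K * 2^-1 ^+ n) -> u @ \oo --> l.
Proof.
move=> uK; apply/cvgC_seqP => e e0.
have K1 : 0 < `|K| + 1 by rewrite ltr_wpDl.
have [n0 n0P] := geometric_small (divr_gt0 e0 K1); exists n0 => n n0n.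
apply: le_lt_trans (uK n) _; move: n0P; rewrite ltr_pdivlMr// mulrC; apply: le_lt_trans.
apply: (@le_trans _ _ ((`|K| + 1) * 2^-1 ^+ n)).
  apply: ler_wpM2r; first by rewrite exprn_ge0// invr_ge0.
  by apply: le_trans (ler_norm K) _; rewrite lerDl.
apply: ler_wpM2l; first exact: ltW.
by apply: ler_wiXn2l; rewrite ?invr_ge0 ?invf_le1 ?ler1n.
Qed.

Definition rapid a := forall r : R, 0 < r -> exists K, forall k, N (a k) * r ^+ k <= K.

(** Infinite radius of convergence together with the sum: the form in which entire functions are
    handled from here on. *)
Definition pser f a := rapid a /\ forall w, psum a n w @[n --> \oo] --> f w.

(** [2 - 2 * 2^-1 ^+ j] is the sum of the first [j] powers of 1/2; written out exactly, it lets the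
    induction on [j] close. *)
Lemma psum_tail a (r K : R) w m j : (forall k, N (a k) * r ^+ k <= K) -> 0 < r -> N w <= r / 2 ->
  N (psum a (m + j) w - psum a m w) <= K * (N w / r) ^+ m * (2 - 2 * 2^-1 ^+ j).
Proof.
move=> aK r0 wr; have x0 : 0 <= N w / r by rewrite divr_ge0 ?normc_ge0// ltW.
have x1 : N w / r <= 2^-1 by rewrite ler_pdivrMr// mulrC.
have K0 : 0 <= K by apply: le_trans (aK 0%N); rewrite expr0 mulr1 normc_ge0.
elim: j => [|j IH]; first by rewrite addn0 subrr Normc.normc0 expr0 mulr1 subrr mulr0.
rewrite addnS psumS addrAC; apply: le_trans (normcD _ _) _.
have h : N (a (m + j)%N * w ^+ (m + j)) <= K * (N w / r) ^+ m * 2^-1 ^+ j.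
  rewrite Normc.normcM normcX.
  have -> : N w ^+ (m + j) = r ^+ (m + j) * (N w / r) ^+ (m + j).
    by rewrite -exprMn mulrC divfK ?gt_eqF.
  rewrite [(N w / r) ^+ (m + j)]exprD !mulrA; apply: ler_pM; rewrite ?mulr_ge0 ?normc_ge0 ?exprn_ge0 ?(ltW r0)//.
    by apply: ler_wpM2r; rewrite ?exprn_ge0.
  by apply: lerXn2r; rewrite ?nnegrE ?invr_ge0.
apply: le_trans (lerD IH h) _.
by rewrite exprS; move: (K * _) (2^-1 ^+ j) => *; lra.
Qed.

Lemma psum_remainder a (r K : R) w l m : (forall k, N (a k) * r ^+ k <= K) -> 0 < r -> N w <= r / 2 ->
  psum a n w @[n --> \oo] --> l -> N (l - psum a m w) <= 2 * K * (N w / r) ^+ m.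
Proof.
move=> aK r0 wr al; apply: (cvgC_dist_le (m := m) al) => n mn.
rewrite -(subnKC mn); apply: le_trans (psum_tail _ _ aK r0 wr) _.
have K0 : 0 <= K by apply: le_trans (aK 0%N); rewrite expr0 mulr1 normc_ge0.
have x0 : 0 <= N w / r by rewrite divr_ge0 ?normc_ge0// ltW.
have h : 0 <= K * (N w / r) ^+ m by rewrite mulr_ge0// exprn_ge0.
rewrite -[2 * K * _]mulrA [2 * (K * _)]mulrC; apply: ler_wpM2l => //.
by rewrite gerBl mulr_ge0// exprn_ge0// invr_ge0.
Qed.

(** Strong induction: once the lower differences vanish, the remainder estimate at a small real [t]
    bounds [N (d k) * t ^+ k] by a multiple of [t ^+ k.+1]. *)
Lemma psum_uniq_local a b (r K : R) : 0 < r ->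
  (forall k, N (a k) * r ^+ k <= K) -> (forall k, N (b k) * r ^+ k <= K) ->
  (forall w, N w <= r / 2 -> exists l : C, psum a n w @[n --> \oo] --> l /\ psum b n w @[n --> \oo] --> l) ->
  forall k, a k = b k.
Proof.
move=> r0 aK bK ab.
pose d k := a k - b k.
have psd n w : psum d n w = psum a n w - psum b n w.
  by rewrite /psum -sumrB; apply: eq_bigr => i _; rewrite mulrBl.
have dK k : N (d k) * r ^+ k <= K + K.
  apply: le_trans (lerD (aK k) (bK k)); rewrite -mulrDl; apply: ler_wpM2r; first by rewrite exprn_ge0// ltW.
  by apply: le_trans (normcD _ _) _; rewrite normcNC.
have d0 w : N w <= r / 2 -> psum d n w @[n --> \oo] --> (0 : C).
  move=> /ab[l [al bl]]; rewrite -(subrr l).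
  by under eq_fun do rewrite psd; exact: (cvgB al bl).
move=> k; apply/eqP; rewrite -subr_eq0 -/(d k).
elim/ltn_ind: k => k IH.
have pk w : psum d k.+1 w = d k * w ^+ k.
  by rewrite psumS /psum big1 ?add0r// => i _; have /eqP -> := IH _ (ltn_ord i); rewrite mul0r.
suff H e : 0 < e -> N (d k) <= (4 * K / r ^+ k.+1) * e.
  by rewrite -normc_eq0 eq_le normc_ge0 (le0_of_eps H).
move=> e0; pose t := Num.min e (r / 2).
have t0 : 0 < t by rewrite lt_min e0 divr_gt0.
have tr : t <= r / 2 by rewrite ge_min lexx orbT.
have te : t <= e by rewrite ge_min lexx.
have nt : N t%:C = t by rewrite normc_real gtr0_norm.
have ntr : N t%:C <= r / 2 by rewrite nt.
have K0 : 0 <= K by apply: le_trans (aK 0%N); rewrite expr0 mulr1 normc_ge0.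
have := psum_remainder k.+1 dK r0 ntr (d0 _ ntr).
rewrite pk sub0r normcNC Normc.normcM normcX nt expr_div_n => H.
have tk : 0 < t ^+ k by rewrite exprn_gt0.
have rk : 0 < r ^+ k.+1 by rewrite exprn_gt0.
apply: (@le_trans _ _ ((4 * K / r ^+ k.+1) * t)); last first.
  by apply: ler_wpM2l => //; rewrite divr_ge0 ?mulr_ge0// ltW.
rewrite -(ler_pM2r tk); apply: le_trans H _.
rewrite exprS; move: (r ^+ k.+1)^-1 (t ^+ k) => *; lra.
Qed.

Lemma archimedean_nat (x : R) : exists n : nat, x <= n.+1%:R.
Proof.
exists (Num.truncn `|x|); apply: le_trans (ler_norm x) _.
by rewrite ltW// truncnS_gt.
Qed.

(** The expansions obtained from larger and larger squares agree by uniqueness on the smallest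
    half-disc, so a single sequence serves for all radii. *)
Lemma entire_pser f : entire_cderiv f -> exists a, pser f a.
Proof.
move=> ef.
have /choice[A AP] (n : nat) := @cauchy_taylor R f n.+1%:R (ltr0Sn _ n) ef.
pose h n : R := n.+1%:R / 2.
have h0 n : 0 < h n by rewrite divr_gt0.
have cA n w : N w <= h n -> psum (A n) m w @[m --> \oo] --> f w.
  move=> wh; have [K KP] := AP n w wh.
  apply: (@cvgC_geometric _ _ K) => m; rewrite normcB; apply: le_trans (KP m) _.
  have K0 : 0 <= K by have := KP 0%N; rewrite expr0 mulr1; apply: le_trans; exact: normc_ge0.
  apply: ler_wpM2l => //; apply: lerXn2r; rewrite ?nnegrE ?invr_ge0 ?divr_ge0 ?normc_ge0//.
  by rewrite ler_pdivrMr// mulrC.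
have bA n : exists K, forall k, N (A n k) * h n ^+ k <= K.
  have nh : N (h n)%:C = h n by rewrite normc_real gtr0_norm.
  have [|K KP] := AP n (h n)%:C; first by rewrite nh.
  have K0 : 0 <= K by have := KP 0%N; rewrite expr0 mulr1; apply: le_trans; exact: normc_ge0.
  have KP' k : N (f (h n)%:C - psum (A n) k (h n)%:C) <= K.
    apply: le_trans (KP k) _; rewrite -[leRHS]mulr1; apply: ler_wpM2l => //.
    apply: exprn_ile1; rewrite nh ?divr_ge0 ?(ltW (h0 n))// /h.
    by rewrite mulrAC mulfV ?pnatr_eq0// mul1r invf_le1// ler1n.
  exists (K + K) => k.
  rewrite -nh -normcX -Normc.normcM.
  have -> : A n k * (h n)%:C ^+ k = (f (h n)%:C - psum (A n) k (h n)%:C) - (f (h n)%:C - psum (A n) k.+1 (h n)%:C).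
    by rewrite psumS; move: (psum _ _ _) (f _) (A n k * _) => *; ring.
  by apply: le_trans (normcD _ _) _; rewrite normcNC lerD.
have AE n k : A n k = A 0%N k.
  have [K0 K0P] := bA 0%N; have [K KP] := bA n.
  apply: (@psum_uniq_local _ _ (h 0%N) (Num.max K K0)) => //.
  - move=> j; apply: (@le_trans _ _ K); last by rewrite le_max lexx.
    apply: le_trans (KP j); apply: ler_wpM2l; first exact: normc_ge0.
    apply: lerXn2r; rewrite ?nnegrE ?(ltW (h0 _))// /h ler_pM2r ?invr_gt0// ler_nat//.
  - by move=> j; apply: le_trans (K0P j) _; rewrite le_max lexx orbT.
  - move=> w wh; exists (f w); split; apply: cA; apply: (le_trans wh).
      apply: (@le_trans _ _ (h 0%N)); last by rewrite /h ler_pM2r ?invr_gt0// ler_nat.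
      by rewrite ler_pdivrMr// ler_pMr// ler1n.
    by rewrite ler_pdivrMr// ler_pMr// ler1n.
have A_eq n : A n = A 0%N by apply/funext.
exists (A 0%N); split.
  move=> r r0; have [n nP] := archimedean_nat (2 * r).
  have [K KP] := bA n; exists K => k; rewrite -(AE n); apply: le_trans (KP k).
  apply: ler_wpM2l; first exact: normc_ge0.
  by apply: lerXn2r; rewrite ?nnegrE ?(ltW (h0 _)) ?(ltW r0)// /h ler_pdivlMr// mulrC.
move=> w; have [n nP] := archimedean_nat (2 * N w).
by rewrite -(A_eq n); apply: cA; rewrite /h ler_pdivlMr// mulrC.
Qed.

Lemma pser_remainder f a (r : R) : pser f a -> 0 < r -> exists2 K, 0 <= K &
  forall w m, N w <= r -> N (f w - psum a m w) <= K * (N w / (2 * r)) ^+ m.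
Proof.
move=> [ra ca] r0; have r20 : 0 < 2 * r by rewrite mulr_gt0.
have [K KP] := ra _ r20; exists (2 * K).
  by apply: mulr_ge0 => //; apply: le_trans (KP 0%N); rewrite expr0 mulr1 normc_ge0.
move=> w m wr; apply: psum_remainder => //.
by rewrite mulrAC mulfV ?pnatr_eq0// mul1r.
Qed.

Lemma pser_uniform f a (r : R) : pser f a -> 0 < r -> exists2 K, 0 <= K &
  forall w m, N w <= r -> N (f w - psum a m w) <= K * 2^-1 ^+ m.
Proof.
move=> fa r0; have [K K0 KP] := pser_remainder fa r0; exists K => // w m wr.
apply: le_trans (KP w m wr) _; apply: ler_wpM2l => //.
apply: lerXn2r; rewrite ?nnegrE ?invr_ge0 ?divr_ge0 ?normc_ge0 ?mulr_ge0 ?(ltW r0)//.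
by rewrite ler_pdivrMr ?mulr_gt0// mulrA mulVf ?pnatr_eq0// mul1r.
Qed.

Lemma pser0 f a : pser f a -> f 0 = a 0%N.
Proof.
move=> fa; have [K K0 KP] := pser_remainder fa ltr01.
have := KP 0 1%N; rewrite Normc.normc0 => /(_ ler01).
rewrite mul0r expr1 mulr0 /psum big_ord_recl big_ord0 expr0 mulr1 addr0 => H.
have : N (f 0 - a 0%N) == 0 by rewrite eq_le H normc_ge0.
by rewrite normc_eq0 subr_eq0 => /eqP.
Qed.

End PowerSeries.

(** * Termwise differentiation and integration, and Cauchy's estimate *)

Section PowerSeriesCalculus.
Variable R : realType.
Local Notation C := R[i]^o.
Local Notation N := (@Normc.normc R).
Local Notation S := (@segment_integral R).
Implicit Types (f g : C -> C) (w z h : C) (a b : nat -> C).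

(** The real and imaginary parts, divided by [2 * K + 1], move by at most [2^-1 ^+ n.+1] at step
    [n], which is the hypothesis of [nested_limit]. *)
Lemma psum_cvg_ex a z : rapid a -> exists l : C, psum a n z @[n --> \oo] --> l.
Proof.
move=> ra; have r0 : 0 < 2 * (N z + 1) by rewrite mulr_gt0// ltr_wpDl ?normc_ge0.
have [K KP] := ra _ r0.
have K0 : 0 <= K by apply: le_trans (KP 0%N); rewrite expr0 mulr1 normc_ge0.
have D0 : 0 < 2 * K + 1 by rewrite ltr_wpDl// mulr_ge0.
have term n : N (a n * z ^+ n) <= K * 2^-1 ^+ n.
  rewrite Normc.normcM normcX; apply: (@le_trans _ _ (N (a n) * ((2 * (N z + 1)) ^+ n * 2^-1 ^+ n))).
    apply: ler_wpM2l; first exact: normc_ge0.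
    rewrite -exprMn; apply: lerXn2r; rewrite ?nnegrE ?normc_ge0//.
      by rewrite mulrAC mulfV ?pnatr_eq0// mul1r addr_ge0 ?normc_ge0.
    by rewrite mulrAC mulfV ?pnatr_eq0// mul1r lerDl.
  by rewrite mulrA; apply: ler_wpM2r => //; rewrite exprn_ge0// invr_ge0.
have lim (Q : C -> R) : (forall x y, Q (x + y) = Q x + Q y) -> (forall x, `|Q x| <= N x) ->
    exists l : R, forall n, `|Q (psum a n z) - l| <= (2 * K + 1) * 2^-1 ^+ n.
  move=> QD Qle.
  have [l lP] : exists l, forall n, `|Q (psum a n z) / (2 * K + 1) - l| <= 2^-1 ^+ n.
    apply: nested_limit => n; rewrite -mulrBl normrM normfV (gtr0_norm D0) ler_pdivrMr//.
    rewrite psumS QD addrC addKr; apply: le_trans (Qle _) (le_trans (term n) _).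
    have h : 0 <= 2^-1 ^+ n :> R by rewrite exprn_ge0// invr_ge0.
    by rewrite exprS; move: h; move: (2^-1 ^+ n) => x x0; nra.
  exists (l * (2 * K + 1)) => n.
  have -> : Q (psum a n z) - l * (2 * K + 1) = (2 * K + 1) * (Q (psum a n z) / (2 * K + 1) - l).
    by rewrite mulrBr [_ * (_ / _)]mulrCA mulfV ?gt_eqF// mulr1 [_ * l]mulrC.
  by rewrite normrM (gtr0_norm D0); apply: ler_wpM2l; [exact: ltW|exact: lP].
have [x xP] := lim (@complex.Re R) (fun x y => raddfD _ _ _) (@normr_Re_le R).
have [y yP] := lim (@complex.Im R) (fun x y => raddfD _ _ _) (@normr_Im_le R).
exists (x +i* y); apply: (@cvgC_geometric _ _ _ (2 * (2 * K + 1))) => n.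
apply: le_trans (normc_le_ReIm _) _; rewrite !raddfB/=.
by have := xP n; have := yP n; move: (2^-1 ^+ n) => *; lra.
Qed.

Definition dcoef a k : C := k.+1%:R * a k.+1.

Lemma natC_real n : (n%:R : C) = (n%:R : R)%:C.
Proof. by rewrite rmorph_nat. Qed.

Lemma normc_nat n : N n%:R = n%:R.
Proof. by rewrite natC_real normc_real ger0_norm. Qed.

Lemma leq_exp2 n : n%:R <= 2 ^+ n :> R.
Proof. by rewrite -natrX ler_nat ltnW// ltn_expl. Qed.

Lemma rapid_dcoef a : rapid a -> rapid (dcoef a).
Proof.
move=> ra r r0; have [K KP] := ra _ (mulr_gt0 (ltr0n R 2) r0).
exists (K / r) => k; rewrite /dcoef Normc.normcM normc_nat ler_pdivlMr//.
apply: le_trans (KP k.+1); rewrite exprMn [_ * N _]mulrC -mulrA -mulrA.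
apply: ler_wpM2l; first exact: normc_ge0.
rewrite -exprSr; apply: ler_wpM2r; first by rewrite exprn_ge0// ltW.
exact: leq_exp2.
Qed.

(** The second-order remainder of [z ^+ k] obeys a recursion in [k]. Its constant is polynomial
    times geometric in [k], hence summable against rapidly decreasing coefficients. *)
Lemma pow_second_order (rho : R) z h k : 1 <= rho -> N z <= rho -> N (z + h) <= rho ->
  N ((z + h) ^+ k - z ^+ k - h * (k%:R * z ^+ k.-1)) <= N h ^+ 2 * (k%:R ^+ 2 * rho ^+ k).
Proof.
move=> r1 zr zhr; have r0 : 0 <= rho by apply: le_trans r1.
elim: k => [|k IH].
  by rewrite !expr0 subrr !mul0r mulr0 subr0 Normc.normc0 expr0n/= mul0r mulr0.
have -> : (z + h) ^+ k.+1 - z ^+ k.+1 - h * (k.+1%:R * z ^+ k.+1.-1) =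
    (z + h) * ((z + h) ^+ k - z ^+ k - h * (k%:R * z ^+ k.-1)) + h ^+ 2 * (k%:R * z ^+ k.-1).
  case: k {IH} => [|k] /=; first by rewrite !expr0 !expr1; ring.
  by rewrite !exprS -[k.+2]addn1 natrD; move: (z ^+ k) ((z + h) ^+ k) => *; ring.
apply: le_trans (normcD _ _) _; rewrite Normc.normcM [N (h ^+ 2 * _)]Normc.normcM [N (k%:R * _)]Normc.normcM !normcX normc_nat.
have h2 : 0 <= N h ^+ 2 by rewrite exprn_ge0 ?normc_ge0.
apply: (@le_trans _ _ (rho * (N h ^+ 2 * (k%:R ^+ 2 * rho ^+ k)) + N h ^+ 2 * (k%:R * rho ^+ k.+1))).
  apply: lerD; first by apply: ler_pM => //; exact: normc_ge0.
  apply: ler_wpM2l => //; apply: ler_wpM2l => //.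
  apply: (@le_trans _ _ (rho ^+ k.-1)); first by apply: lerXn2r; rewrite ?nnegrE ?normc_ge0.
  by apply: ler_weXn2l => //; case: k {IH} => // k; rewrite /= leqW// leqW.
have -> : rho * (N h ^+ 2 * (k%:R ^+ 2 * rho ^+ k)) + N h ^+ 2 * (k%:R * rho ^+ k.+1) =
   N h ^+ 2 * ((k%:R ^+ 2 + k%:R) * rho ^+ k.+1) by rewrite [rho ^+ k.+1]exprS; ring.
apply: ler_wpM2l => //; apply: ler_wpM2r; first by rewrite exprn_ge0.
by rewrite -[k.+1%:R]natr1; have : 0 <= k%:R :> R by []; move: (k%:R) => x x0; nra.
Qed.

Lemma psum_second_order a (rho : R) z h n : 1 <= rho -> N z <= rho -> N (z + h) <= rho ->
  N (psum a n.+1 (z + h) - psum a n.+1 z - h * psum (dcoef a) n z) <=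
  N h ^+ 2 * \sum_(k < n.+1) N (a k) * (k%:R ^+ 2 * rho ^+ k).
Proof.
move=> r1 zr zhr.
have -> : psum (dcoef a) n z = \sum_(k < n.+1) a k * (k%:R * z ^+ k.-1).
  rewrite big_ord_recl mul0r mulr0 add0r; apply: eq_bigr => k _.
  by rewrite /dcoef/= mulrA [a _ * _]mulrC.
rewrite /psum -sumrB mulr_sumr -sumrB mulr_sumr; apply: le_trans (normc_sum _ _ _) _.
apply: ler_sum => k _.
have -> : a k * (z + h) ^+ k - a k * z ^+ k - h * (a k * (k%:R * z ^+ k.-1)) =
   a k * ((z + h) ^+ k - z ^+ k - h * (k%:R * z ^+ k.-1)) by ring.
rewrite Normc.normcM [leRHS]mulrCA; apply: ler_wpM2l; first exact: normc_ge0.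
exact: pow_second_order.
Qed.

Lemma cderiv_quadratic f z d (M : R) :
  (forall h, N h <= 1 -> N (f (z + h) - f z - h * d) <= N h ^+ 2 * M) -> cderiv f z d.
Proof.
move=> H e e0; have M0 : 0 < `|M| + 1 by rewrite ltr_wpDl.
exists (Num.min 1 (e / (`|M| + 1))); first by rewrite lt_min ltr01 divr_gt0.
move=> h; rewrite lt_min => /andP[h1 h2]; apply: le_trans (H h (ltW h1)) _.
rewrite expr2 -mulrA [e * _]mulrC; apply: ler_wpM2l; first exact: normc_ge0.
apply: (@le_trans _ _ (N h * (`|M| + 1))).
  by apply: ler_wpM2l; [exact: normc_ge0|apply: le_trans (ler_norm M) _; rewrite lerDl].
by rewrite -ler_pdivlMr// ltW.
Qed.

Lemma normcD_ball z h : N h <= 1 -> N z <= N z + 1 /\ N (z + h) <= N z + 1.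
Proof. by move=> h1; split; [rewrite lerDl|apply: le_trans (normcD _ _) _; rewrite lerD2l]. Qed.

Lemma cderiv_psum a n z : cderiv (psum a n.+1) z (psum (dcoef a) n z).
Proof.
apply: (@cderiv_quadratic _ _ _ (\sum_(k < n.+1) N (a k) * (k%:R ^+ 2 * (N z + 1) ^+ k))) => h h1.
have [] := normcD_ball z h1; apply: psum_second_order.
by rewrite lerDr normc_ge0.
Qed.

Lemma rapid_second_order a (rho : R) : rapid a -> 0 < rho -> exists M, forall n,
  \sum_(k < n) N (a k) * (k%:R ^+ 2 * rho ^+ k) <= M.
Proof.
(* 8 is 4 times 2: [4 ^+ k] dominates [k ^ 2], and the remaining [2 ^+ k] makes the sum converge. *)
move=> ra r0; have [K KP] := ra _ (mulr_gt0 (ltr0n R 8) r0).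
have K0 : 0 <= K by apply: le_trans (KP 0%N); rewrite expr0 mulr1 normc_ge0.
exists (2 * K) => n.
suff : \sum_(k < n) N (a k) * (k%:R ^+ 2 * rho ^+ k) <= K * (2 - 2 * 2^-1 ^+ n).
  move/le_trans; apply; rewrite [2 * K]mulrC; apply: ler_wpM2l => //.
  by rewrite gerBl mulr_ge0// exprn_ge0// invr_ge0.
elim: n => [|n IH]; first by rewrite big_ord0 expr0 mulr1 subrr mulr0.
rewrite big_ord_recr/=.
have h : N (a n) * (n%:R ^+ 2 * rho ^+ n) <= K * 2^-1 ^+ n.
  apply: (@le_trans _ _ (N (a n) * ((8 * rho) ^+ n * 2^-1 ^+ n))); last first.
    by rewrite mulrA; apply: ler_wpM2r => //; rewrite exprn_ge0// invr_ge0.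
  apply: ler_wpM2l; first exact: normc_ge0.
  have -> : (8 * rho) ^+ n * 2^-1 ^+ n = (2 ^+ n) ^+ 2 * rho ^+ n.
    by rewrite -exprM mulnC exprM -!exprMn; congr (_ ^+ _); lra.
  apply: ler_wpM2r; first by rewrite exprn_ge0// ltW.
  by apply: lerXn2r; rewrite ?nnegrE ?exprn_ge0// leq_exp2.
apply: le_trans (lerD IH h) _.
by rewrite exprS; move: (2^-1 ^+ n) => *; lra.
Qed.

Lemma cvgC_shift1 (u : nat -> C) (l : C) : u @ \oo --> l -> u n.+1 @[n --> \oo] --> l.
Proof.
move=> /cvgC_seqP ul; apply/cvgC_seqP => e /ul[n0 n0P]; exists n0 => n n0n.
by apply: n0P; exact: leqW.
Qed.

(** The second-order estimate holds for the partial sums with a constant independent of their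
    length, so it passes to the limit and identifies the derivative termwise. *)
Lemma pser_second_order f a z (l : C) : pser f a -> psum (dcoef a) n z @[n --> \oo] --> l ->
  exists M, forall h, N h <= 1 -> N (f (z + h) - f z - h * l) <= N h ^+ 2 * M.
Proof.
move=> [ra ca] cl; have r0 : 0 < N z + 1 by rewrite ltr_wpDl ?normc_ge0.
have [M MP] := rapid_second_order ra r0; exists M => h h1; have [zr zhr] := normcD_ball z h1.
have H : (fun n => psum a n.+1 (z + h) - psum a n.+1 z - h * psum (dcoef a) n z) @ \oo --> f (z + h) - f z - h * l.
  exact: (cvgB (cvgB (cvgC_shift1 (ca _)) (cvgC_shift1 (ca _))) (cvgM (cvg_cst h) cl)).
rewrite -[X in N X]subr0; apply: (cvgC_dist_le (m := 0%N) H) => n _; rewrite subr0.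
apply: le_trans (psum_second_order _ _ _ zr zhr) _; first by rewrite lerDr normc_ge0.
by apply: ler_wpM2l; [rewrite exprn_ge0 ?normc_ge0|exact: MP].
Qed.

Lemma pser_cderiv f a z (l : C) : pser f a -> psum (dcoef a) n z @[n --> \oo] --> l -> cderiv f z l.
Proof. by move=> fa cl; have [M MP] := pser_second_order fa cl; exact: cderiv_quadratic MP. Qed.

Lemma pser_entire f a : pser f a -> entire_cderiv f.
Proof.
move=> fa z; have [l lP] := psum_cvg_ex z (rapid_dcoef fa.1).
by exists l; exact: pser_cderiv lP.
Qed.

Lemma pser_derive f a : pser f a -> pser f^`() (dcoef a).
Proof.
move=> fa; split=> [|z]; first exact: rapid_dcoef fa.1.
have [l lP] := psum_cvg_ex z (rapid_dcoef fa.1).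
by rewrite (cderiv_derive1 (pser_cderiv fa lP)).
Qed.

Lemma pser_deriven f a n : pser f a -> pser f^`(n) (iter n dcoef a).
Proof. by move=> fa; elim: n => [//|n IH]; rewrite derive1nS iterS; exact: pser_derive. Qed.

Lemma iter_dcoef a k j : iter k dcoef a j = ((j + k) ^_ k)%:R * a (j + k)%N.
Proof.
elim: k j => [|k IH] j; first by rewrite /= addn0 ffactn0 mul1r.
rewrite iterS /dcoef IH addnS addSn mulrA -natrM ffactnSr subSn ?leq_addl// addnK.
by rewrite mulnC.
Qed.

Lemma pser_coef f a k : pser f a -> f^`(k) 0 = k`!%:R * a k.
Proof. by move=> /(pser_deriven k)/pser0 ->; rewrite iter_dcoef add0n ffactnn. Qed.

Definition vcoef a k : C := if k is j.+1 then a j / j.+1%:R else 0.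

Lemma dcoef_vcoef a : dcoef (vcoef a) = a.
Proof. by apply/funext => k; rewrite /dcoef /vcoef mulrC divfK// pnatr_eq0. Qed.

Lemma psum_continuous a n : continuous (psum a n).
Proof.
case: n => [|n] z; last exact: cderiv_continuous (cderiv_psum a n z).
have -> : psum a 0 = fun=> 0 by apply/funext => w; rewrite /psum big_ord0.
exact: cst_continuous.
Qed.

Lemma volterra_psum a n z : volterra (psum a n) z = psum (vcoef a) n.+1 z.
Proof.
rewrite /volterra (@segment_FTC _ _ _ (psum (vcoef a) n.+1)).
- by rewrite [X in _ - X]/psum big1 ?subr0// => -[[|k] ?] _; rewrite /= ?mul0r// expr0n/= mulr0.
- by move=> t _; have := cderiv_psum (vcoef a) n (0 + t%:C * (z - 0)); rewrite dcoef_vcoef.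
- by apply: continuous_segment_continuous; exact: psum_continuous.
Qed.

(** Polynomials are integrated exactly, and the partial sums of [f] converge uniformly on the
    segment from 0 to [z]. *)
Lemma pser_volterra f a : pser f a -> pser (volterra f) (vcoef a).
Proof.
move=> fa; have cf := entire_continuous (pser_entire fa); split.
  move=> r r0; have [K KP] := fa.1 r r0; exists (K * r) => -[|k].
    by rewrite /vcoef Normc.normc0 mul0r mulr_ge0 ?(ltW r0)//; apply: le_trans (KP 0%N); rewrite expr0 mulr1 normc_ge0.
  rewrite /vcoef Normc.normcM Normc.normcV normc_nat exprSr mulrA; apply: ler_wpM2r; first exact: ltW.
  apply: le_trans (KP k); apply: ler_wpM2r; first by rewrite exprn_ge0// ltW.
  by rewrite ler_pdivrMr// ler_peMr ?normc_ge0// ler1n.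
move=> z; pose rho := N z + 1; have r0 : 0 < rho by rewrite ltr_wpDl ?normc_ge0.
have [K K0 KP] := pser_uniform fa r0.
suff : psum (vcoef a) n.+1 z @[n --> \oo] --> volterra f z.
  move=> /cvgC_seqP H; apply/cvgC_seqP => e /H[n0 n0P]; exists n0.+1 => -[//|n]; exact: n0P.
apply: (@cvgC_geometric _ _ _ (2 * N z * K)) => n.
rewrite -volterra_psum normcB.
have -> : volterra f z - volterra (psum a n) z = S 0 z (fun w => (-1) * psum a n w + f w).
  rewrite segment_integral_linear; first by rewrite mulN1r addrC.
    by apply: continuous_segment_continuous; exact: psum_continuous.
  exact: continuous_segment_continuous.
rewrite -[2 * _ * _ * _]mulrA; apply: le_trans.
  apply: (@segment_integral_bound _ _ _ _ (K * 2^-1 ^+ n)).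
    apply: continuous_segment_continuous => w.
    exact: (cvgD (cvgM (cvg_cst (-1 : C)) (psum_continuous (x := w))) (cf w)).
  move=> t /andP[t0 t1]; rewrite mulN1r addrC; apply: KP; rewrite add0r subr0 Normc.normcM normc_real ger0_norm//.
  by apply: (@le_trans _ _ (N z)); [apply: ler_piMl; rewrite ?normc_ge0|rewrite lerDl].
by rewrite subr0.
Qed.

(** In characteristic 0 the polynomial [X^n - 1] splits into distinct factors, and its [n] roots
    contain a generator. *)
Lemma primitive_root_exists n : (0 < n)%N -> exists z : R[i], n.-primitive_root z.
Proof.
move=> n_gt0; pose p : {poly R[i]} := 'X^n - 1; have [r Dp] := closed_field_poly_normal p.
rewrite (monicP _) ?monicXnsubC // scale1r in Dp.
have rn1: all n.-unity_root r by apply/allP=> z; rewrite -root_prod_XsubC -Dp.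
have sz_r: (n < (size r).+1)%N by rewrite -(size_prod_XsubC r id) -Dp size_XnsubC.
have [|z] := hasP (has_prim_root n_gt0 rn1 _ sz_r); last by exists z.
by rewrite -separable_prod_XsubC -Dp separable_Xn_sub_1 // pnatr_eq0 -lt0n.
Qed.

(* Averaging over the n-th roots of unity isolates the coefficient, which gives
   Cauchy's estimate with no integral over a circle. *)
Lemma cauchy_estimate f a (r B : R) k : pser f a -> 0 < r ->
  (forall z, N z = r -> N (f z) <= B) -> N (a k) * r ^+ k <= B.
Proof.
move=> fa r0 fB; have [K K0 KP] := pser_uniform fa r0.
(* The error is the cost of replacing [f] by its partial sum of length [n], for which averaging over
   [n] roots of unity is exact. *)
suff H n : (k < n)%N -> N (a k) * r ^+ k <= B + K * 2^-1 ^+ n.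
  rewrite -subr_le0; apply: (@le0_of_geometric _ _ K) => n.
  have kn : (k < maxn n k.+1)%N by rewrite leq_max ltnSn orbT.
  rewrite lerBlDl; apply: le_trans (H _ kn) _; rewrite lerD2l; apply: ler_wpM2l => //.
  by apply: ler_wiXn2l; rewrite ?invr_ge0 ?invf_le1 ?ler1n// leq_maxl.
move=> kn; have n0 : (0 < n)%N by apply: leq_ltn_trans kn.
have [om omP] := primitive_root_exists n0.
have om1 : om ^+ n = 1 := prim_expr_order omP.
have Nom j : N (om ^+ j) = 1.
  have : N om ^+ n == 1 by rewrite -normcX om1 Normc.normc1.
  rewrite pexpr_eq1 ?normc_ge0// => /eqP h; by rewrite normcX h expr1n.
(* The exponent [n - k] stands for [- k], since [om ^+ n = 1]; every term of index other than [k]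
   becomes a vanishing sum of roots of unity. *)
have E : \sum_(j < n) (om ^+ j) ^+ (n - k) * psum a n (r%:C * om ^+ j) = n%:R * (a k * r%:C ^+ k).
  rewrite /psum; under eq_bigr do rewrite mulr_sumr.
  rewrite exchange_big/= (bigD1 (Ordinal kn))//= [X in _ + X]big1 ?addr0 => [|l lk].
    rewrite (eq_bigr (fun=> a k * r%:C ^+ k)); first by rewrite sumr_const card_ord mulr_natl.
    move=> j _; rewrite exprMn mulrCA; congr (_ * _); rewrite mulrCA -exprD subnK ?(ltnW kn)//.
    by rewrite -exprM mulnC exprM om1 expr1n mulr1.
  pose x := om ^+ (n - k + l).
  rewrite (eq_bigr (fun j : 'I_n => a l * r%:C ^+ l * x ^+ j)); last first.
    move=> j _; rewrite exprMn mulrCA -!mulrA; congr (_ * _); rewrite mulrCA -exprD; congr (_ * _).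
    by rewrite /x -!exprM mulnC.
  rewrite -mulr_sumr.
  have x1 : x != 1.
    rewrite /x -(prim_order_dvd omP); apply: contra lk => nd; apply/eqP/val_inj => /=.
    have e : (n - k + l + k = n + l)%N by rewrite addnAC subnK// ltnW.
    have : ((n - k + l + k) %% n = k %% n)%N by rewrite -modnDml (eqP nd) add0n.
    by rewrite e modnDl !modn_small.
  have : (x - 1) * \sum_(j < n) x ^+ j = 0.
    by rewrite -subrX1 /x -exprM mulnC exprM om1 expr1n subrr.
  by move=> /eqP; rewrite mulf_eq0 subr_eq0 (negbTE x1)/= => /eqP ->; rewrite mulr0.
have nR : 0 < n%:R :> R by rewrite ltr0n.
rewrite -(ler_pM2l nR).
have -> : n%:R * (N (a k) * r ^+ k) = N (n%:R * (a k * r%:C ^+ k)).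
  by rewrite !Normc.normcM normc_nat normcX normc_real gtr0_norm.
rewrite -E; apply: le_trans (normc_sum _ _ _) _.
apply: (@le_trans _ _ (\sum_(j < n) (B + K * 2^-1 ^+ n))); last by rewrite sumr_const card_ord mulr_natl.
apply: ler_sum => j _; rewrite Normc.normcM -exprM Nom mul1r.
have nz : N (r%:C * om ^+ j) = r by rewrite Normc.normcM Nom mulr1 normc_real gtr0_norm.
set z := r%:C * _ in nz *; have -> : psum a n z = f z - (f z - psum a n z) by rewrite opprB addrC subrK.
by apply: le_trans (normcD _ _) _; rewrite normcNC lerD// ?fB// KP ?nz.
Qed.

End PowerSeriesCalculus.

(** * Integration over the plane *)

Section PlaneIntegral.
Variable R : realType.
Local Notation C := R[i]^o.
Local Notation N := (@Normc.normc R).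
Local Notation mu := (@lebesgue_measure R).
Local Notation RR := (measurableTypeR R * measurableTypeR R)%type.
Implicit Types (F G : RR -> R) (w z : RR).

Definition plane_integral F : \bar R :=
  (\int[lebesgue_measure \x lebesgue_measure]_(w in [set: R * R]) (F w)%:E)%E.

Definition plane_measurable F := measurable_fun [set: RR] F.

Lemma plane_integral_ge0 F : (forall w, 0 <= F w) -> (0 <= plane_integral F)%E.
Proof. by move=> F0; apply: integral_ge0 => w _; rewrite lee_fin. Qed.

Lemma le_plane_integral F G : plane_measurable F -> plane_measurable G ->
  (forall w, 0 <= F w) -> (forall w, F w <= G w) -> (plane_integral F <= plane_integral G)%E.
Proof.
move=> mF mG F0 FG; apply: ge0_le_integral => //.
- by move=> w _; rewrite lee_fin.
- exact/measurable_EFinP.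
- exact/measurable_EFinP.
- by move=> w _; rewrite lee_fin.
Qed.

Lemma plane_integralD F G : plane_measurable F -> plane_measurable G ->
  (forall w, 0 <= F w) -> (forall w, 0 <= G w) ->
  plane_integral (fun w => F w + G w) = (plane_integral F + plane_integral G)%E.
Proof.
move=> mF mG F0 G0; rewrite -ge0_integralD//.
- by move=> w _; rewrite lee_fin.
- exact/measurable_EFinP.
- by move=> w _; rewrite lee_fin.
- exact/measurable_EFinP.
Qed.

Lemma plane_integralZ (c : R) F : 0 <= c -> plane_measurable F -> (forall w, 0 <= F w) ->
  plane_integral (fun w => c * F w) = (c%:E * plane_integral F)%E.
Proof.
move=> c0 mF F0; rewrite -ge0_integralZl//.
- exact/measurable_EFinP.
- by move=> w _; rewrite lee_fin.
Qed.

Lemma plane_integral_xy F : plane_measurable F -> (forall w, 0 <= F w) ->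
  plane_integral F = (\int[mu]_x \int[mu]_y (F (x, y))%:E)%E.
Proof.
move=> mF F0; apply: fubini_tonelli1; first exact/measurable_EFinP.
by move=> w; rewrite lee_fin.
Qed.

Lemma plane_integral_yx F : plane_measurable F -> (forall w, 0 <= F w) ->
  plane_integral F = (\int[mu]_y \int[mu]_x (F (x, y))%:E)%E.
Proof.
move=> mF F0; apply: fubini_tonelli2; first exact/measurable_EFinP.
by move=> w; rewrite lee_fin.
Qed.

Lemma measurable_row F x : plane_measurable F -> measurable_fun [set: measurableTypeR R] (fun y : measurableTypeR R => F (x, y)).
Proof.
move=> mF; apply: (measurableT_comp mF).
by apply: measurable_fun_pair; [exact: measurable_cst|exact: measurable_id].
Qed.

Lemma measurable_col F y : plane_measurable F -> measurable_fun [set: measurableTypeR R] (fun x : measurableTypeR R => F (x, y)).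
Proof.
move=> mF; apply: (measurableT_comp mF).
by apply: measurable_fun_pair; [exact: measurable_id|exact: measurable_cst].
Qed.

Lemma measurable_plane_affine F (a b c d : R) : plane_measurable F ->
  plane_measurable (fun w : RR => F (a * w.1 + b, c * w.2 + d)).
Proof.
move=> mF; apply: (measurableT_comp mF); apply: measurable_fun_pair.
- exact: (measurableT_comp (measurable_affine a b) measurable_fst).
- exact: (measurableT_comp (measurable_affine c d) measurable_snd).
Qed.

Lemma integral_affineT (a c : R) (f : measurableTypeR R -> \bar R) : a != 0 ->
  measurable_fun [set: measurableTypeR R] f -> (forall x, (0 <= f x)%E) ->
  (\int[mu]_x f x = `|a|%:E * \int[mu]_x f (a * x + c)%R)%E.
Proof. by move=> a0 mf f0; rewrite (ge0_integral_affine c a0 _ mf)//. Qed.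

Lemma measurable_inner F : plane_measurable F -> (forall w, 0 <= F w) ->
  measurable_fun [set: measurableTypeR R] (fun x : measurableTypeR R => (\int[mu]_y (F (x, y))%:E)%E).
Proof.
move=> mF F0; have mFE : measurable_fun [set: RR] (EFin \o F) by exact/measurable_EFinP.
by apply: (@measurable_fun_fubini_tonelli_F _ _ _ _ _ mu (EFin \o F)) => // w; rewrite lee_fin.
Qed.

Lemma plane_integral_affine F (a b c d : R) : a != 0 -> c != 0 -> plane_measurable F -> (forall w, 0 <= F w) ->
  plane_integral F = ((`|a| * `|c|)%:E * plane_integral (fun w => F ((a * w.1 + b)%R, (c * w.2 + d)%R)))%E.
Proof.
move=> a0 c0 mF F0; have mG := measurable_plane_affine a b c d mF.
rewrite (plane_integral_xy mF F0) (plane_integral_xy mG (fun w => F0 _))/=.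
rewrite (integral_affineT b a0).
- rewrite EFinM -muleA; congr (_ * _)%E; rewrite -ge0_integralZl//; last 2 first.
  + exact: (measurable_inner mG (fun w => F0 _)).
  + by move=> x _; apply: integral_ge0 => y _; rewrite lee_fin.
  apply: eq_integral => x _; rewrite (integral_affineT d c0)//.
    by apply/measurable_EFinP; exact: measurable_row.
  by move=> y; rewrite lee_fin.
- exact: measurable_inner.
- by move=> x; apply: integral_ge0 => y _; rewrite lee_fin.
Qed.

Definition rot90 w : RR := (- w.2, w.1).

Lemma measurable_rot90 F : plane_measurable F -> plane_measurable (fun w => F (rot90 w)).
Proof.
move=> mF; apply: (measurableT_comp mF); apply: measurable_fun_pair; last exact: measurable_fst.
by apply: measurableT_comp; [exact: oppr_measurable|exact: measurable_snd].
Qed.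

(** A quarter turn exchanges the two coordinates up to a sign: Tonelli does the exchange, and
    reflection invariance on the line the sign. *)
Lemma plane_integral_rot90 F : plane_measurable F -> (forall w, 0 <= F w) ->
  plane_integral (fun w => F (rot90 w)) = plane_integral F.
Proof.
move=> mF F0; rewrite (plane_integral_xy (measurable_rot90 mF) (fun w => F0 _)) (plane_integral_yx mF F0).
apply: eq_integral => x _; rewrite /rot90/= [RHS](@integral_affineT (-1) 0)//.
- by rewrite normrN1 mul1e; apply: eq_integral => y _; rewrite mulN1r addr0.
- by apply/measurable_EFinP; exact: (measurable_col x mF).
- by move=> y; rewrite lee_fin.
Qed.

Definition box w (rho : R) : set RR := `[w.1 - rho, w.1 + rho] `*` `[w.2 - rho, w.2 + rho].

Lemma measurable_box w rho : measurable (box w rho).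
Proof. exact: measurableX. Qed.

Lemma boxP w rho z : box w rho z <-> `|z.1 - w.1| <= rho /\ `|z.2 - w.2| <= rho.
Proof.
by rewrite /box/= !in_itv/= !ler_distl; split=> -[-> ->].
Qed.

Lemma measurable_indic_box w rho : plane_measurable (\1_(box w rho)).
Proof. exact: (measurable_indic (measurable_box w rho)). Qed.

Lemma plane_integral_box w rho : 0 <= rho -> plane_integral (\1_(box w rho)) = (4 * rho ^+ 2)%:E.
Proof.
move=> rho0; rewrite /plane_integral integral_indic ?setIT//; last exact: measurable_box.
transitivity (mule (mu `[w.1 - rho, w.1 + rho]) (mu `[w.2 - rho, w.2 + rho])).
  exact: product_measure1E.
rewrite !lebesgue_measure_itv/= !lte_fin.
have E (x : R) : (x - rho < x + rho) = (0 < rho) by apply/idP/idP; lra.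
rewrite !E.
case: ltgtP rho0 => // [r0|<-] _; last by rewrite mul0e expr0n/= mulr0.
by rewrite -!EFinB -EFinM; congr (_%:E); ring.
Qed.

End PlaneIntegral.

(** * Measurability of entire functions, and contour integrals in plane coordinates *)

Section MeanValue.
Variable R : realType.
Local Notation C := R[i]^o.
Local Notation N := (@Normc.normc R).
Local Notation S := (@segment_integral R).
Local Notation mu := (@lebesgue_measure R).
Local Notation RR := (measurableTypeR R * measurableTypeR R)%type.
Local Notation I := ('i%C : C).
Implicit Types (f g : C -> C) (w z : RR).

Definition zc w : C := w.1 +i* w.2.

Lemma zc_ReIm (z : C) : zc (complex.Re z, complex.Im z) = z.
Proof. by case: z. Qed.

Lemma zcD w z : zc (w.1 + z.1, w.2 + z.2) = zc w + zc z.
Proof. by apply/eqP; rewrite eq_complex/= !eqxx. Qed.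

Lemma zc_rot90 w : zc (rot90 w) = I * zc w.
Proof. by apply/eqP; rewrite eq_complex/= !mul0r !mul1r !add0r !eqxx. Qed.

Lemma zc_iter_rot90 j w : zc (iter j (@rot90 R) w) = I ^+ j * zc w.
Proof. by elim: j => [|j IH]; rewrite ?expr0 ?mul1r// iterS zc_rot90 IH exprS mulrA. Qed.

Lemma measurable_fst_plane : plane_measurable (fun w : RR => w.1 : R).
Proof. exact: measurable_fst. Qed.

Lemma measurable_snd_plane : plane_measurable (fun w : RR => w.2 : R).
Proof. exact: measurable_snd. Qed.

Lemma plane_measurableD (F G : RR -> R) : plane_measurable F -> plane_measurable G ->
  plane_measurable (fun w => F w + G w).
Proof. by move=> mF mG; exact: measurable_realfun.measurable_funD. Qed.

Lemma plane_measurableB (F G : RR -> R) : plane_measurable F -> plane_measurable G ->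
  plane_measurable (fun w => F w - G w).
Proof. by move=> mF mG; exact: measurable_realfun.measurable_funB. Qed.

Lemma plane_measurableM (F G : RR -> R) : plane_measurable F -> plane_measurable G ->
  plane_measurable (fun w => F w * G w).
Proof. by move=> mF mG; exact: measurable_realfun.measurable_funM. Qed.

Lemma plane_measurable_cst (c : R) : plane_measurable (fun=> c).
Proof. exact: measurable_cst. Qed.

Lemma plane_measurable_comp (h : R -> R) (F : RR -> R) : measurable_fun [set: R] h ->
  plane_measurable F -> plane_measurable (fun w => h (F w)).
Proof. by move=> mh mF; exact: (measurableT_comp mh mF). Qed.

Lemma measurable_complex_pow n : plane_measurable (fun w => complex.Re (zc w ^+ n)) /\
  plane_measurable (fun w => complex.Im (zc w ^+ n)).
Proof.
elim: n => [|n [IHr IHi]]; first by split; exact: plane_measurable_cst.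
split.
- have -> : (fun w => complex.Re (zc w ^+ n.+1)) = (fun w => w.1 * complex.Re (zc w ^+ n) - w.2 * complex.Im (zc w ^+ n)).
    by apply/funext => w; rewrite exprS complex_ReM.
  by apply: plane_measurableB; apply: plane_measurableM => //; [exact: measurable_fst_plane|exact: measurable_snd_plane].
- have -> : (fun w => complex.Im (zc w ^+ n.+1)) = (fun w => w.1 * complex.Im (zc w ^+ n) + w.2 * complex.Re (zc w ^+ n)).
    by apply/funext => w; rewrite exprS complex_ImM.
  by apply: plane_measurableD; apply: plane_measurableM => //; [exact: measurable_fst_plane|exact: measurable_snd_plane].
Qed.

Lemma measurable_psum a n : plane_measurable (fun w => complex.Re (psum a n (zc w))) /\
  plane_measurable (fun w => complex.Im (psum a n (zc w))).
Proof.
elim: n => [|n [IHr IHi]].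
  by split; under eq_fun do rewrite /psum big_ord0; exact: plane_measurable_cst.
have [pr pi] := measurable_complex_pow n.
split.
- have -> : (fun w => complex.Re (psum a n.+1 (zc w))) = (fun w => complex.Re (psum a n (zc w)) +
      (complex.Re (a n) * complex.Re (zc w ^+ n) - complex.Im (a n) * complex.Im (zc w ^+ n))).
    by apply/funext => w; rewrite psumS raddfD/= complex_ReM.
  by apply: plane_measurableD => //; apply: plane_measurableB; apply: plane_measurableM => //; exact: plane_measurable_cst.
- have -> : (fun w => complex.Im (psum a n.+1 (zc w))) = (fun w => complex.Im (psum a n (zc w)) +
      (complex.Re (a n) * complex.Im (zc w ^+ n) + complex.Im (a n) * complex.Re (zc w ^+ n))).
    by apply/funext => w; rewrite psumS raddfD/= complex_ImM.
  by apply: plane_measurableD => //; apply: plane_measurableD; apply: plane_measurableM => //; exact: plane_measurable_cst.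
Qed.

(** Pointwise limit of the moduli of the Taylor polynomials, which are polynomial in the two
    coordinates. *)
Lemma measurable_normc_entire f : entire_cderiv f -> plane_measurable (fun w => N (f (zc w))).
Proof.
move=> /entire_pser[a [_ ca]].
have mN n : plane_measurable (fun w => N (psum a n (zc w))).
  have [pr pi] := measurable_psum a n.
  have -> : (fun w => N (psum a n (zc w))) = (fun w => Num.sqrt (complex.Re (psum a n (zc w)) * complex.Re (psum a n (zc w))
     + complex.Im (psum a n (zc w)) * complex.Im (psum a n (zc w)))).
    by apply/funext => w; rewrite /Normc.normc; case: (psum _ _ _) => x y /=; rewrite !expr2.
  apply: plane_measurable_comp.
    by apply: continuous_measurable_fun; exact: sqrt_continuous.
  by apply: plane_measurableD; apply: plane_measurableM.
apply: (@measurable_fun_cvg _ _ _ _ (fun n w => N (psum a n (zc w)))) => // w _.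
exact: (cvg_comp _ _ (ca (zc w)) (@continuous_normc R (f (zc w)))).
Qed.

Lemma measurable_normc_powR f (p : R) : entire_cderiv f -> plane_measurable (fun w => N (f (zc w)) `^ p).
Proof.
move=> ef; apply: (@plane_measurable_comp (fun x => x `^ p) (fun w => N (f (zc w)))).
  exact: measurable_powR.
exact: measurable_normc_entire.
Qed.

Local Notation I01 := (`[0%R, 1%R]%classic : set (measurableTypeR R)).

Lemma path_integral_norm (g : R -> C) : (forall t, 0 <= t <= 1 -> {for t, continuous g}) ->
  ((N (path_integral g))%:E <= 2%:E * \int[mu]_(t in I01) (N (g t))%:E)%E.
Proof.
move=> cg; have [gR gI] := continuous_path_integrable cg.
have iN : mu.-integrable I01 (EFin \o (fun t => N (g t))).
  apply: continuous_compact_integrable; first exact: segment_compact.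
  apply: continuous_in_subspaceT => t /[1!inE]/=; rewrite in_itv/= => t01.
  exact: (continuous_comp (cg t t01) (@continuous_normc R _)).
have mI : measurable I01 by [].
have B (f : R -> R) : mu.-integrable I01 (EFin \o f) -> (forall t, `|f t| <= N (g t)) ->
  `|\int[mu]_(t in I01) f t| <= \int[mu]_(t in I01) N (g t).
  move=> fi fK; apply: le_trans (le_normr_Rintegral mI fi) _.
  apply: le_Rintegral => //; by have := integrable_norm fi.
have -> : (\int[mu]_(t in I01) (N (g t))%:E)%E = (\int[mu]_(t in I01) N (g t))%:E.
  by rewrite /Rintegral fineK//; apply: integrable_fin_num.
rewrite -EFinM lee_fin; apply: le_trans (normc_le_ReIm _) _ => /=.
rewrite mulr_natl mulr2n; apply: lerD; apply: B => // t.
- exact: normr_Re_le.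
- exact: normr_Im_le.
Qed.

(** The factor [r] compensates [z^-1] on the side, where [r <= N z]. The length [2 * r] of the side
    turns the parameter in [[0, 1]] into the coordinate [y] in [[- r, r]]. *)
Lemma square_side_bound g (r : R) (j : nat) : 0 < r -> entire_cderiv g ->
  ((r * N (S (vertex r j) (vertex r j.+1) (fun x : C => g x * x^-1 ^+ 1)))%:E <=
   2%:E * \int[mu]_(y in `[(- r)%R, r]) (N (g (I ^+ j * zc (r, y))))%:E)%E.
Proof.
move=> r0 eg; have cg := entire_continuous eg.
pose l (t : R) : C := vertex r j + t%:C * (vertex r j.+1 - vertex r j).
have cF : outer_continuous r (fun x : C => g x * x^-1 ^+ 1).
  by apply: outer_continuousM; [exact: continuous_outer|exact: outer_continuousXV].
have cl (t : R) : {for t, continuous (fun t : R => g (l t))}.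
  exact: (continuous_comp (continuous_line (x := t)) (cg _)).
have mF : measurable_fun [set: measurableTypeR R] (fun t : measurableTypeR R => (N (g (l t)))%:E).
  apply/measurable_EFinP; apply: continuous_measurable_fun => t.
  exact: (continuous_comp (cl t) (@continuous_normc R _)).
have d2 : N (vertex r j.+1 - vertex r j) = 2 * r.
  have -> : vertex r j.+1 - vertex r j = r%:C * I ^+ j * (2 * I) by rewrite vertexS /vertex; ring.
  rewrite !Normc.normcM normcX normc_I expr1n !mulr1 normc_real gtr0_norm// normc_nat mulrC//.
rewrite segment_integralE Normc.normcM d2.
have -> : r * (2 * r * N (path_integral (fun t => g (l t) * (l t)^-1 ^+ 1))) =
  (2 * r) * (r * N (path_integral (fun t => g (l t) * (l t)^-1 ^+ 1))) by ring.
have cG t : 0 <= t <= 1 -> {for t, continuous (fun t : R => g (l t) * (l t)^-1 ^+ 1)}.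
  by move=> t01; exact: (continuous_comp (continuous_line (x := t)) (outer_continuous_side (j := j) r0 cF t01)).
have H1 : ((r * N (path_integral (fun t => g (l t) * (l t)^-1 ^+ 1)))%:E <= 2%:E * \int[mu]_(t in I01) (N (g (l t)))%:E)%E.
  rewrite EFinM; apply: le_trans.
    by apply: (lee_wpmul2l _ (path_integral_norm cG)); rewrite lee_fin ltW.
  rewrite muleCA; apply: lee_wpmul2l => //.
  rewrite -ge0_integralZl//; last 3 first.
  - apply/measurable_EFinP; apply: subspace_continuous_measurable_fun => //.
    apply: continuous_in_subspaceT => t /[1!inE]/=; rewrite in_itv/= => t01.
    exact: (continuous_comp (cG t t01) (@continuous_normc R _)).
  - by move=> t _; rewrite lee_fin normc_ge0.
  - by rewrite lee_fin ltW.
  apply: ge0_le_integral => //.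
  - by move=> t _; rewrite -EFinM lee_fin mulr_ge0 ?normc_ge0// ltW.
  - apply/measurable_EFinP; apply: subspace_continuous_measurable_fun => //.
    apply: continuous_in_subspaceT => t /[1!inE]/=; rewrite in_itv/= => t01.
    have ct := continuous_comp (cG t t01) (@continuous_normc R _).
    exact: (cvgM (cvg_cst r) ct).
  - exact: measurable_funTS.
  move=> t /=; rewrite in_itv/= => t01; rewrite -?EFinM lee_fin.
  have /andP[lr _] := normc_side_point j r0 t01.
  have l0 : 0 < N (l t) by exact: lt_le_trans lr.
  rewrite expr1 Normc.normcM Normc.normcV mulrCA; apply: ler_piMr; first exact: normc_ge0.
  by rewrite ler_pdivrMr// mul1r.
have -> : (\int[mu]_(y in `[(- r)%R, r]) (N (g (I ^+ j * zc (r, y))))%:E = (2 * r)%:E * \int[mu]_(t in I01) (N (g (l t)))%:E)%E.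
  have r2 : 2 * r != 0 by rewrite mulf_neq0 ?gt_eqF.
  rewrite (@ge0_integral_affine _ (2 * r) (- r))//.
  - rewrite gtr0_norm ?mulr_gt0//; congr (_ * _)%E.
    have -> : [set x : R | `[- r, r]%classic (2 * r * x - r)] = I01.
      apply/seteqP; split => x /=; rewrite !in_itv/= => /andP[h1 h2]; apply/andP; split.
      + by rewrite -(pmulr_rge0 _ r0); lra.
      + rewrite -(ler_pM2l r0); lra.
      + have : 0 <= r * x by rewrite mulr_ge0// ltW. lra.
      + have : r * x <= r by rewrite ger_pMr. lra.
    apply: eq_integral => t _; congr (N (g _))%:E; rewrite /l side_point mulrCA; congr (_ * _).
    rewrite /zc; apply/eqP; rewrite eq_complex/=; apply/andP; split; apply/eqP; ring.
  - apply/measurable_EFinP; apply: measurable_funTS; apply: continuous_measurable_fun => y.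
    have cz : {for y, continuous (fun y : R => I ^+ j * zc (r, y))}.
      have -> : (fun y : R => I ^+ j * zc (r, y)) = (fun y : R => I ^+ j * (r%:C + y%:C * I)).
        by apply/funext => x; congr (_ * _); apply/eqP; rewrite eq_complex/=; apply/andP; split; apply/eqP; ring.
      exact: (cvgM (cvg_cst _) (cvgD (cvg_cst _) (cvgM (@continuous_real_complex R y) (cvg_cst _)))).
    exact: (continuous_comp (continuous_comp cz (cg _)) (@continuous_normc R _)).
  - by move=> y _; rewrite lee_fin normc_ge0.
rewrite EFinM [leRHS]muleCA; apply: lee_wpmul2l => //.
by rewrite lee_fin mulr_ge0// ltW.
Qed.

End MeanValue.

(** * Sub-mean value inequality for |f|^p over squares *)

Section SubMeanValue.
Variable R : realType.
Local Notation C := R[i]^o.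
Local Notation N := (@Normc.normc R).
Local Notation mu := (@lebesgue_measure R).
Local Notation RR := (measurableTypeR R * measurableTypeR R)%type.
Local Notation I := ('i%C : C).
Implicit Types (f g : C -> C) (w z : RR).

Lemma indic_boxE w (rho : R) z : \1_(box w rho) z = ((`|z.1 - w.1| <= rho) && (`|z.2 - w.2| <= rho))%:R :> R.
Proof.
rewrite indicE; suff -> : (z \in box w rho) = (`|z.1 - w.1| <= rho) && (`|z.2 - w.2| <= rho) by [].
by apply/idP/andP => [/set_mem/boxP//|h]; exact/mem_set/boxP. Qed.

Lemma indic_box_rot90 j (rho : R) w :
  \1_(box (0, 0) rho) (iter j (@rot90 R) w) = \1_(box (0, 0) rho) w :> R.
Proof.
by elim: j => [//|j <-]; rewrite iterS !indic_boxE /rot90/= !subr0 normrN andbC.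
Qed.

Lemma measurable_iter_rot90 (F : RR -> R) j : plane_measurable F ->
  plane_measurable (fun w => F (iter j (@rot90 R) w)).
Proof.
move=> mF; elim: j => [//|j IH].
by have := measurable_rot90 IH; under eq_fun do rewrite -iterSr.
Qed.

(** Cauchy's formula at the centre, integrated over the half-side [r]. The sides of varying size
    fill part of the box; a quarter turn brings side [j] to a vertical line, and Tonelli assembles
    the lines. *)
Lemma area_mean0 g (rho : R) : 0 < rho -> entire_cderiv g ->
  ((rho ^+ 2 * N (g 0))%:E <=
   32%:E * plane_integral (fun w => (N (g (zc w)) * \1_(box (0%R, 0%R) rho) w)%R))%E.
Proof.
move=> rho0 eg; pose G w := N (g (zc w)) * \1_(box (0, 0) rho) w.
have mG : plane_measurable G.
  by apply: plane_measurableM; [exact: measurable_normc_entire|exact: measurable_indic_box].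
have G0 w : 0 <= G w by rewrite mulr_ge0 ?normc_ge0.
pose Gj j w := G (iter j (@rot90 R) w).
have Gj0 j w : 0 <= Gj j w by exact: G0.
have mGj j : plane_measurable (Gj j).
  exact: measurable_iter_rot90.
have iGj j : plane_integral (Gj j) = plane_integral G.
  elim: j => [//|j <-]; rewrite -(plane_integral_rot90 (mGj j))//.
  by congr plane_integral; apply/funext => w; rewrite /Gj -iterSr.
have side (r : R) : 0 < r -> r <= rho ->
  ((r * N (g 0))%:E <= 2%:E * \sum_(j < 4) \int[mu]_y (Gj j (r, y))%:E)%E.
  move=> r0 rr.
  have h1 : N (g 0) <= N (g 0 * square_integral r (fun x : C => x^-1)).
    by rewrite Normc.normcM ler_peMr ?normc_ge0//; exact: square_integral_V.
  have N0r : N (0 : C) < r by rewrite Normc.normc0.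
  have E := cauchy_expansion 0 r0 N0r eg.
  (* At [w = 0] the remainder carries the factor [w] and vanishes, so the expansion reduces to the
     mean value formula. *)
  have rem0 : square_integral r (cauchy_remainder g 0 1) = 0.
    have := @square_integral_bound R r (cauchy_remainder g 0 1) 0 r0 (cauchy_remainder_continuous r0 N0r (entire_continuous eg)).
    rewrite mulr0 => H.
    have : N (square_integral r (cauchy_remainder g 0 1)) == 0.
      rewrite eq_le normc_ge0 andbT; apply: H => j t _.
      by rewrite /cauchy_remainder expr1 mul0r Normc.normc0.
    by rewrite normc_eq0 => /eqP.
  rewrite E rem0 addr0 big_ord_recl big_ord0 expr0 mul1r addr0 in h1.
  apply: (@le_trans _ _ (\sum_(j < 4) r * N (segment_integral (vertex r j) (vertex r j.+1) (fun x : C => g x * x^-1 ^+ 1)))%:E).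
    rewrite lee_fin -mulr_sumr; apply: ler_wpM2l; first exact: ltW.
    by apply: le_trans h1 _; exact: normc_sum.
  rewrite -sumEFin ge0_sume_distrr; last by move=> j _; apply: integral_ge0 => y _; rewrite lee_fin.
  apply: lee_sum => j _; apply: le_trans (square_side_bound j r0 eg) _.
  apply: lee_wpmul2l => //.
  rewrite [leLHS]integral_mkcond; apply: ge0_le_integral => //.
  - by move=> y _; rewrite patchE; case: ifP => // _; rewrite lee_fin normc_ge0.
  - apply/measurable_restrict => //=; rewrite setTI; apply/measurable_EFinP; apply: measurable_funTS.
    have := measurable_row r (measurable_iter_rot90 j (measurable_normc_entire eg)).
    by under eq_fun do rewrite zc_iter_rot90.
  - by apply/measurable_EFinP; exact: measurable_row.
  move=> y _; rewrite patchE; case: ifPn => [/set_mem/=|_]; last by rewrite lee_fin.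
  rewrite in_itv/= => /andP[y1 y2]; rewrite lee_fin /Gj /G indic_box_rot90 zc_iter_rot90 indic_boxE/= !subr0.
  have -> : `|r| <= rho by rewrite gtr0_norm.
  have -> : `|y| <= rho by rewrite ler_norml; apply/andP; split; lra.
  by rewrite mulr1.
(* For [r] in [[rho / 2, rho]] both the factor [r] on the left and the length of the interval are at
   least [rho / 2], which costs 4. The side bounds give 2 and the four sides 4, whence 32. *)
have rh : 0 < rho / 2 by rewrite divr_gt0.
pose D : set (measurableTypeR R) := `[rho / 2, rho]%classic.
have mD : measurable D by exact: measurable_itv.
have muD : mu D = (rho / 2)%:E.
  rewrite /D lebesgue_measure_itv/= lte_fin.
  have -> : rho / 2 < rho by rewrite ltr_pdivrMr// ltr_pMr// ltr1n.
  by rewrite -EFinB; congr (_%:E); lra.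
have mrow j : measurable_fun [set: measurableTypeR R] (fun x : measurableTypeR R => (\int[mu]_y (Gj j (x, y))%:E)%E).
  exact: measurable_inner.
have irow j x : (0 <= \int[mu]_y (Gj j (x, y))%:E)%E by apply: integral_ge0 => y _; rewrite lee_fin.
have H : (\int[mu]_(x in D) (rho / 2 * N (g 0))%:E <= \int[mu]_(x in D) (2%:E * \sum_(j < 4) \int[mu]_y (Gj j (x, y))%:E))%E.
  apply: ge0_le_integral => //.
  - by move=> x _; rewrite lee_fin mulr_ge0 ?normc_ge0// ltW.
  - apply: measurable_funTS; apply: measurable_funeM; apply: emeasurable_sum => j; exact: mrow.
  move=> x; rewrite /D /= in_itv/= => /andP[x1 x2]; apply: le_trans (side x _ x2); last exact: lt_le_trans x1.
  by rewrite lee_fin; apply: ler_wpM2r => //; exact: normc_ge0.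
have H2 : (\int[mu]_(x in D) (2%:E * \sum_(j < 4) \int[mu]_y (Gj j (x, y))%:E) <= 8%:E * plane_integral G)%E.
  rewrite ge0_integralZl//; last 2 first.
  - by apply: measurable_funTS; apply: emeasurable_sum => j; exact: mrow.
  - by move=> x _; apply: sume_ge0 => j _.
  rewrite ge0_integral_sum//; last by move=> j; apply: measurable_funTS.
  apply: (@le_trans _ _ (2%:E * \sum_(j < 4) plane_integral G)%E).
    apply: lee_wpmul2l => //; apply: lee_sum => j _.
    rewrite -(iGj j) (plane_integral_xy (mGj j) (Gj0 j)).
    by apply: ge0_subset_integral.
  have pG0 : (0 <= plane_integral G)%E by exact: plane_integral_ge0.
  rewrite !big_ord_recl big_ord0 adde0; move: pG0; case: (plane_integral G) => [x _||//].
    by rewrite -!EFinD -!EFinM lee_fin; lra.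
  by move=> _; rewrite [leRHS]gt0_muley ?lte_fin// leey.
have H0 : (\int[mu]_(x in D) (rho / 2 * N (g 0))%:E = (rho / 2 * N (g 0) * (rho / 2))%:E)%E.
  by rewrite [RHS]EFinM -muD; exact: (integral_cst mu mD).
move: (le_trans H H2); rewrite H0 => H3.
have -> : rho ^+ 2 * N (g 0) = 4 * (rho / 2 * N (g 0) * (rho / 2)) by field.
rewrite EFinM; have -> : (32%:E = 4%:E * 8%:E :> \bar R)%E by rewrite -EFinM; congr (_%:E); lra.
by rewrite -muleA; apply: lee_wpmul2l.
Qed.

Lemma entire_translate f (c : C) : entire_cderiv f -> entire_cderiv (fun x => f (c + x)).
Proof.
move=> ef x; have [d dP] := ef (c + x); exists d => e e0; have [r r0 rP] := dP e e0.
by exists r => // h hr; rewrite addrA; exact: rP.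
Qed.

Lemma area_mean f w (rho : R) : 0 < rho -> entire_cderiv f ->
  ((rho ^+ 2 * N (f (zc w)))%:E <=
   32%:E * plane_integral (fun z => (N (f (zc z)) * \1_(box w rho) z)%R))%E.
Proof.
move=> rho0 ef; have := area_mean0 rho0 (entire_translate (zc w) ef); rewrite addr0.
move/le_trans; apply; apply: lee_wpmul2l => //.
rewrite [leRHS](@plane_integral_affine _ _ 1 w.1 1 w.2) ?oner_neq0//; last 2 first.
- by apply: plane_measurableM; [exact: measurable_normc_entire|exact: measurable_indic_box].
- by move=> z; rewrite mulr_ge0 ?normc_ge0.
rewrite normr1 mulr1 mul1e le_eqVlt; apply/orP; left; apply/eqP; congr plane_integral.
apply/funext => z; rewrite !indic_boxE/= !mul1r !addrK !subr0; congr (N (f _) * _).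
by rewrite -zcD; congr zc; rewrite /= ![w.1 + _]addrC ![w.2 + _]addrC.
Qed.

Lemma area_mean_real f w (rho J : R) (F : RR -> R) : 0 < rho -> entire_cderiv f ->
  plane_measurable F -> (forall z, N (f (zc z)) * \1_(box w rho) z <= F z) ->
  plane_integral F = J%:E -> rho ^+ 2 * N (f (zc w)) <= 32 * J.
Proof.
move=> rho0 ef mF fF FJ; rewrite -lee_fin; apply: le_trans (area_mean w rho0 ef) _.
rewrite EFinM -FJ; apply: lee_wpmul2l => //; apply: le_plane_integral => //.
- by apply: plane_measurableM; [exact: measurable_normc_entire|exact: measurable_indic_box].
- by move=> z; rewrite mulr_ge0 ?normc_ge0.
Qed.

Definition submean_bound (p K : R) := forall f w (rho : R), 0 < rho -> entire_cderiv f ->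
  ((rho ^+ 2 * N (f (zc w)) `^ p)%:E <=
   K%:E * plane_integral (fun z => (N (f (zc z)) `^ p * \1_(box w rho) z)%R))%E.

Lemma measurable_powR_box f (p : R) w rho : entire_cderiv f ->
  plane_measurable (fun z => N (f (zc z)) `^ p * \1_(box w rho) z).
Proof.
by move=> ef; apply: plane_measurableM; [exact: measurable_normc_powR|exact: measurable_indic_box].
Qed.

(** Truncation at the height [la], a fixed fraction of the value at the centre:
    [|f| <= la + la^(1-p) |f|^p] for [p >= 1]. Inserted in the area mean, the first term is absorbed
    by the left-hand side. *)
Lemma submean_ge1 (p : R) : 1 <= p -> exists2 K, 0 < K & submean_bound p K.
Proof.
(* The constant term contributes [32 * 4 * la * rho^2]; 256 makes this half of the left-hand side.
   The equation keeps [c] opaque until the final arithmetic. *)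
move=> p1; have [c cE] : exists c : R, c = 256 by exists 256.
have c0 : 0 < c by rewrite cE ltr0n.
exists (c `^ p); [exact: powR_gt0|move=> f w rho rho0 ef]; pose F z := N (f (zc z)) `^ p * \1_(box w rho) z.
have p0 : p != 0 by rewrite gt_eqF// (lt_le_trans ltr01).
have mF : plane_measurable F by exact: measurable_powR_box.
have F0 z : 0 <= F z by rewrite mulr_ge0 ?powR_ge0.
have K0 : 0 < c `^ p :> R by exact: powR_gt0.
have := plane_integral_ge0 F0; rewrite -/F.
case FJ : (plane_integral F) => [J| |]// J0; last first.
  by rewrite gt0_muley ?lte_fin// leey.
rewrite -EFinM lee_fin; rewrite lee_fin in J0.
have [u0|u0] := eqVneq (N (f (zc w))) 0.
  by rewrite u0 powR0// mulr0 mulr_ge0// ltW.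
have {}u0 : 0 < N (f (zc w)) by rewrite lt_neqAle eq_sym u0 normc_ge0.
pose la := N (f (zc w)) / c.
have la0 : 0 < la by rewrite divr_gt0.
have lap : 0 < la `^ p by exact: powR_gt0.
have H : rho ^+ 2 * N (f (zc w)) <= 32 * (la * (4 * rho ^+ 2) + la / la `^ p * J).
  apply: (@area_mean_real f w rho _ (fun z => la * \1_(box w rho) z + la / la `^ p * F z)) => //.
  - apply: plane_measurableD; apply: plane_measurableM => //; try exact: plane_measurable_cst.
    exact: measurable_indic_box.
  - move=> z; rewrite /F mulrA -mulrDl; apply: ler_wpM2r => //.
    have [h|h] := leP (N (f (zc z))) la.
      by apply: le_trans h _; rewrite lerDl mulr_ge0 ?powR_ge0// divr_ge0 ?powR_ge0// ltW.
    have s1 : 1 <= N (f (zc z)) / la by rewrite ler_pdivlMr// mul1r ltW.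
    have := le1r_powR s1 p1; rewrite powRM ?normc_ge0 ?invr_ge0 ?(ltW la0)// => H.
    apply: (@le_trans _ _ (la * (N (f (zc z)) `^ p * la^-1 `^ p))).
      have {1}-> : N (f (zc z)) = la * (N (f (zc z)) / la) by rewrite mulrC divfK// gt_eqF.
      by apply: ler_wpM2l => //; exact: ltW.
    have -> : la^-1 `^ p = (la `^ p)^-1.
      by rewrite -[la^-1]powR_inv1 ?(ltW la0)// -powRrM mulN1r powRN.
    have -> : la * (N (f (zc z)) `^ p * (la `^ p)^-1) = la / la `^ p * N (f (zc z)) `^ p by ring.
    by rewrite lerDr ltW.
  rewrite plane_integralD//; first last.
  - by move=> z; rewrite mulr_ge0// divr_ge0 ?powR_ge0// ltW.
  - by move=> z; rewrite mulr_ge0// ltW.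
  - by apply: plane_measurableM => //; exact: plane_measurable_cst.
  - by apply: plane_measurableM; [exact: plane_measurable_cst|exact: measurable_indic_box].
  rewrite !plane_integralZ//; first last.
  - exact: measurable_indic_box.
  - exact: ltW.
  - by rewrite divr_ge0 ?powR_ge0// ltW.
  by rewrite plane_integral_box ?(ltW rho0)// FJ -!EFinM -EFinD.
have ue : N (f (zc w)) = c * la by rewrite mulrC divfK// gt_eqF.
have up : N (f (zc w)) `^ p = c `^ p * la `^ p by rewrite ue powRM// ltW.
rewrite up mulrCA; apply: ler_wpM2l; first exact: ltW.
rewrite ue in H.
have H' : rho ^+ 2 * la * 4 <= la / la `^ p * J.
  by move: H; rewrite cE; move: (la / la `^ p * J) (rho ^+ 2) => x y; lra.
have : rho ^+ 2 * la * 4 * la `^ p <= la * J.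
  move: H'; rewrite -(ler_pM2r lap) => /le_trans; apply.
  by rewrite mulrAC divfK ?gt_eqF.
move=> h; rewrite -(ler_pM2l la0); apply: le_trans h.
have : 0 <= la * (rho ^+ 2 * la `^ p).
  by apply: mulr_ge0; [exact: ltW|apply: mulr_ge0; [exact: sqr_ge0|exact: ltW]].
have -> : rho ^+ 2 * la * 4 * la `^ p = 4 * (la * (rho ^+ 2 * la `^ p)) by ring.
by move: (la * (rho ^+ 2 * la `^ p)) => x; lra.
Qed.

Lemma entire_bounded_box f w (rho : R) : entire_cderiv f -> exists K, forall z, box w rho z -> N (f (zc z)) <= K.
Proof.
move=> ef; have [a fa] := entire_pser ef.
pose M := `|w.1| + `|w.2| + 2 * `|rho| + 1.
have M0 : 0 < M by rewrite ltr_wpDl// !addr_ge0// mulr_ge0.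
have [K K0 KP] := pser_uniform fa M0; exists K => z /boxP[h1 h2].
have := KP (zc z) 0%N; rewrite expr0 mulr1 /psum big_ord0 subr0; apply.
apply: le_trans (normc_le_ReIm _) _ => /=.
have e1 : `|z.1| <= `|w.1| + `|rho|.
  have -> : z.1 = w.1 + (z.1 - w.1) by rewrite addrC subrK.
  by apply: le_trans (ler_normD _ _) _; rewrite lerD2l; apply: le_trans h1 (ler_norm _).
have e2 : `|z.2| <= `|w.2| + `|rho|.
  have -> : z.2 = w.2 + (z.2 - w.2) by rewrite addrC subrK.
  by apply: le_trans (ler_normD _ _) _; rewrite lerD2l; apply: le_trans h2 (ler_norm _).
by rewrite /M; move: e1 e2; move: `|z.1| `|z.2| `|w.1| `|w.2| `|rho| => *; lra.
Qed.

(* For p < 1 the function |f|^p is compared with a near-maximum of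
   |f(z)|^p dist(z, boundary)^2, around which |f| is nearly constant. *)
Lemma submean_lt1 (p : R) : 0 < p -> p < 1 -> submean_bound p (8 * (32 * 8 `^ ((1 - p) / p))).
Proof.
move=> p0 p1 f w rho rho0 ef; pose F z := N (f (zc z)) `^ p * \1_(box w rho) z.
have pn0 : p != 0 by rewrite gt_eqF.
have mF : plane_measurable F by exact: measurable_powR_box.
have F0 z : 0 <= F z by rewrite mulr_ge0 ?powR_ge0.
pose c : R := 8 `^ ((1 - p) / p).
have c0 : 0 < c by exact: powR_gt0.
have K0 : 0 < 8 * (32 * c) by rewrite !mulr_gt0.
have := plane_integral_ge0 F0; rewrite -/F -/c.
case FJ : (plane_integral F) => [J| |]// J0; last first.
  by rewrite gt0_muley ?lte_fin// leey.
rewrite -EFinM lee_fin; rewrite lee_fin in J0.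
have [u0|u0] := eqVneq (N (f (zc w))) 0.
  by rewrite u0 powR0// mulr0 mulr_ge0// ltW.
have {}u0 : 0 < N (f (zc w)) by rewrite lt_neqAle eq_sym u0 normc_ge0.
(* Distance to the boundary of the box in the maximum norm. Since [h] vanishes on the boundary, a
   near-maximum has a box of half that distance around it. *)
pose d z := rho - Num.max `|z.1 - w.1| `|z.2 - w.2|.
pose h z := N (f (zc z)) `^ p * d z ^+ 2.
have [M MP] := entire_bounded_box w rho ef.
have dle z : box w rho z -> 0 <= d z <= rho.
  move=> /boxP[h1 h2]; rewrite /d subr_ge0 ge_max h1 h2/= gerBl le_max.
  by rewrite normr_ge0.
pose E := [set y | exists2 z, box w rho z & y = h z].
have ww : box w rho w by apply/boxP; rewrite !subrr !normr0 ltW.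
have hw : h w = rho ^+ 2 * N (f (zc w)) `^ p.
  by rewrite /h /d !subrr normr0 maxxx subr0 mulrC.
have hw0 : 0 < h w by rewrite hw mulr_gt0 ?exprn_gt0// powR_gt0.
have hE : has_sup E.
  split; first by exists (h w), w.
  exists (M `^ p * rho ^+ 2) => _ [z zb ->]; have /andP[d0 dr] := dle z zb.
  have M0 : 0 <= M by apply: le_trans (MP z zb); exact: normc_ge0.
  apply: ler_pM; rewrite ?powR_ge0 ?exprn_ge0//.
    by apply: ge0_ler_powR => //; rewrite ?nnegrE ?normc_ge0 ?(ltW p0)//; exact: MP.
  by apply: lerXn2r; rewrite ?nnegrE// ltW.
have hsup z : box w rho z -> h z <= sup E.
  by move=> zb; apply: ub_le_sup; [by case: hE|exists z].
have s0 : 0 < sup E by apply: lt_le_trans hw0 (hsup w ww).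
have [_ [z zb ->] zs] := @sup_adherent _ E (sup E / 2) (divr_gt0 s0 (ltr0n R 2)) hE.
have {}zs : sup E < 2 * h z by lra.
have hz0 : 0 < h z by lra.
have /andP[dz0 dzr] := dle z zb.
have {}dz0 : 0 < d z.
  rewrite lt_neqAle dz0 andbT eq_sym; apply: contraTneq hz0 => e0.
  by rewrite /h e0 expr0n/= mulr0 ltxx.
pose de := d z / 2; have de0 : 0 < de by rewrite divr_gt0.
have uz0 : 0 < N (f (zc z)).
  rewrite lt_neqAle normc_ge0 andbT eq_sym; apply: contraTneq hz0 => e0.
  by rewrite /h e0 powR0// mul0r ltxx.
have dd z' : box z de z' -> box w rho z' /\ de <= d z'.
  move=> /boxP[h1 h2].
  have m1 : `|z.1 - w.1| <= rho - d z by rewrite /d opprB [rho + _]addrC subrK le_max lexx.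
  have m2 : `|z.2 - w.2| <= rho - d z by rewrite /d opprB [rho + _]addrC subrK le_max lexx orbT.
  have t1 : `|z'.1 - w.1| <= rho - de.
    have -> : z'.1 - w.1 = (z'.1 - z.1) + (z.1 - w.1) by rewrite addrA subrK.
    by apply: le_trans (ler_normD _ _) _; rewrite /de in h1 *; lra.
  have t2 : `|z'.2 - w.2| <= rho - de.
    have -> : z'.2 - w.2 = (z'.2 - z.2) + (z.2 - w.2) by rewrite addrA subrK.
    by apply: le_trans (ler_normD _ _) _; rewrite /de in h2 *; lra.
  split; first by apply/boxP; split; [apply: le_trans t1 _|apply: le_trans t2 _]; lra.
  by rewrite /d lerBrDr -lerBrDl ge_max t1 t2.
(* 8 is 2 times 4: near-maximality costs 2, and the distance to the boundary, at most halved in the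
   small box, enters squared. *)
have up8 z' : box z de z' -> N (f (zc z')) `^ p <= 8 * N (f (zc z)) `^ p.
  move=> /dd[z'b dez]; have := hsup z' z'b; rewrite /h => H.
  have de2 : 0 < de ^+ 2 by rewrite exprn_gt0.
  rewrite -(ler_pM2r de2); apply: (@le_trans _ _ (N (f (zc z')) `^ p * d z' ^+ 2)).
    apply: ler_wpM2l; first exact: powR_ge0.
    by apply: lerXn2r; rewrite ?nnegrE ?(ltW de0)//; apply: le_trans dez; exact: ltW.
  apply: le_trans H _; apply: le_trans (ltW zs) _.
  by rewrite /h /de; lra.
(* The power [1 - p] of [|f|] is bounded by its value at [z]; what remains is [|f|^p], so the area
   mean of [|f|] turns into one of [|f|^p]. *)
have uz z' : box z de z' -> N (f (zc z')) <= c * N (f (zc z)) `^ (1 - p) * N (f (zc z')) `^ p.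
  move=> z'b.
  have {1}-> : N (f (zc z')) = N (f (zc z')) `^ (1 - p) * N (f (zc z')) `^ p.
    rewrite -powRD ?subrK ?powRr1 ?normc_ge0//.
    by apply/implyP; rewrite oner_eq0.
  apply: ler_wpM2r; first exact: powR_ge0.
  have e1 (x : R) : x `^ (1 - p) = (x `^ p) `^ ((1 - p) / p).
    by rewrite -powRrM mulrC divfK.
  rewrite (e1 (N (f (zc z')))) (e1 (N (f (zc z)))) /c -powRM ?powR_ge0//.
  apply: ge0_ler_powR; rewrite ?nnegrE ?mulr_ge0 ?powR_ge0 ?divr_ge0 ?subr_ge0 ?invr_ge0 ?(ltW p0) ?(ltW p1)//.
  exact: up8.
have H : de ^+ 2 * N (f (zc z)) <= 32 * (c * N (f (zc z)) `^ (1 - p) * J).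
  apply: (@area_mean_real f z de _ (fun z' => c * N (f (zc z)) `^ (1 - p) * F z')) => //.
  - by apply: plane_measurableM => //; exact: plane_measurable_cst.
  - move=> z'; rewrite [\1_(box z de) z']indicE; case: (boolP (z' \in box z de)) => [/set_mem z'b|_]; last first.
      by rewrite mulr0 mulr_ge0// mulr_ge0 ?powR_ge0// ltW.
    rewrite mulr1; apply: le_trans (uz z' z'b) _; rewrite /F indicE mem_set ?mulr1//.
    by have [] := dd z' z'b.
  rewrite plane_integralZ//; last by rewrite mulr_ge0 ?powR_ge0// ltW.
  by rewrite FJ -EFinM.
have up0 : 0 < N (f (zc z)) `^ (1 - p) by exact: powR_gt0.
have ue : N (f (zc z)) = N (f (zc z)) `^ (1 - p) * N (f (zc z)) `^ p.
  rewrite -powRD ?subrK ?powRr1 ?normc_ge0//.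
  by apply/implyP; rewrite oner_eq0.
have H' : de ^+ 2 * N (f (zc z)) `^ p <= 32 * c * J.
  rewrite -(ler_pM2l up0); move: H; rewrite {1}ue.
  move: (N (f (zc z)) `^ (1 - p)) (N (f (zc z)) `^ p) => x y H.
  have -> : x * (de ^+ 2 * y) = de ^+ 2 * (x * y) by ring.
  by apply: le_trans H _; have -> : 32 * (c * x * J) = x * (32 * c * J) by ring.
rewrite -hw; apply: le_trans (hsup w ww) _; apply: le_trans (ltW zs) _.
have -> : 2 * h z = 8 * (de ^+ 2 * N (f (zc z)) `^ p) by rewrite /h /de; field.
by rewrite -[leRHS]mulrA; apply: ler_wpM2l.
Qed.

Lemma submean (p : R) : 0 < p -> exists2 K, 0 < K & submean_bound p K.
Proof.
move=> p0; have [p1|p1] := leP 1 p.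
  exact: submean_ge1.
exists (8 * (32 * 8 `^ ((1 - p) / p))); last exact: submean_lt1.
by rewrite !mulr_gt0// powR_gt0.
Qed.

End SubMeanValue.

(** * Elementary inequalities for powers, exponentials and factorials *)

Section RealEstimates.
Variable R : realType.
Implicit Types (r h t x alpha : R).

(** Bernoulli's inequality, read off from Young's inequality for [t * 1] with exponents [alpha] and
    its conjugate. *)
Lemma powR_tangent alpha t : 1 < alpha -> 0 <= t -> 1 + alpha * (t - 1) <= t `^ alpha.
Proof.
move=> a1 t0; have a0 : 0 < alpha by exact: lt_trans a1.
have b0 : 0 < 1 - alpha^-1 by rewrite subr_gt0 invf_lt1.
have := @conjugate_powR R t 1 alpha (1 - alpha^-1)^-1 t0 ler01 a0.
rewrite invr_gt0 invrK => /(_ b0) H.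
have {}H := H (subrKC _ _); rewrite mulr1 powR1 mul1r in H.
move: H; rewrite -(ler_pM2l a0) mulrDr [alpha * (_ / _)]mulrCA mulfV ?gt_eqF// mulr1.
rewrite mulrBr mulr1 mulfV ?gt_eqF//; lra.
Qed.

(** The tangent at [r + h], after scaling by [r + h]: a mean value estimate for [x^alpha] without
    derivatives. *)
Lemma powR_increment alpha r h : 1 < alpha -> 0 <= r -> 0 <= h ->
  (r + h) `^ alpha <= r `^ alpha + alpha * (h * (r + h) `^ (alpha - 1)).
Proof.
move=> a1 r0 h0; have a0 : 0 < alpha by exact: lt_trans a1.
have [e|s0] := eqVneq (r + h) 0.
  have r00 : r = 0 by apply/eqP; rewrite eq_le r0 andbT; lra.
  have h00 : h = 0 by apply/eqP; rewrite eq_le h0 andbT; lra.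
  by rewrite r00 h00 addr0 mul0r mulr0 addr0.
have {}s0 : 0 < r + h by rewrite lt_neqAle eq_sym s0 addr_ge0.
have := powR_tangent a1 (divr_ge0 r0 (ltW s0)).
have sp : 0 < (r + h) `^ alpha by exact: powR_gt0.
rewrite -(ler_pM2l sp) -powRM ?divr_ge0 ?(ltW s0)// mulrC [(r + h) * _]mulrC divfK ?gt_eqF//.
have sE : (r + h) `^ alpha = (r + h) * (r + h) `^ (alpha - 1) by rewrite mulr_powRB1// ltW.
have -> : (1 + alpha * (r / (r + h) - 1)) * (r + h) `^ alpha = (r + h) `^ alpha - alpha * (h * (r + h) `^ (alpha - 1)).
  rewrite [in LHS]sE [in X in _ = X - _]sE; move: ((r + h) `^ (alpha - 1)) => y.
  by field; rewrite gt_eqF.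
lra.
Qed.

Lemma exprn_le_fact x n : 0 <= x -> x ^+ n <= n`!%:R * expR x.
Proof.
move=> x0; case: n => [|n].
  by rewrite expr0 fact0 mul1r -[leLHS](expR0 R) ler_expR.
rewrite mulrC -ler_pdivrMr ?ltr0n ?fact_gt0//; apply: le_trans (expR_ge1Dxn n x0).
by rewrite lerDr.
Qed.

(** A crude Stirling bound [n! <= e n (n/e)^n]. The induction step is [(1 - y)^(1/y) <= 1/e] with
    [y = 1/(n+2)]. *)
Lemma fact_le_exp n : n.+1`!%:R <= expR 1 * n.+1%:R * (n.+1%:R ^+ n.+1 * expR (- n.+1%:R)) :> R.
Proof.
elim: n => [|n IH].
  by rewrite factS fact0 muln1 mulr1 expr1n mul1r -expRD subrr expR0.
have e0 : 0 < expR 1 :> R by exact: expR_gt0.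
rewrite factS natrM.
apply: (@le_trans _ _ (n.+2%:R * (expR 1 * n.+1%:R * (n.+1%:R ^+ n.+1 * expR (- n.+1%:R))))).
  by apply: ler_wpM2l.
have key : expR 1 * n.+1%:R ^+ n.+2 <= n.+2%:R ^+ n.+2 :> R.
  pose y : R := n.+2%:R^-1.
  have n2 : 0 < n.+2%:R :> R by rewrite ltr0n.
  have y1 : 1 - y <= expR (- y) by rewrite expR_ge1Dx.
  have e : n.+1%:R = n.+2%:R * (1 - y) :> R.
    by rewrite mulrBr mulr1 /y mulfV ?gt_eqF// -[n.+2%:R]natr1 addrK.
  have yp : 0 <= 1 - y by rewrite subr_ge0 /y invf_le1// ler1n.
  rewrite {1}e exprMn mulrCA -[leRHS]mulr1; apply: ler_wpM2l; first by rewrite exprn_ge0.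
  apply: (@le_trans _ _ (expR 1 * expR (- y) ^+ n.+2)).
    by apply: ler_wpM2l; [exact: ltW|apply: lerXn2r; rewrite ?nnegrE ?expR_ge0].
  by rewrite -expRM_natl mulrN /y mulfV ?gt_eqF// -expRD subrr expR0.
have -> : expR (- n.+1%:R) = expR 1 * expR (- n.+2%:R) :> R.
  by rewrite -expRD -[n.+2%:R]natr1; congr expR; ring.
have -> : n.+2%:R * (expR 1 * n.+1%:R * (n.+1%:R ^+ n.+1 * (expR 1 * expR (- n.+2%:R)))) =
  expR 1 * n.+2%:R * ((expR 1 * n.+1%:R ^+ n.+2) * expR (- n.+2%:R)) :> R.
  by rewrite [n.+1%:R ^+ n.+2]exprS; move: (n.+2%:R) (n.+1%:R ^+ n.+1) (expR (- _)) (expR 1) => *; ring.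
apply: ler_wpM2l; first by rewrite mulr_ge0// ltW.
by apply: ler_wpM2r; first exact: expR_ge0.
Qed.

End RealEstimates.

(** * The weight exp(-|z|^alpha) and Taylor coefficients *)

Section Weights.
Variables (R : realType) (alpha : R).
Hypothesis alpha_gt2 : 2 < alpha.
Local Notation C := R[i]^o.
Local Notation N := (@Normc.normc R).
Implicit Types (f g : C -> C) (z : C) (r : R).

Let a0 : 0 < alpha. Proof. by apply: lt_trans alpha_gt2. Qed.
Let a1 : 1 < alpha. Proof. by apply: lt_trans alpha_gt2; rewrite ltr1n. Qed.

(* The weight n!^(1/alpha) alpha^(-n/alpha) is, up to powers of n,
   the maximum of r^n exp(-r^alpha). *)
Definition peak (n : nat) : R := (n`!%:R / alpha ^+ n) `^ alpha^-1.

Lemma peak_gt0 n : 0 < peak n.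
Proof. by rewrite powR_gt0// divr_gt0 ?ltr0n ?fact_gt0// exprn_gt0. Qed.

Lemma powR_nat_swap r n (b : R) : 0 <= r -> (r ^+ n) `^ b = (r `^ b) ^+ n.
Proof.
by move=> r0; rewrite -(powR_mulrn n r0) -(powR_mulrn n (powR_ge0 r b)) -!powRrM mulrC.
Qed.

(** The inequality [t^n <= n! exp t] at [t = alpha * r^alpha], raised to the power [1/alpha]. *)
Lemma exprn_le_peak r n : 0 <= r -> r ^+ n <= peak n * expR (r `^ alpha).
Proof.
move=> r0; have ra0 : 0 <= r `^ alpha by exact: powR_ge0.
have rE : r ^+ n = ((r `^ alpha) ^+ n) `^ alpha^-1.
  by rewrite powR_nat_swap// -powRrM mulfV ?gt_eqF// powRr1.
have eE : expR (r `^ alpha) = expR (alpha * r `^ alpha) `^ alpha^-1.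
  by rewrite [alpha * _]mulrC expRM -powRrM mulfV ?gt_eqF// powRr1// expR_ge0.
rewrite rE eE /peak -powRM ?expR_ge0//; last by rewrite divr_ge0 ?exprn_ge0// ltW.
apply: ge0_ler_powR; rewrite ?nnegrE ?invr_ge0 ?(ltW a0) ?exprn_ge0//.
  by rewrite mulr_ge0 ?expR_ge0// divr_ge0 ?exprn_ge0// ltW.
rewrite mulrAC ler_pdivlMr ?exprn_gt0// -exprMn [r `^ _ * _]mulrC.
by apply: exprn_le_fact; rewrite mulr_ge0// ltW.
Qed.

(** The witness solves [r^alpha = (n+1)/alpha], the critical point of [r^(n+1) exp(- r^alpha)]. The
    Stirling bound shows that only a factor linear in [n] is lost there. *)
Lemma peak_attained n : exists2 r, 0 < r & r <= n.+1%:R /\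
  peak n.+1 * expR (r `^ alpha) <= (expR 1 * n.+1%:R) * r ^+ n.+1.
Proof.
have n0 : 0 < n.+1%:R / alpha by rewrite divr_gt0.
pose x : R := n.+1%:R.
have n1 : 1 <= x by rewrite /x ler1n.
have x0 : 0 < x by exact: lt_le_trans n1.
have ia : 0 <= alpha^-1 by rewrite invr_ge0 ltW.
have ia1 : alpha^-1 <= 1 by rewrite invf_le1// ltW.
exists ((x / alpha) `^ alpha^-1); first exact: powR_gt0.
have rE : ((x / alpha) `^ alpha^-1) `^ alpha = x / alpha.
  by rewrite -powRrM mulVf ?gt_eqF// powRr1// ltW.
split.
  apply: (@le_trans _ _ (x `^ alpha^-1)); last exact: ler1_powR.
  apply: ge0_ler_powR; rewrite ?nnegrE// ?(ltW n0) ?(ltW x0)//.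
  by rewrite ler_pdivrMr// ler_peMr ?(ltW x0)// ltW.
rewrite rE.
have c1 : 1 <= expR 1 * x by rewrite mulr_ege1// -[leLHS](expR0 R) ler_expR.
apply: (@le_trans _ _ ((expR 1 * x) `^ alpha^-1 * ((x / alpha) `^ alpha^-1) ^+ n.+1)); last first.
  by apply: ler_wpM2r; [rewrite exprn_ge0 ?powR_ge0|exact: ler1_powR].
rewrite -powR_nat_swap ?(ltW n0)// -powRM ?(le_trans ler01 c1) ?exprn_ge0 ?(ltW n0)//.
have -> : expR (x / alpha) = expR x `^ alpha^-1 by rewrite -expRM.
rewrite /peak -powRM ?expR_ge0//; last by rewrite divr_ge0// exprn_ge0// ltW.
apply: ge0_ler_powR; rewrite ?nnegrE ?mulr_ge0 ?expR_ge0 ?divr_ge0 ?exprn_ge0 ?invr_ge0 ?divr_ge0 ?exprn_ge0 ?(ltW a0) ?(ltW x0)//.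
have an0 : 0 < alpha ^+ n.+1 by rewrite exprn_gt0.
rewrite mulrAC ler_pdivrMr// -[leRHS]mulrA -exprMn divfK ?gt_eqF//.
have := fact_le_exp R n; rewrite -/x.
have ex : 0 < expR x by exact: expR_gt0.
rewrite -(ler_pM2r ex) => /le_trans; apply.
rewrite -!mulrA -expRD addNr expR0 mulr1 !mulrA//.
Qed.

(** The polynomial factor records the loss incurred in passing from the norm to pointwise values. *)
Definition growth f (G : R) (D : nat) :=
  forall z, N (f z) <= G * (1 + N z) ^+ D * expR (N z `^ alpha).

(** Cauchy's estimate on the nearly optimal circle. Its radius is at most [n], so [(1 + r)^D] costs
    a power [D] of [n + 1], and [peak_attained] one more. *)
Lemma growth_coef f a (G : R) D n : pser f a -> growth f G D ->
  N (a n) <= expR 1 * G * n.+1%:R ^+ D.+1 / peak n.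
Proof.
move=> fa fG.
have G0 : 0 <= G.
  have := fG 0; rewrite Normc.normc0 addr0 expr1n mulr1 => h.
  by have := le_trans (normc_ge0 _) h; rewrite pmulr_lge0// expR_gt0.
have e1 : 1 <= expR 1 :> R by rewrite -[leLHS](expR0 R) ler_expR.
case: n => [|n].
  have -> : peak 0 = 1 by rewrite /peak fact0 expr0 divr1 powR1.
  rewrite divr1 expr1n mulr1 -(pser0 fa); apply: le_trans (fG 0) _.
  rewrite Normc.normc0 addr0 expr1n mulr1 powR0 ?gt_eqF// expR0 mulr1.
  by rewrite ler_peMl.
have [r r0 [rn rP]] := peak_attained n.
have H : N (a n.+1) * r ^+ n.+1 <= G * (1 + r) ^+ D * expR (r `^ alpha).
  by apply: (cauchy_estimate n.+1 fa r0) => z <-; exact: fG.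
have rn0 : 0 < r ^+ n.+1 by rewrite exprn_gt0.
have p0 := peak_gt0 n.+1.
rewrite ler_pdivlMr// -(ler_pM2r rn0).
apply: (@le_trans _ _ (G * (1 + r) ^+ D * (peak n.+1 * expR (r `^ alpha)))).
  by rewrite mulrAC [leRHS]mulrCA [leRHS]mulrC; apply: ler_wpM2r => //; exact: ltW.
apply: (@le_trans _ _ (G * (1 + r) ^+ D * (expR 1 * n.+1%:R * r ^+ n.+1))).
  by apply: ler_wpM2l => //; rewrite mulr_ge0// exprn_ge0// addr_ge0// ltW.
rewrite !mulrA; apply: ler_wpM2r; first exact: ltW.
have h1 : (1 + r) ^+ D <= n.+2%:R ^+ D.
  have h : 1 + r <= n.+2%:R by rewrite -[X in _ <= X]natr1 addrC lerD2r.
  apply: lerXn2r; [|by rewrite nnegrE ler0n|exact: h].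
  by rewrite nnegrE addr_ge0 ?(ltW r0).
have h2 : n.+1%:R <= n.+2%:R :> R by rewrite ler_nat.
rewrite exprSr -!mulrA [leRHS]mulrCA; apply: ler_wpM2l => //.
rewrite mulrCA; apply: ler_wpM2l; first exact: expR_ge0.
by apply: ler_pM; rewrite ?exprn_ge0 ?addr_ge0 ?(ltW r0).
Qed.

(** Counterpart of [growth] with the polynomial on the other side: [growth] is what a finite norm
    gives, [decay] is what suffices for one when [L * p >= 4]. *)
Definition decay f (B : R) (L : nat) :=
  forall z, N (f z) * (1 + N z) ^+ L <= B * expR (N z `^ alpha).

Lemma one_plus_pow r L : 0 <= r -> (1 + r) ^+ L <= 2 ^+ L * (1 + r ^+ L).
Proof.
move=> r0; have [h|h] := leP r 1.
  apply: (@le_trans _ _ (2 ^+ L)); first by apply: lerXn2r; rewrite ?nnegrE ?addr_ge0//; lra.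
  by rewrite ler_peMr ?exprn_ge0// lerDl exprn_ge0.
apply: (@le_trans _ _ ((2 * r) ^+ L)); first by apply: lerXn2r; rewrite ?nnegrE ?addr_ge0 ?mulr_ge0//; lra.
by rewrite exprMn; apply: ler_wpM2l; [rewrite exprn_ge0|rewrite lerDr].
Qed.

Lemma peak_mono_shift n L : peak n <= alpha ^+ L * peak (n + L).
Proof.
have ia : 0 <= alpha^-1 by rewrite invr_ge0 ltW.
have ia1 : alpha^-1 <= 1 by rewrite invf_le1// ltW.
have aL : 1 <= alpha ^+ L by rewrite exprn_ege1// ltW.
apply: (@le_trans _ _ ((alpha ^+ L) `^ alpha^-1 * peak (n + L))); last first.
  by apply: ler_wpM2r; [exact/ltW/peak_gt0|exact: ler1_powR].
rewrite /peak -powRM ?divr_ge0 ?exprn_ge0 ?(ltW a0)//.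
apply: ge0_ler_powR; rewrite ?nnegrE ?mulr_ge0 ?divr_ge0 ?exprn_ge0 ?invr_ge0 ?exprn_ge0 ?(ltW a0)//.
have -> : alpha ^+ L * ((n + L)`!%:R / alpha ^+ (n + L)) = (n + L)`!%:R / alpha ^+ n.
  by rewrite exprD; field; rewrite !expf_neq0// gt_eqF.
apply: ler_wpM2r; first by rewrite invr_ge0 exprn_ge0// ltW.
by rewrite ler_nat; apply: leq_fact; rewrite leq_addr.
Qed.

Definition decay_const (L : nat) : R := 2 ^+ L * (alpha ^+ L + 1).

Lemma decay_const_ge0 L : 0 <= decay_const L.
Proof. by rewrite mulr_ge0 ?addr_ge0 ?exprn_ge0// ltW. Qed.

Lemma monomial_decay r n L : 0 <= r ->
  r ^+ n * (1 + r) ^+ L <= decay_const L * peak (n + L) * expR (r `^ alpha).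
Proof.
move=> r0; apply: (@le_trans _ _ (2 ^+ L * (r ^+ n + r ^+ (n + L)))).
  have -> : 2 ^+ L * (r ^+ n + r ^+ (n + L)) = r ^+ n * (2 ^+ L * (1 + r ^+ L)) by rewrite exprD; ring.
  by apply: ler_wpM2l; [rewrite exprn_ge0|exact: one_plus_pow].
rewrite /decay_const -!mulrA; apply: ler_wpM2l; first by rewrite exprn_ge0.
rewrite [leRHS]mulrA mulrDl mul1r mulrDl; apply: lerD; last exact: exprn_le_peak.
apply: le_trans (exprn_le_peak n r0) _; apply: ler_wpM2r; first exact: expR_ge0.
exact: peak_mono_shift.
Qed.

(** Bounds an entire function by a weighted sum of its coefficients. The summation takes place
    pointwise, where the triangle inequality holds for every [p]. *)
Lemma pser_decay f a (B : R) L : pser f a ->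
  (forall m, \sum_(n < m) N (a n) * peak (n + L) <= B) -> decay f (decay_const L * B) L.
Proof.
move=> [_ ca] aB z; have z0 : 0 < (1 + N z) ^+ L by rewrite exprn_gt0// ltr_pwDl// normc_ge0.
rewrite -ler_pdivlMr// -[f z]subr0; apply: (cvgC_dist_le (m := 0%N) (ca z)) => m _.
rewrite subr0 ler_pdivlMr//; apply: (@le_trans _ _ ((\sum_(n < m) N (a n) * N z ^+ n) * (1 + N z) ^+ L)).
  apply: ler_wpM2r; first exact: ltW.
  by apply: le_trans (normc_sum _ _ _) _; apply: ler_sum => n _; rewrite Normc.normcM normcX.
rewrite mulr_suml; apply: (@le_trans _ _ (\sum_(n < m) decay_const L * (N (a n) * peak (n + L)) * expR (N z `^ alpha))).
  apply: ler_sum => n _; rewrite -mulrA [decay_const L * _]mulrCA -[leRHS]mulrA.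
  by apply: ler_wpM2l; [exact: normc_ge0|exact: monomial_decay (normc_ge0 z)].
rewrite -mulr_suml -mulr_sumr; apply: ler_wpM2r; first exact: expR_ge0.
by apply: ler_wpM2l; [exact: decay_const_ge0|exact: aB].
Qed.

End Weights.

(** * The Fock norm against pointwise growth and decay *)

Section FockNorm.
Variables (R : realType) (p alpha : R).
Hypothesis p_gt0 : 0 < p.
Hypothesis alpha_gt2 : 2 < alpha.
Local Notation C := R[i]^o.
Local Notation N := (@Normc.normc R).
Local Notation mu := (@lebesgue_measure R).
Local Notation RR := (measurableTypeR R * measurableTypeR R)%type.
Local Notation normp := (fock_normp p (@radial_power R alpha)).
Implicit Types (f g : C -> C) (w z : RR).

Let a0 : 0 < alpha. Proof. by apply: lt_trans alpha_gt2. Qed.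
Let a1 : 1 < alpha. Proof. by apply: lt_trans alpha_gt2; rewrite ltr1n. Qed.

Definition weight w : R := expR (- p * N (zc w) `^ alpha).

Definition wdensity f w : R := N (f (zc w)) `^ p * weight w.

Lemma fock_normpE f : normp f = plane_integral (wdensity f).
Proof. by []. Qed.

Lemma weight_ge0 w : 0 <= weight w.
Proof. exact: expR_ge0. Qed.

Lemma wdensity_ge0 f w : 0 <= wdensity f w.
Proof. by rewrite mulr_ge0 ?powR_ge0 ?weight_ge0. Qed.

Lemma entire_id : entire_cderiv (fun x : C => x).
Proof. by move=> x; exists 1; apply/cderiv_is_derive; exact: is_derive_id. Qed.

Lemma measurable_normc_zc : plane_measurable (fun w : RR => N (zc w)).
Proof. exact: (measurable_normc_entire entire_id). Qed.

Lemma measurable_weight : plane_measurable weight.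
Proof.
apply: (@plane_measurable_comp _ (fun x => expR (- p * x `^ alpha)) (fun w => N (zc w))) measurable_normc_zc.
apply: (measurableT_comp (@measurable_expR R)); apply: measurable_realfun.measurable_funM; first exact: measurable_cst.
exact: measurable_powR.
Qed.

Lemma measurable_wdensity f : entire_cderiv f -> plane_measurable (wdensity f).
Proof. by move=> ef; apply: plane_measurableM; [exact: measurable_normc_powR|exact: measurable_weight]. Qed.

(** An integrable majorant of [(1 + |z|)^-4] in product form, so that its integral reduces to
    arctangent integrals on the line. *)
Definition cauchy_density w : R := (1 + w.1 ^+ 2)^-1 * (1 + w.2 ^+ 2)^-1.

Lemma measurable_oneDsqrV : measurable_fun [set: measurableTypeR R] (fun x : measurableTypeR R => (1 + x ^+ 2)^-1).
Proof. by apply: continuous_measurable_fun; exact: continuous_oneDsqrV. Qed.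

Lemma oneDsqrV_ge0 (x : R) : 0 <= (1 + x ^+ 2)^-1.
Proof. by rewrite invr_ge0 addr_ge0// sqr_ge0. Qed.

Lemma measurable_cauchy_density : plane_measurable cauchy_density.
Proof.
apply: plane_measurableM.
- exact: (measurableT_comp measurable_oneDsqrV measurable_fst).
- exact: (measurableT_comp measurable_oneDsqrV measurable_snd).
Qed.

Lemma integral_oneDsqrV : exists2 J : R, 0 <= J & (\int[mu]_x ((1 + x ^+ 2)^-1)%:E = J%:E)%E.
Proof.
have mO := measurable_oneDsqrV.
have mE : measurable_fun [set: measurableTypeR R] (fun x : measurableTypeR R => ((1 + x ^+ 2)^-1)%:E).
  exact/measurable_EFinP.
have E1 : (\int[mu]_(x in `[0%R, +oo[) ((1 + x ^+ 2)^-1)%:E = (pi / 2)%:E)%E by exact: integral0y_oneDsqr.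
have E2 : (\int[mu]_(x in `]-oo, 0%R]) ((1 + x ^+ 2)^-1)%:E = (pi / 2)%:E)%E.
  rewrite -E1 (ge0_integration_by_substitution0 mE).
    by apply: eq_integral => x _; rewrite sqrrN.
  by move=> x; rewrite lee_fin oneDsqrV_ge0.
have le : (\int[mu]_x ((1 + x ^+ 2)^-1)%:E <= (pi / 2)%:E + (pi / 2)%:E)%E.
  have -> : [set: measurableTypeR R] = `]-oo, 0%R] `|` `]0%R, +oo[.
    apply/seteqP; split => // x _; rewrite /= !in_itv/= andbT.
    by have [h|h] := leP x 0; [left|right].
  rewrite ge0_integral_setU//; first last.
  - rewrite disj_set2E; apply/eqP; rewrite -subset0 => x []/=; rewrite !in_itv/= andbT => h1 h2.
    by move: (le_lt_trans h1 h2); rewrite ltxx.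
  - by move=> x _; rewrite lee_fin oneDsqrV_ge0.
  - exact: measurable_funTS.
  rewrite E2; apply: leeD => //; rewrite -E1; apply: ge0_subset_integral => //.
  - exact: measurable_funTS.
  - by move=> x _; rewrite lee_fin oneDsqrV_ge0.
  - by move=> x /=; rewrite !in_itv/= !andbT; exact: ltW.
have ge : (0 <= \int[mu]_x ((1 + x ^+ 2)^-1)%:E)%E.
  by apply: integral_ge0 => x _; rewrite lee_fin oneDsqrV_ge0.
move: le ge; case: (\int[mu]_x ((1 + x ^+ 2)^-1)%:E)%E => [J _ J0| |]//.
by exists J.
Qed.

Lemma plane_integral_cauchy : exists2 J : R, 0 <= J & plane_integral cauchy_density = J%:E.
Proof.
have [J J0 JP] := integral_oneDsqrV; exists (J * J); first exact: mulr_ge0.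
rewrite (plane_integral_xy measurable_cauchy_density); last by move=> w; rewrite mulr_ge0 ?oneDsqrV_ge0.
have mE : measurable_fun [set: measurableTypeR R] (fun x : measurableTypeR R => ((1 + x ^+ 2)^-1)%:E).
  by apply/measurable_EFinP; exact: measurable_oneDsqrV.
transitivity (\int[mu]_x (J%:E * ((1 + x ^+ 2)^-1)%:E))%E.
  apply: eq_integral => x _; rewrite /cauchy_density/=.
  rewrite muleC -JP -ge0_integralZl//; last 2 first.
  - by move=> y _; rewrite lee_fin oneDsqrV_ge0.
  - by rewrite lee_fin oneDsqrV_ge0.
rewrite ge0_integralZl//; last by move=> y _; rewrite lee_fin oneDsqrV_ge0.
by rewrite JP EFinM.
Qed.

Lemma normc_sqr w : N (zc w) ^+ 2 = w.1 ^+ 2 + w.2 ^+ 2.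
Proof. by rewrite /zc /Normc.normc sqr_sqrtr// addr_ge0 ?sqr_ge0. Qed.

Lemma one_plus_normc_ge1 (x : C) : 1 <= 1 + N x.
Proof. by rewrite lerDl normc_ge0. Qed.

Lemma one_plus_normc_gt0 (x : C) : 0 < 1 + N x.
Proof. by rewrite ltr_pwDl// normc_ge0. Qed.

Lemma cauchy_density_ge w : ((1 + N (zc w)) ^+ 4)^-1 <= cauchy_density w.
Proof.
rewrite /cauchy_density -invfM lef_pV2 ?posrE ?exprn_gt0 ?one_plus_normc_gt0//; last first.
  by rewrite mulr_gt0// ltr_pwDl// sqr_ge0.
have h : N (zc w) ^+ 2 = w.1 ^+ 2 + w.2 ^+ 2 := normc_sqr w.
have n0 : 0 <= N (zc w) := normc_ge0 _.
have x0 := sqr_ge0 w.1; have y0 := sqr_ge0 w.2.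
apply: (@le_trans _ _ ((1 + N (zc w) ^+ 2) ^+ 2)).
  by rewrite h; move: (w.1 ^+ 2) (w.2 ^+ 2) x0 y0 => x y x0 y0; have := mulr_ge0 x0 y0; nra.
rewrite -[4%N]/(2 * 2)%N exprM; apply: lerXn2r; rewrite ?nnegrE ?exprn_ge0 ?addr_ge0 ?sqr_ge0//.
by rewrite sqrrD; move: n0; move: (N (zc w)) => n n0; lra.
Qed.

(** The weight cancels the exponential, and what remains of the decay, [(1 + |z|)^(- L p)], is below
    [cauchy_density]. *)
Lemma decay_weight (u B : R) L w : 4 <= L%:R * p -> 0 <= u ->
  u * (1 + N (zc w)) ^+ L <= B * expR (N (zc w) `^ alpha) ->
  u `^ p * weight w <= B `^ p * cauchy_density w.
Proof.
move=> Lp u0 uB; have x1 := one_plus_normc_ge1 (zc w); have x0 := one_plus_normc_gt0 (zc w).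
have B0 : 0 <= B.
  have h : 0 <= B * expR (N (zc w) `^ alpha).
    by apply: le_trans uB; rewrite mulr_ge0// exprn_ge0// ltW.
  by move: h; rewrite pmulr_lge0// expR_gt0.
apply: (@le_trans _ _ (B `^ p * ((1 + N (zc w)) ^+ 4)^-1)); last first.
  by apply: ler_wpM2l; [exact: powR_ge0|exact: cauchy_density_ge].
rewrite ler_pdivlMr ?exprn_gt0//.
have h : (u * (1 + N (zc w)) ^+ L) `^ p <= (B * expR (N (zc w) `^ alpha)) `^ p.
  by apply: ge0_ler_powR; rewrite ?nnegrE ?(ltW p_gt0) ?mulr_ge0 ?expR_ge0 ?exprn_ge0 ?(ltW x0)//.
rewrite !powRM ?exprn_ge0 ?expR_ge0 ?(ltW x0)// in h.
have e1 : expR (N (zc w) `^ alpha) `^ p = expR (p * N (zc w) `^ alpha).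
  by rewrite [p * _]mulrC expRM.
have e2 : (1 + N (zc w)) ^+ 4 <= ((1 + N (zc w)) ^+ L) `^ p.
  rewrite -!powR_mulrn ?(ltW x0)// -powRrM; exact: ler_powR.
have we : 0 < weight w by exact: expR_gt0.
apply: (@le_trans _ _ (u `^ p * ((1 + N (zc w)) ^+ L) `^ p * weight w)).
  rewrite mulrAC; apply: ler_wpM2r; first exact: ltW.
  by apply: ler_wpM2l => //; exact: powR_ge0.
apply: (@le_trans _ _ (B `^ p * expR (p * N (zc w) `^ alpha) * weight w)).
  by apply: ler_wpM2r; [exact: ltW|rewrite -e1].
by rewrite -mulrA /weight -expRD mulNr subrr expR0 mulr1.
Qed.

Lemma decay_normp L : 4 <= L%:R * p -> exists2 J : R, 0 <= J &
  forall f B, entire_cderiv f -> decay alpha f B L -> (normp f <= (J * B `^ p)%:E)%E.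
Proof.
move=> Lp; have [J J0 JP] := plane_integral_cauchy; exists J => // f B ef fB.
rewrite fock_normpE mulrC EFinM -JP -plane_integralZ ?powR_ge0//; first last.
- by move=> w; rewrite mulr_ge0 ?oneDsqrV_ge0.
- exact: measurable_cauchy_density.
apply: le_plane_integral.
- exact: measurable_wdensity.
- by apply: plane_measurableM; [exact: plane_measurable_cst|exact: measurable_cauchy_density].
- exact: wdensity_ge0.
- by move=> w; exact: (decay_weight Lp (normc_ge0 _) (fB _)).
Qed.

Lemma box_normc w (rho : R) z : box w rho z -> N (zc z) <= N (zc w) + 2 * rho.
Proof.
move=> /boxP[h1 h2]; have -> : zc z = zc w + (zc z - zc w) by rewrite addrC subrK.
apply: le_trans (normcD _ _) _; rewrite lerD2l; apply: le_trans (normc_le_ReIm _) _.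
by rewrite /=; lra.
Qed.

Lemma weight_compare (rho r c : R) w z : 0 <= rho -> N (zc w) <= r ->
  alpha * (2 * rho * (r + 2 * rho) `^ (alpha - 1)) <= c -> box w rho z ->
  expR (- p * r `^ alpha) <= expR (p * c) * weight z.
Proof.
move=> rho0 wr hc /box_normc zw.
have r0 : 0 <= r by apply: le_trans wr; exact: normc_ge0.
rewrite -expRD ler_expR !mulNr lerNl opprD opprK addrC lerBlDl -mulrDr; apply: ler_wpM2l; first exact: ltW.
apply: (@le_trans _ _ ((r + 2 * rho) `^ alpha)).
  apply: ge0_ler_powR; rewrite ?nnegrE ?normc_ge0 ?(ltW a0) ?addr_ge0 ?mulr_ge0//.
  by apply: le_trans zw _; rewrite lerD2r.
have h := @powR_increment R alpha r (2 * rho) a1 r0 (mulr_ge0 (ler0n R 2) rho0).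
by apply: le_trans h _; rewrite addrC lerD2r.
Qed.

(** [c] bounds the oscillation of [|z|^alpha] over the box, by [powR_increment]; so the weight can
    be moved under the integral at the price [expR (p * c)]. *)
Lemma submean_weight : exists2 K : R, 0 < K & forall f w (rho r c : R), 0 < rho -> N (zc w) <= r ->
  alpha * (2 * rho * (r + 2 * rho) `^ (alpha - 1)) <= c -> entire_cderiv f ->
  ((rho ^+ 2 * (N (f (zc w)) `^ p * expR (- p * r `^ alpha)))%:E <=
   (K * expR (p * c))%:E * plane_integral (fun z => (wdensity f z * \1_(box w rho) z)%R))%E.
Proof.
have [K K0 KP] := @submean R p p_gt0; exists K => // f w rho r c rho0 wr hc ef.
rewrite mulrA [_ * expR (- p * _)]mulrC EFinM.
apply: le_trans.
  by apply: lee_wpmul2l (KP f w rho rho0 ef); rewrite lee_fin expR_ge0.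
rewrite muleCA [K * _]mulrC [in leRHS]EFinM -[leRHS]muleA [leRHS]muleCA.
apply: lee_wpmul2l; first by rewrite lee_fin ltW.
have mb := measurable_powR_box (f := f) p w rho ef.
have mw : plane_measurable (fun z => wdensity f z * \1_(box w rho) z).
  by apply: plane_measurableM; [exact: measurable_wdensity|exact: measurable_indic_box].
rewrite -!plane_integralZ ?expR_ge0//; first last.
- by move=> z; rewrite mulr_ge0 ?powR_ge0.
- by move=> z; rewrite mulr_ge0 ?wdensity_ge0.
apply: le_plane_integral.
- by apply: plane_measurableM => //; exact: plane_measurable_cst.
- by apply: plane_measurableM => //; exact: plane_measurable_cst.
- by move=> z; rewrite mulr_ge0 ?expR_ge0// mulr_ge0 ?powR_ge0.
move=> z; rewrite !mulrA; have [zb|zb] := boolP (z \in box w rho); last first.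
  by rewrite indicE (negbTE zb) !mulr0.
rewrite indicE zb !mulr1 /wdensity mulrC [leRHS]mulrAC [leRHS]mulrC.
apply: ler_wpM2l; first exact: powR_ge0.
exact: (weight_compare (ltW rho0) wr hc (set_mem zb)).
Qed.

Lemma wdensity_box_le f w (rho : R) : entire_cderiv f ->
  (plane_integral (fun z => (wdensity f z * \1_(box w rho) z)%R) <= normp f)%E.
Proof.
move=> ef; rewrite fock_normpE; apply: le_plane_integral.
- by apply: plane_measurableM; [exact: measurable_wdensity|exact: measurable_indic_box].
- exact: measurable_wdensity.
- by move=> z; rewrite mulr_ge0 ?wdensity_ge0.
- by move=> z; rewrite ler_piMr ?wdensity_ge0// indicE; case: (_ \in _).
Qed.

(* At distance (1 + |z|)^(-alpha) the weight exp(-p |z|^alpha) varies by a bounded factor. *)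
Lemma fock_growth : exists D : nat, exists2 K : R, 0 <= K & forall f (M : R), entire_cderiv f ->
  (normp f <= M%:E)%E -> growth alpha f ((K * M) `^ p^-1) D.
Proof.
have [K K0 KP] := submean_weight.
(* [rho ^- 2] is of order [(1 + |z|)^(2 alpha)]; after the [p]-th root its exponent is
   [2 alpha / p], rounded up to an integer degree. *)
have [D DP] := archimedean_nat (2 * alpha / p).
exists D.+1, (4 * (K * expR (p * alpha))); first by rewrite !mulr_ge0 ?expR_ge0// ltW.
move=> f M ef fM x; pose w : RR := (complex.Re x, complex.Im x).
have wx : zc w = x by exact: zc_ReIm.
pose y := 1 + N x; have y0 : 0 < y := one_plus_normc_gt0 x; have y1 : 1 <= y := one_plus_normc_ge1 x.
have yn : y != 0 by rewrite gt_eqF.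
(* With [2 * rho = y^(- alpha)] the oscillation bound is [alpha * y^(- alpha) * y^(alpha - 1)], at
   most [alpha]. The denominator 2 is the source of the 4 in the constant. *)
pose rho := y `^ (- alpha) / 2.
have rho0 : 0 < rho by rewrite divr_gt0// powR_gt0.
have rho1 : 2 * rho <= 1.
  rewrite /rho mulrC divfK//; apply: (@le_trans _ _ (y `^ 0)); last by rewrite powRr0.
  by apply: ler_powR => //; rewrite oppr_le0 ltW.
have hc : alpha * (2 * rho * (N x + 2 * rho) `^ (alpha - 1)) <= alpha.
  rewrite -[leRHS]mulr1; apply: ler_wpM2l; first exact: ltW.
  apply: (@le_trans _ _ (y `^ (- alpha) * y `^ (alpha - 1))).
    have {1}-> : 2 * rho = y `^ (- alpha) by rewrite /rho mulrC divfK.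
    apply: ler_wpM2l; first exact: powR_ge0.
    apply: ge0_ler_powR; rewrite ?nnegrE ?subr_ge0 ?(ltW a1) ?addr_ge0 ?normc_ge0 ?mulr_ge0 ?(ltW rho0) ?(ltW y0)//; first exact: powR_ge0.
    by rewrite /y [1 + N x]addrC lerD2l.
  rewrite -powRD ?yn ?implybT// addrA addNr add0r.
  apply: (@le_trans _ _ (y `^ 0)); last by rewrite powRr0.
  by apply: ler_powR => //; lra.
have wr : N (zc w) <= N x by rewrite wx.
have := KP f w rho (N x) alpha rho0 wr hc ef; rewrite wx => H.
have := le_trans H (lee_wpmul2l _ (le_trans (wdensity_box_le w rho ef) fM)).
rewrite lee_fin mulr_ge0 ?expR_ge0 ?(ltW K0)// => /(_ isT); rewrite -EFinM lee_fin => {}H.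
have M0 : 0 <= M by rewrite -lee_fin; apply: le_trans fM; rewrite fock_normpE; apply: plane_integral_ge0; exact: wdensity_ge0.
have KM0 : 0 <= 4 * (K * expR (p * alpha)) * M by rewrite !mulr_ge0 ?expR_ge0// ltW.
have H2 : N (f x) `^ p <= (4 * (K * expR (p * alpha)) * M) * (y ^+ D.+1) `^ p * expR (N x `^ alpha) `^ p.
  have e1 : expR (N x `^ alpha) `^ p = expR (p * N x `^ alpha) by rewrite [p * _]mulrC expRM.
  have ye : y `^ (2 * alpha) <= (y ^+ D.+1) `^ p.
    rewrite -powR_mulrn ?(ltW y0)// -powRrM; apply: ler_powR => //.
    by rewrite -ler_pdivrMr.
  rewrite e1; apply: (@le_trans _ _ ((4 * (K * expR (p * alpha)) * M) * y `^ (2 * alpha) * expR (p * N x `^ alpha))); last first.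
    by apply: ler_wpM2r; [exact: expR_ge0|apply: ler_wpM2l].
  have ee : expR (- p * N x `^ alpha) * expR (p * N x `^ alpha) = 1 by rewrite -expRD mulNr addNr expR0.
  have re : 4 * rho ^+ 2 * y `^ (2 * alpha) = 1.
    rewrite /rho expr_div_n -powR_mulrn ?powR_ge0// -powRrM.
    have -> : 4 * (y `^ (- alpha * 2) / 2 ^+ 2) * y `^ (2 * alpha) = y `^ (- alpha * 2) * y `^ (2 * alpha).
      by field.
    by rewrite -powRD ?yn ?implybT// mulNr mulrC addNr powRr0.
  have yp : 0 < y `^ (2 * alpha) by exact: powR_gt0.
  have ep : 0 < expR (p * N x `^ alpha) by exact: expR_gt0.
  rewrite -[leLHS]mulr1 -{1}ee -[leLHS]mulr1 -{1}re.
  have -> : N (f x) `^ p * (expR (- p * N x `^ alpha) * expR (p * N x `^ alpha)) * (4 * rho ^+ 2 * y `^ (2 * alpha)) =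
     (rho ^+ 2 * (N (f x) `^ p * expR (- p * N x `^ alpha))) * (4 * y `^ (2 * alpha) * expR (p * N x `^ alpha)) by ring.
  apply: (@le_trans _ _ (K * expR (p * alpha) * M * (4 * y `^ (2 * alpha) * expR (p * N x `^ alpha)))).
    by apply: ler_wpM2r => //; rewrite !mulr_ge0// ltW.
  by rewrite le_eqVlt; apply/orP; left; apply/eqP; ring.
have pinv x' : 0 <= x' -> (x' `^ p) `^ p^-1 = x' :> R.
  by move=> h; rewrite -powRrM mulfV ?gt_eqF// powRr1.
rewrite -[leLHS]pinv ?normc_ge0//.
apply: le_trans (ge0_ler_powR _ _ _ H2) _; rewrite ?nnegrE ?invr_ge0 ?powR_ge0 ?(ltW p_gt0) ?mulr_ge0 ?powR_ge0 ?expR_ge0 ?(ltW K0)//.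
rewrite powRM ?powR_ge0 ?mulr_ge0 ?powR_ge0 ?expR_ge0 ?(ltW K0)//.
rewrite powRM ?powR_ge0 ?mulr_ge0 ?expR_ge0 ?(ltW K0)//.
by rewrite !pinv ?expR_ge0 ?exprn_ge0// ltW.
Qed.

End FockNorm.

(** * Increments of the Volterra primitive *)

Section VolterraIncrement.
Variable R : realType.
Local Notation C := R[i]^o.
Local Notation N := (@Normc.normc R).
Local Notation S := (@segment_integral R).
Implicit Types (f g : C -> C) (x : C).

Lemma volterra_cderiv f x : entire_cderiv f -> cderiv (volterra f) x (f x).
Proof.
by move=> /entire_pser[a fa]; apply: (pser_cderiv (pser_volterra fa)); rewrite dcoef_vcoef; exact: fa.2.
Qed.

Lemma entire_volterra f : entire_cderiv f -> entire_cderiv (volterra f).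
Proof. by move=> ef x; exists (f x); exact: volterra_cderiv. Qed.

Lemma volterra0 f : volterra f 0 = 0.
Proof. by rewrite /volterra /segment_integral subr0 mul0r. Qed.

Lemma volterra_increment f a b : entire_cderiv f -> volterra f b - volterra f a = S a b f.
Proof.
move=> ef; apply/esym/segment_FTC; first by move=> t _; exact: volterra_cderiv.
exact/continuous_segment_continuous/entire_continuous.
Qed.

(** The path from 0 to [x] is cut at [s * x], so that a short final stretch, where [f] may be large,
    enters only with its own length. *)
Lemma volterra_two_scale f x (s A B : R) : entire_cderiv f -> 0 <= s <= 1 ->
  (forall t : R, 0 <= t <= s -> N (f (t%:C * x)) <= A) ->
  (forall t : R, s <= t <= 1 -> N (f (t%:C * x)) <= B) ->
  N (volterra f x) <= 2 * N x * A + 2 * ((1 - s) * N x) * B.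
Proof.
move=> ef /andP[s0 s1] fA fB.
have -> : volterra f x = S 0 (s%:C * x) f + S (s%:C * x) x f.
  by rewrite -!volterra_increment// volterra0 subr0 addrC subrK.
have cf a b : segment_continuous a b f by exact/continuous_segment_continuous/entire_continuous.
have A0 : 0 <= A by apply: le_trans (fA 0 _); rewrite ?normc_ge0// lexx.
apply: le_trans (normcD _ _) _; apply: lerD.
- apply: (@le_trans _ _ (2 * N (s%:C * x - 0) * A)); last first.
    rewrite subr0 Normc.normcM normc_real ger0_norm//; apply: ler_wpM2r => //.
    by apply: ler_wpM2l => //; rewrite ler_piMl ?normc_ge0.
  apply: segment_integral_bound => // t /andP[t0 t1].
  have -> : 0 + t%:C * (s%:C * x - 0) = (t * s)%:C * x :> C by rewrite add0r subr0 mulrA real_complexM.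
  by apply: fA; rewrite mulr_ge0//= ler_piMl.
- have e : x - s%:C * x = (1 - s)%:C * x by rewrite real_complexB; ring.
  have -> : (1 - s) * N x = N (x - s%:C * x) by rewrite e Normc.normcM normc_real ger0_norm ?subr_ge0.
  apply: segment_integral_bound => // t /andP[t0 t1].
  have -> : s%:C * x + t%:C * (x - s%:C * x) = (s + t * (1 - s))%:C * x :> C.
    by rewrite e real_complexD real_complexM; ring.
  apply: fB; rewrite lerDl mulr_ge0 ?subr_ge0//=.
  have := mulr_ge0 (_ : 0 <= 1 - t) (_ : 0 <= 1 - s); rewrite !subr_ge0 => /(_ t1 s1).
  by move=> h; lra.
Qed.

End VolterraIncrement.

(** * Inequalities for quasi-norms and for powers against exponentials *)

Section RealExtra.
Variable R : realType.

Lemma powR_addr_le (x y p : R) : 0 < p -> 0 <= x -> 0 <= y -> (x + y) `^ p <= 2 `^ p * (x `^ p + y `^ p).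
Proof.
move=> p0; wlog xy : x y / x <= y.
  move=> H x0 y0; have [h|/ltW h] := leP x y; first exact: H.
  by rewrite addrC [x `^ p + _]addrC; exact: H.
move=> x0 y0; apply: (@le_trans _ _ ((2 * y) `^ p)).
  by apply: ge0_ler_powR; rewrite ?nnegrE ?(ltW p0) ?addr_ge0 ?mulr_ge0//; lra.
by rewrite powRM//; apply: ler_wpM2l; rewrite ?powR_ge0// lerDr powR_ge0.
Qed.

Lemma pow_le_expR_powR (e : R) m : 0 < e ->
  exists2 c : R, 0 <= c & forall r, 1 <= r -> (1 + r) ^+ m <= c * expR (r `^ e).
Proof.
move=> e0; have [k kP] := archimedean_nat (m%:R / e).
exists (2 ^+ m * k.+1`!%:R); first by rewrite mulr_ge0// exprn_ge0.
move=> r r1; have r0 : 0 <= r by apply: le_trans r1.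
apply: (@le_trans _ _ ((2 * r) ^+ m)); first by apply: lerXn2r; rewrite ?nnegrE ?addr_ge0 ?mulr_ge0//; lra.
rewrite exprMn -mulrA; apply: ler_wpM2l; first by rewrite exprn_ge0.
apply: le_trans (exprn_le_fact k.+1 (powR_ge0 r e)).
rewrite -(powR_mulrn m r0) -(powR_mulrn k.+1 (powR_ge0 r e)) -powRrM.
by apply: ler_powR => //; rewrite mulrC -ler_pdivrMr.
Qed.

End RealExtra.

(** * Tonelli's theorem for pairs of points of the plane *)

Section PlaneArea.
Variable R : realType.
Local Notation mu := (@lebesgue_measure R).
Local Notation RR := (measurableTypeR R * measurableTypeR R)%type.

(** A named copy of the product measure, to carry the sigma-finite structure that Tonelli requires
    when each variable is itself a point of the plane. *)
Definition plane_area : set RR -> \bar R := (mu \x mu)%E.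

HB.instance Definition _ := Measure.copy plane_area (mu \x mu)%E.

Lemma plane_area_sigma_finite : sigma_finite [set: RR] plane_area.
Proof.
exists (fun n => box (0, 0) n%:R).
  apply/seteqP; split => // w _; have [n nP] := archimedean_nat (`|w.1| + `|w.2|).
  by exists n.+1 => //; apply/boxP; rewrite !subr0; split; apply: le_trans nP; rewrite ?lerDl ?lerDr.
move=> n; split; first exact: measurable_box.
have := plane_integral_box (0, 0) (ler0n R n); rewrite /plane_integral integral_indic ?setIT//; last exact: measurable_box.
by rewrite /plane_area => ->; rewrite ltry.
Qed.

HB.instance Definition _ := Measure_isSigmaFinite.Build _ _ _ plane_area plane_area_sigma_finite.

Lemma plane_tonelli (F : RR -> RR -> R) : measurable_fun [set: RR * RR] (fun u => F u.1 u.2) ->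
  (forall z w, 0 <= F z w) ->
  (\int[mu \x mu]_(z in [set: RR]) plane_integral (F z) =
   \int[mu \x mu]_(w in [set: RR]) plane_integral (F^~ w))%E.
Proof.
move=> mF F0; have mE : measurable_fun [set: RR * RR] (fun u => (F u.1 u.2)%:E) by exact/measurable_EFinP.
have F0E u : (0 <= (F u.1 u.2)%:E)%E by rewrite lee_fin.
have H := @fubini_tonelli _ _ RR RR R plane_area plane_area (fun u => (F u.1 u.2)%:E) mE F0E.
exact H.
Qed.

Lemma measurable_plane_inner (F : RR -> RR -> R) : measurable_fun [set: RR * RR] (fun u => F u.1 u.2) ->
  (forall z w, 0 <= F z w) -> measurable_fun [set: RR] (fun z => plane_integral (F z)).
Proof.
move=> mF F0; have mE : measurable_fun [set: RR * RR] (fun u => (F u.1 u.2)%:E) by exact/measurable_EFinP.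
have F0E u : (0 <= (F u.1 u.2)%:E)%E by rewrite lee_fin.
exact: (@measurable_fun_fubini_tonelli_F _ _ RR RR R plane_area (fun u => (F u.1 u.2)%:E) mE F0E).
Qed.

End PlaneArea.

(** * The Volterra operator preserves the Fock space *)

Section VolterraBounded.
Variables (R : realType) (p alpha : R).
Hypothesis p_gt0 : 0 < p.
Hypothesis alpha_gt2 : 2 < alpha.
Local Notation C := R[i]^o.
Local Notation N := (@Normc.normc R).
Local Notation mu := (@lebesgue_measure R).
Local Notation RR := (measurableTypeR R * measurableTypeR R)%type.
Local Notation normp := (fock_normp p (@radial_power R alpha)).
Implicit Types (f g : C -> C) (w z : RR).

Let a0 : 0 < alpha. Proof. by apply: lt_trans alpha_gt2. Qed.
Let a1 : 1 < alpha. Proof. by apply: lt_trans alpha_gt2; rewrite ltr1n. Qed.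

(** The solution of [p * aa + 2 * aa = 2 * (alpha - 1)]. It balances the gain [h^p] of a stretch of
    length [h = |z|^(- aa)] against the ratio of the areas of boxes of sizes [|z|^(1 - alpha)] and
    [h]. It lies below [alpha - 1], which leaves a positive exponent for the decay far from [z]. *)
Let aa : R := (alpha - 1) / (1 + p / 2).

Let p20 : 0 < 1 + p / 2. Proof. by rewrite ltr_pwDl// divr_ge0// ltW. Qed.

Let aa0 : 0 < aa. Proof. by rewrite divr_gt0// subr_gt0. Qed.

Let aaE : aa * (1 + p / 2) = alpha - 1. Proof. by rewrite divfK// gt_eqF. Qed.

Let aa_lt : aa < alpha - 1.
Proof. by rewrite -aaE ltr_pMr// ltrDl divr_gt0. Qed.

(* Near z the integral is split at distance |z|^(-aa) from z: beyond it f is smaller by a factor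
   exp(-|z|^e), within it |f|^p is controlled by its area mean over a box of that size. *)
Definition near_kernel z w : R :=
  let h := N (zc z) `^ (- aa) in
  if [&& 8 <= N (zc z), `|w.1 - z.1| <= 2 * h & `|w.2 - z.2| <= 2 * h] then N (zc z) `^ (2 * aa) else 0.

Lemma near_kernel_ge0 z w : 0 <= near_kernel z w.
Proof. by rewrite /near_kernel; case: ifP => // _; exact: powR_ge0. Qed.

Lemma measurable_near_kernel : measurable_fun [set: RR * RR] (fun u : RR * RR => near_kernel u.1 u.2).
Proof.
have mN : measurable_fun [set: RR * RR] (fun u : RR * RR => N (zc u.1)).
  exact: (measurableT_comp (@measurable_normc_zc R) measurable_fst).
have mNp b : measurable_fun [set: RR * RR] (fun u : RR * RR => N (zc u.1) `^ b).
  exact: (measurableT_comp (measurable_powR _) mN).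
have m1 : measurable_fun [set: RR * RR] (fun u : RR * RR => u.1.1 : R).
  exact: (measurableT_comp measurable_fst measurable_fst).
have m2 : measurable_fun [set: RR * RR] (fun u : RR * RR => u.1.2 : R).
  exact: (measurableT_comp measurable_snd measurable_fst).
have m3 : measurable_fun [set: RR * RR] (fun u : RR * RR => u.2.1 : R).
  exact: (measurableT_comp measurable_fst measurable_snd).
have m4 : measurable_fun [set: RR * RR] (fun u : RR * RR => u.2.2 : R).
  exact: (measurableT_comp measurable_snd measurable_snd).
have mh : measurable_fun [set: RR * RR] (fun u : RR * RR => 2 * N (zc u.1) `^ (- aa)).
  by apply: measurable_realfun.measurable_funM => //; exact: measurable_cst.
have mabs (F G : RR * RR -> R) : measurable_fun [set: RR * RR] F -> measurable_fun [set: RR * RR] G ->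
    measurable_fun [set: RR * RR] (fun u => `|F u - G u|).
  move=> mF mG; apply: (measurableT_comp (@normr_measurable R setT)).
  exact: measurable_realfun.measurable_funB.
apply: measurable_fun_ifT; [|exact: mNp|exact: measurable_cst].
apply: measurable_and; first by apply: measurable_fun_ler => //; exact: measurable_cst.
by apply: measurable_and; apply: measurable_fun_ler => //; exact: mabs.
Qed.

Lemma measurable_near_kernel_col w : plane_measurable (near_kernel^~ w).
Proof.
have mp : measurable_fun [set: RR] (fun z : RR => (z, w)).
  by apply: measurable_fun_pair; [exact: measurable_id|exact: measurable_cst].
exact: (measurableT_comp measurable_near_kernel mp).
Qed.

(** The bound [8 <= |z|] makes [|z|] and [|w|] comparable up to a factor 2 on the support. The
    support therefore has area of order [|w|^(-2 aa)], which the height [|z|^(2 aa)] of the kernel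
    compensates. *)
Lemma near_kernel_mass w : (plane_integral (near_kernel^~ w) <= (16 * 4 `^ (2 * aa))%:E)%E.
Proof.
pose m := N (zc w); pose h := (m / 2) `^ (- aa).
have m0 : 0 <= m := normc_ge0 _.
have aa20 : 0 <= 2 * aa by apply: mulr_ge0 => //; exact: ltW.
have C0 : 0 <= (2 * m) `^ (2 * aa) by exact: powR_ge0.
have le z : near_kernel z w <= (2 * m) `^ (2 * aa) * \1_(box w (2 * h)) z.
  rewrite /near_kernel; case: ifP => [/and3P[z8 h1 h2]|_]; last by rewrite mulr_ge0.
  have zp : 0 < N (zc z) by apply: lt_le_trans z8.
  have h1' : N (zc z) `^ (- aa) <= 1.
    apply: (@le_trans _ _ (N (zc z) `^ 0)); last by rewrite powRr0.
    by apply: ler_powR; [apply: le_trans z8; rewrite ler1n|rewrite oppr_le0 ltW].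
  have d : N (zc w - zc z) <= 4.
    apply: le_trans (normc_le_ReIm _) _ => /=.
    by move: h1 h2 h1'; move: `|_| `|_| => *; lra.
  have wz : m <= 2 * N (zc z).
    have := normcD (zc z) (zc w - zc z); rewrite addrC subrK -/m; lra.
  have zw : N (zc z) <= 2 * m.
    have := normcD (zc w) (zc z - zc w); rewrite [_ + (_ - _)]addrC subrK -[N (zc z - _)]normcNC opprB -/m; lra.
  have m20 : 0 < m / 2 by rewrite divr_gt0//; lra.
  have hh : N (zc z) `^ (- aa) <= h.
    rewrite /h !powRN lef_pV2 ?posrE ?powR_gt0//.
    apply: ge0_ler_powR; rewrite ?nnegrE ?(ltW aa0) ?(ltW m20) ?(ltW zp)//.
    by rewrite ler_pdivrMr// mulrC.
  rewrite indicE mem_set ?mulr1.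
    by apply: ge0_ler_powR; rewrite ?nnegrE ?aa20 ?(ltW zp)// mulr_ge0.
  apply/boxP; rewrite ![`|_ - w.1|]distrC ![`|_ - w.2|]distrC.
  by split; [apply: le_trans h1 _|apply: le_trans h2 _]; rewrite ler_pM2l.
apply: le_trans (le_plane_integral (measurable_near_kernel_col w) _ (near_kernel_ge0^~ w) le) _.
  by apply: plane_measurableM; [exact: plane_measurable_cst|exact: measurable_indic_box].
rewrite plane_integralZ//; last exact: measurable_indic_box.
rewrite plane_integral_box ?mulr_ge0 ?powR_ge0// -EFinM lee_fin.
have [m00|m00] := eqVneq m 0.
  have an : 2 * aa != 0 by rewrite gt_eqF// mulr_gt0.
  by rewrite m00 mulr0 (powR0 an) mul0r mulr_ge0// powR_ge0.
have m20 : m / 2 != 0 by rewrite mulf_neq0// invr_eq0.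
have -> : 2 * m = 4 * (m / 2) by field.
rewrite powRM ?divr_ge0// /h exprMn -(powR_mulrn 2 (powR_ge0 (m / 2) (- aa))) -powRrM.
have -> : - aa * 2 = - (2 * aa) by ring.
rewrite powRN le_eqVlt; apply/orP; left; apply/eqP.
by field; rewrite powR_eq0 negb_and m20.
Qed.

(** A Schur test: Tonelli puts the integral over [z] on the kernel, whose mass is bounded uniformly
    in [w]. *)
Lemma plane_integral_near f : entire_cderiv f ->
  (\int[lebesgue_measure \x lebesgue_measure]_(z in [set: R * R])
     plane_integral (fun w => (wdensity p alpha f w * near_kernel z w)%R)
   <= (16 * 4 `^ (2 * aa))%:E * normp f)%E.
Proof.
move=> ef; rewrite plane_tonelli; last 2 first.
- apply: measurable_realfun.measurable_funM; last exact: measurable_near_kernel.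
  exact: (measurableT_comp (measurable_wdensity p alpha ef) measurable_snd).
- by move=> z w; rewrite mulr_ge0 ?wdensity_ge0 ?near_kernel_ge0.
have c0 : 0 <= 16 * 4 `^ (2 * aa) by rewrite mulr_ge0 ?powR_ge0.
rewrite fock_normpE -(plane_integralZ c0 (measurable_wdensity p alpha ef) (wdensity_ge0 p alpha f)).
have mS : measurable_fun [set: RR * RR] (fun u : RR * RR => (u.2, u.1)).
  by apply: measurable_fun_pair; [exact: measurable_snd|exact: measurable_fst].
apply: ge0_le_integral => //.
- by move=> w _; apply: plane_integral_ge0 => z; rewrite mulr_ge0 ?wdensity_ge0 ?near_kernel_ge0.
- apply: (@measurable_plane_inner _ (fun w z => wdensity p alpha f w * near_kernel z w)).
    apply: measurable_realfun.measurable_funM.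
      exact: (measurableT_comp (measurable_wdensity p alpha ef) measurable_fst).
    exact: (measurableT_comp measurable_near_kernel mS).
  by move=> w z; rewrite mulr_ge0 ?wdensity_ge0 ?near_kernel_ge0.
- by apply/measurable_EFinP; apply: plane_measurableM; [exact: plane_measurable_cst|exact: measurable_wdensity].
move=> w _; rewrite [in leRHS]EFinM [leRHS]muleC.
rewrite (plane_integralZ (wdensity_ge0 p alpha f w) (measurable_near_kernel_col w) (near_kernel_ge0^~ w)).
apply: lee_wpmul2l; last exact: near_kernel_mass.
by rewrite lee_fin wdensity_ge0.
Qed.

(** The weighted sub-mean value inequality at a point of the final stretch. Its box is contained in
    the support of the kernel, where the kernel is constant. *)
Lemma near_bound : exists2 K : R, 0 < K & forall f w (t : R), entire_cderiv f -> 8 <= N (zc w) ->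
  1 - N (zc w) `^ (- aa) / N (zc w) <= t <= 1 ->
  (((2 * N (zc w) `^ (- aa) * N (f (t%:C * zc w))) `^ p * weight p alpha w)%:E <=
   K%:E * plane_integral (fun u => (wdensity p alpha f u * near_kernel w u)%R))%E.
Proof.
have [K K0 KP] := submean_weight p_gt0 alpha_gt2.
pose c := alpha * (2 * 3 `^ (alpha - 1)).
exists (2 `^ p * (K * expR (p * c))); first by rewrite !mulr_gt0 ?powR_gt0 ?expR_gt0.
move=> f w t ef r8 /andP[t0 t1]; pose r := N (zc w); rewrite -/r in r8 t0 *.
have r1 : 1 <= r by apply: le_trans r8; rewrite ler1n.
have rp : 0 < r by apply: lt_le_trans r1.
have rn : r != 0 by rewrite gt_eqF.
pose h := r `^ (- aa); rewrite -/h in t0 *.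
have h0 : 0 < h by exact: powR_gt0.
have hr : h / r <= 1.
  rewrite ler_pdivrMr// mul1r; apply: (@le_trans _ _ (r `^ 0)); last by rewrite powRr0.
  by apply: ler_powR => //; rewrite oppr_le0 ltW.
have t0' : 0 <= t by lra.
pose v : RR := (t * w.1, t * w.2).
have vE : zc v = t%:C * zc w by apply/eqP; rewrite eq_complex/= !mul0r subr0 addr0 !eqxx.
(* The scale on which [p * |z|^alpha] varies by a bounded amount. *)
pose d := r `^ (1 - alpha).
have d0 : 0 < d by exact: powR_gt0.
have dh : d <= h by apply: ler_powR => //; move: aa_lt; lra.
have d1 : 2 * d <= 2 * r.
  rewrite ler_pM2l//; apply: (@le_trans _ _ (r `^ 1)); last by rewrite powRr1// ltW.
  by apply: ler_powR => //; move: a0; lra.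
have vr : N (zc v) <= r by rewrite vE Normc.normcM normc_real ger0_norm// ler_piMl// ltW.
have hc : alpha * (2 * d * (r + 2 * d) `^ (alpha - 1)) <= c.
  apply: ler_wpM2l; first exact: ltW.
  rewrite -!mulrA ler_pM2l//; apply: (@le_trans _ _ (d * (3 `^ (alpha - 1) * r `^ (alpha - 1)))).
    apply: ler_wpM2l; first exact: ltW.
    rewrite -powRM ?(ltW rp)//; apply: ge0_ler_powR; rewrite ?nnegrE ?subr_ge0 ?(ltW a1)//.
    - by rewrite addr_ge0 ?mulr_ge0// ltW.
    - by rewrite mulr_ge0// ltW.
    - by move: d1; lra.
  rewrite mulrCA -powRD ?rn ?implybT//.
  have -> : 1 - alpha + (alpha - 1) = 0 by ring.
  by rewrite powRr0 mulr1.
have sub u : box v d u -> near_kernel w u = r `^ (2 * aa).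
  move=> /boxP[u1 u2]; rewrite /near_kernel -/r r8/= -/h.
  have wr1 : `|w.1| <= r by exact: (normr_Re_le (zc w)).
  have wr2 : `|w.2| <= r by exact: (normr_Im_le (zc w)).
  have tr (x y : R) : `|y| <= r -> `|x - t * y| <= d -> `|x - y| <= 2 * h.
    move=> yr xy; have -> : x - y = (x - t * y) + (t - 1) * y by ring.
    apply: le_trans (ler_normD _ _) _; have -> : 2 * h = h + h by ring.
    apply: lerD; first exact: le_trans dh.
    rewrite normrM distrC [`|1 - t|]ger0_norm ?subr_ge0//; apply: (@le_trans _ _ (h / r * r)); last first.
      by rewrite divfK.
    by apply: ler_pM; rewrite ?subr_ge0//; lra.
  by rewrite (tr _ _ wr1 u1) (tr _ _ wr2 u2).
have c0 : 0 <= 2 `^ p * r `^ (2 * aa) by rewrite mulr_ge0 ?powR_ge0.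
have E : (2 * h * N (f (t%:C * zc w))) `^ p * weight p alpha w =
   (2 `^ p * r `^ (2 * aa)) * (d ^+ 2 * (N (f (zc v)) `^ p * expR (- p * r `^ alpha))).
  rewrite vE /weight -/r !powRM ?mulr_ge0 ?normc_ge0 ?(ltW h0)//.
  (* This identity of exponents is the equation that defines [aa]. *)
  have -> : h `^ p = r `^ (2 * aa) * d ^+ 2.
    rewrite -(powR_mulrn 2 (ltW d0)) -!powRrM -powRD ?rn ?implybT//.
    by congr (_ `^ _); move: aaE; lra.
  ring.
rewrite E EFinM; apply: le_trans (lee_wpmul2l _ (KP f v d r c d0 vr hc ef)) _; first by rewrite lee_fin.
have mb : plane_measurable (fun z => wdensity p alpha f z * \1_(box v d) z).
  by apply: plane_measurableM; [exact: measurable_wdensity|exact: measurable_indic_box].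
have mk : plane_measurable (fun u => wdensity p alpha f u * near_kernel w u).
  apply: plane_measurableM; first exact: measurable_wdensity.
  have mp : measurable_fun [set: RR] (fun u : RR => (w, u)).
    by apply: measurable_fun_pair; [exact: measurable_cst|exact: measurable_id].
  exact: (measurableT_comp measurable_near_kernel mp).
rewrite muleA -EFinM -!plane_integralZ//; first last.
- by move=> z; rewrite mulr_ge0 ?wdensity_ge0 ?near_kernel_ge0.
- by rewrite !mulr_ge0 ?expR_ge0 ?powR_ge0// ltW.
- by move=> z; rewrite mulr_ge0 ?wdensity_ge0.
- by rewrite mulr_ge0// mulr_ge0 ?expR_ge0// ltW.
apply: le_plane_integral.
- by apply: plane_measurableM => //; exact: plane_measurable_cst.
- by apply: plane_measurableM => //; exact: plane_measurable_cst.
- by move=> z; rewrite !mulr_ge0 ?wdensity_ge0 ?expR_ge0 ?powR_ge0// ltW.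
move=> z; rewrite indicE; have [zb|zb] := boolP (z \in box v d); last first.
  by rewrite !mulr0 !mulr_ge0 ?wdensity_ge0 ?near_kernel_ge0 ?expR_ge0 ?powR_ge0// ltW.
rewrite (sub z (set_mem zb)) mulr1 le_eqVlt; apply/orP; left; apply/eqP.
by move: (wdensity _ _ _ _) (r `^ _) (2 `^ p) (expR _) => *; ring.
Qed.

(** By convexity [(t r)^alpha <= t r^alpha]; at distance [r^(- aa)] from the end the exponent has
    dropped by [r^(alpha - 1 - aa)], which outweighs every power of [r]. *)
Lemma far_bound f (G : R) D w (t : R) : 0 <= G -> growth alpha f G D -> 1 <= N (zc w) ->
  0 <= t <= 1 - N (zc w) `^ (- aa) / N (zc w) ->
  N (f (t%:C * zc w)) <= G * (1 + N (zc w)) ^+ D * (expR (N (zc w) `^ alpha) * expR (- N (zc w) `^ (alpha - 1 - aa))).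
Proof.
move=> G0 fG r1 /andP[t0 ts]; pose r := N (zc w); rewrite -/r in r1 ts *.
have rp : 0 < r by apply: lt_le_trans r1.
have rn : r != 0 by rewrite gt_eqF.
have h0 : 0 < r `^ (- aa) / r by rewrite divr_gt0// powR_gt0.
have t1 : t <= 1 by lra.
have tr : N (t%:C * zc w) = t * r by rewrite Normc.normcM normc_real ger0_norm.
apply: le_trans (fG _) _; rewrite tr; apply: ler_pM.
- by rewrite mulr_ge0 ?exprn_ge0 ?addr_ge0 ?mulr_ge0// ltW.
- exact: expR_ge0.
- apply: ler_wpM2l => //; apply: lerXn2r; rewrite ?nnegrE ?addr_ge0 ?mulr_ge0 ?(ltW rp)//.
  by rewrite lerD2l ler_piMl// ltW.
rewrite -expRD ler_expR.
have tt : (t * r) `^ alpha <= t * r `^ alpha.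
  have [->|tn] := eqVneq t 0; first by rewrite !mul0r powR0// gt_eqF.
  apply: ge1r_powRZ; rewrite ?(ltW rp) ?(ltW a1)//; first by rewrite lt_neqAle eq_sym tn t0.
apply: le_trans tt _; apply: (@le_trans _ _ ((1 - r `^ (- aa) / r) * r `^ alpha)).
  by apply: ler_wpM2r => //; exact: powR_ge0.
rewrite mulrBl mul1r lerD2l lerN2 le_eqVlt; apply/orP; left; apply/eqP.
have -> : r `^ alpha = r * r `^ (alpha - 1) by rewrite mulr_powRB1// ltW.
rewrite mulrA divfK// -powRD ?rn ?implybT//; congr (_ `^ _); ring.
Qed.

(** For [|z| >= 8] the far part decays fast enough to be dominated by [cauchy_density] and the near
    part by the kernel integral; for [|z| < 8] the continuous function [V f] is bounded. *)
Lemma volterra_density f : entire_cderiv f -> (normp f < +oo)%E ->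
  exists2 c1 : R, 0 <= c1 & exists2 c2 : R, 0 < c2 & forall w,
  ((wdensity p alpha (volterra f) w)%:E <= (c1 * cauchy_density w)%:E +
    c2%:E * plane_integral (fun u => (wdensity p alpha f u * near_kernel w u)%R))%E.
Proof.
move=> ef fN; have n0 : (0 <= normp f)%E by rewrite fock_normpE; apply: plane_integral_ge0; exact: wdensity_ge0.
have [M M0 fM] : exists2 M : R, 0 <= M & (normp f <= M%:E)%E.
  by move: fN n0; case: (normp f) => // M _ M0; exists M.
have [D [K K0 KP]] := fock_growth p_gt0 alpha_gt2; have {KP}fG := KP f M ef fM.
move: ((K * M) `^ p^-1) (powR_ge0 (K * M) p^-1) fG => G G0 fG.
have [L0 L0P] := archimedean_nat (4 / p); set L := L0.+1.
have Lp : 4 <= L%:R * p by rewrite -ler_pdivrMr.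
have [K1 K10 K1P] := near_bound.
have e0 : 0 < alpha - 1 - aa by rewrite subr_gt0.
have [c cc0 cP] := @pow_le_expR_powR R _ (D + L).+1 e0.
have [b bP] := entire_bounded_box (0, 0) 8 (entire_volterra ef).
pose B1 := 2 * G * c; pose B2 := `|b| * 9 ^+ L.
have B10 : 0 <= B1 by rewrite !mulr_ge0.
have B20 : 0 <= B2 by rewrite mulr_ge0 ?exprn_ge0.
exists (B2 `^ p + 2 `^ p * B1 `^ p); first by rewrite addr_ge0 ?mulr_ge0 ?powR_ge0.
exists (2 `^ p * K1); first by rewrite mulr_gt0// powR_gt0.
move=> w; have cd0 : 0 <= cauchy_density w by rewrite mulr_ge0 ?oneDsqrV_ge0.
set J := plane_integral _.
have J0 : (0 <= J)%E by apply: plane_integral_ge0 => u; rewrite mulr_ge0 ?wdensity_ge0 ?near_kernel_ge0.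
pose r := N (zc w); have r0 : 0 <= r := normc_ge0 _.
have er1 : 1 <= expR (r `^ alpha) by rewrite -[leLHS]expR0 ler_expR powR_ge0.
have [r8|r8] := leP 8 r; last first.
  apply: (@le_trans _ _ (B2 `^ p * cauchy_density w)%:E).
    rewrite lee_fin; apply: (decay_weight p_gt0 Lp (normc_ge0 _)).
    apply: (@le_trans _ _ B2); last by rewrite ler_peMr.
    rewrite -/r; apply: ler_pM; rewrite ?normc_ge0 ?exprn_ge0 ?addr_ge0//.
      apply: le_trans (ler_norm b); apply: bP; apply/boxP; rewrite !subr0; split.
        by apply: le_trans (normr_Re_le (zc w)) _; exact: ltW.
      by apply: le_trans (normr_Im_le (zc w)) _; exact: ltW.
    by apply: lerXn2r; rewrite ?nnegrE ?addr_ge0//; lra.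
  rewrite -[leLHS]adde0; apply: leeD.
    by rewrite lee_fin; apply: ler_wpM2r => //; rewrite lerDl mulr_ge0 ?powR_ge0.
  by rewrite mule_ge0// lee_fin mulr_ge0 ?powR_ge0// ltW.
have r1 : 1 <= r by apply: le_trans r8; rewrite ler1n.
have rp : 0 < r by apply: lt_le_trans r1.
move: J0; case EJ : J => [s| |]// s0; last first.
  by rewrite gt0_muley ?lte_fin ?mulr_gt0 ?powR_gt0// addey ?leey.
rewrite lee_fin in s0.
pose h := r `^ (- aa).
have h0 : 0 < h by exact: powR_gt0.
have hr : h / r <= 1.
  rewrite ler_pdivrMr// mul1r; apply: (@le_trans _ _ (r `^ 0)); last by rewrite powRr0.
  by apply: ler_powR => //; rewrite oppr_le0 ltW.
have we : 0 < weight p alpha w by exact: expR_gt0.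
have q0 : 0 <= K1 * s / weight p alpha w by rewrite divr_ge0 ?mulr_ge0// ltW.
(* [v / (2 * h)] is the bound of [|f|] that [near_bound] gives on the final stretch; its length [h]
   and the factor 2 of the segment bound turn it into [v]. *)
pose v := (K1 * s / weight p alpha w) `^ p^-1.
have v0 : 0 <= v by exact: powR_ge0.
pose A := G * (1 + r) ^+ D * (expR (r `^ alpha) * expR (- r `^ (alpha - 1 - aa))).
have A0 : 0 <= A by rewrite !mulr_ge0 ?exprn_ge0 ?expR_ge0 ?addr_ge0.
pose u := 2 * r * A; have u0 : 0 <= u by apply: mulr_ge0 => //; apply: mulr_ge0.
have uv : N (volterra f (zc w)) <= u + v.
  have -> : v = 2 * ((1 - (1 - h / r)) * r) * (v / (2 * h)).
    by field; rewrite !gt_eqF.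
  apply: volterra_two_scale => //.
  - by rewrite subr_ge0 hr/= gerBl divr_ge0// ltW.
  - by move=> t ts; exact: far_bound.
  move=> t ts; have := K1P f w t ef r8 ts; rewrite -/J EJ -EFinM lee_fin -ler_pdivlMr// -/r -/h => H.
  rewrite ler_pdivlMr ?mulr_gt0// mulrC.
  have x0 : 0 <= 2 * h * N (f (t%:C * zc w)) by rewrite !mulr_ge0 ?normc_ge0// ltW.
  have -> : 2 * h * N (f (t%:C * zc w)) = ((2 * h * N (f (t%:C * zc w))) `^ p) `^ p^-1.
    by rewrite -powRrM mulfV ?gt_eqF// powRr1.
  by apply: ge0_ler_powR; rewrite ?nnegrE ?powR_ge0 ?invr_ge0 ?(ltW p_gt0).
have vp : v `^ p * weight p alpha w = K1 * s.
  by rewrite /v -powRrM mulVf ?gt_eqF// powRr1// divfK// gt_eqF.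
have up : u `^ p * weight p alpha w <= B1 `^ p * cauchy_density w.
  apply: (decay_weight p_gt0 Lp u0); rewrite -/r /u /A /B1.
  have cr := cP r r1.
  have e1 : expR (r `^ (alpha - 1 - aa)) * expR (- r `^ (alpha - 1 - aa)) = 1 by rewrite -expRD subrr expR0.
  apply: (@le_trans _ _ (2 * G * (1 + r) ^+ (D + L).+1 * (expR (r `^ alpha) * expR (- r `^ (alpha - 1 - aa))))).
    have -> : 2 * r * (G * (1 + r) ^+ D * (expR (r `^ alpha) * expR (- r `^ (alpha - 1 - aa)))) * (1 + r) ^+ L =
       2 * G * (r * (1 + r) ^+ (D + L)) * (expR (r `^ alpha) * expR (- r `^ (alpha - 1 - aa))).
      by rewrite exprD; move: (expR _) (expR _) (_ ^+ D) (_ ^+ L) => *; ring.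
    apply: ler_wpM2r; first by rewrite mulr_ge0 ?expR_ge0.
    apply: ler_wpM2l; first by rewrite mulr_ge0.
    by rewrite exprS; apply: ler_wpM2r; [rewrite exprn_ge0 ?addr_ge0|rewrite lerDr].
  apply: (@le_trans _ _ (2 * G * c * expR (r `^ alpha) *
      (expR (r `^ (alpha - 1 - aa)) * expR (- r `^ (alpha - 1 - aa))))); last by rewrite e1 mulr1.
  have -> : 2 * G * c * expR (r `^ alpha) * (expR (r `^ (alpha - 1 - aa)) * expR (- r `^ (alpha - 1 - aa))) =
     2 * G * (c * expR (r `^ (alpha - 1 - aa))) * (expR (r `^ alpha) * expR (- r `^ (alpha - 1 - aa))).
    by move: (expR _) (expR _) (expR _) => *; ring.
  apply: ler_wpM2r; first by rewrite mulr_ge0 ?expR_ge0.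
  by apply: ler_wpM2l; first by rewrite mulr_ge0.
rewrite -EFinM -EFinD lee_fin.
apply: (@le_trans _ _ (2 `^ p * (u `^ p + v `^ p) * weight p alpha w)).
  apply: ler_wpM2r; first exact: ltW.
  apply: le_trans (powR_addr_le p_gt0 u0 v0).
  by apply: ge0_ler_powR; rewrite ?nnegrE ?normc_ge0 ?addr_ge0 ?(ltW p_gt0).
apply: (@le_trans _ _ (2 `^ p * (B1 `^ p * cauchy_density w + K1 * s))).
  rewrite -mulrA mulrDl vp; apply: ler_wpM2l; first exact: powR_ge0.
  by rewrite lerD2r.
rewrite mulrDr [(_ + _) * cauchy_density w]mulrDl -!mulrA lerD2r lerDr.
by apply: mulr_ge0 => //; exact: powR_ge0.
Qed.

Theorem volterra_fock f : fock p (@radial_power R alpha) f -> fock p (@radial_power R alpha) (volterra f).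
Proof.
move=> [/entireP ef fN]; have eV := entire_volterra ef; split; first exact/entireP.
have [c1 c10 [c2 c20 cP]] := volterra_density ef fN.
have [J J0 JP] := @plane_integral_cauchy R.
have mk : measurable_fun [set: RR] (fun z => plane_integral (fun u => wdensity p alpha f u * near_kernel z u)).
  apply: (@measurable_plane_inner _ (fun z u => wdensity p alpha f u * near_kernel z u)).
    apply: measurable_realfun.measurable_funM; last exact: measurable_near_kernel.
    exact: (measurableT_comp (measurable_wdensity p alpha ef) measurable_snd).
  by move=> w z; rewrite mulr_ge0 ?wdensity_ge0 ?near_kernel_ge0.
have k0 z : (0 <= plane_integral (fun u => (wdensity p alpha f u * near_kernel z u)%R))%E.
  by apply: plane_integral_ge0 => u; rewrite mulr_ge0 ?wdensity_ge0 ?near_kernel_ge0.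
have mc : plane_measurable (fun w => c1 * @cauchy_density R w).
  by apply: plane_measurableM; [exact: plane_measurable_cst|exact: measurable_cauchy_density].
have cd0 w : 0 <= @cauchy_density R w by rewrite mulr_ge0 ?oneDsqrV_ge0.
apply: (@le_lt_trans _ _ (\int[mu \x mu]_(w in [set: RR]) ((c1 * cauchy_density w)%:E +
    c2%:E * plane_integral (fun u => (wdensity p alpha f u * near_kernel w u)%R)))%E).
  rewrite fock_normpE; apply: ge0_le_integral => //.
  - by move=> w _; rewrite lee_fin wdensity_ge0.
  - by apply/measurable_EFinP; exact: measurable_wdensity.
  - by apply: emeasurable_funD; [exact/measurable_EFinP|exact: measurable_funeM].
rewrite ge0_integralD//; first last.
- exact: measurable_funeM.
- by move=> w _; rewrite mule_ge0// lee_fin ltW.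
- exact/measurable_EFinP.
- by move=> w _; rewrite lee_fin mulr_ge0.
rewrite ge0_integralZl//; last by rewrite lee_fin ltW.
have := plane_integralZ c10 (@measurable_cauchy_density R) cd0; rewrite {1}/plane_integral => ->.
rewrite JP -EFinM lte_add_pinfty ?ltry// lte_mul_pinfty ?lee_fin ?(ltW c20)//.
apply: le_lt_trans (plane_integral_near ef) _.
by rewrite lte_mul_pinfty// lee_fin mulr_ge0 ?powR_ge0.
Qed.

End VolterraBounded.

(** * Linear combinations, monomials and dilations of power series *)

Section PowerSeriesLinear.
Variable R : realType.
Local Notation C := R[i]^o.
Local Notation N := (@Normc.normc R).
Implicit Types (f g : C -> C) (a b : nat -> C).

Lemma rapid_linear a b (c : C) : rapid a -> rapid b -> rapid (fun k => c * a k + b k).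
Proof.
move=> ra rb r r0; have [K KP] := ra r r0; have [K' K'P] := rb r r0.
exists (N c * K + K') => k; apply: (@le_trans _ _ (N c * (N (a k) * r ^+ k) + N (b k) * r ^+ k)).
  rewrite mulrA -mulrDl; apply: ler_wpM2r; first by rewrite exprn_ge0// ltW.
  by apply: le_trans (normcD _ _) _; rewrite Normc.normcM.
by apply: lerD => //; apply: ler_wpM2l => //; exact: normc_ge0.
Qed.

Lemma psum_linear a b (c z : C) n : psum (fun k => c * a k + b k) n z = c * psum a n z + psum b n z.
Proof.
by rewrite /psum mulr_sumr -big_split; apply: eq_bigr => k _; rewrite mulrDl mulrA.
Qed.

Lemma pser_linear f g a b c : pser f a -> pser g b -> pser (c *: f + g) (fun k => c * a k + b k).
Proof.
move=> [ra fa] [rb gb]; split; first exact: rapid_linear.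
move=> z; under eq_fun do rewrite psum_linear.
have -> : (c *: f + g) z = c * f z + g z by [].
by apply: cvgD => //; apply: cvgM => //; exact: cvg_cst.
Qed.

Lemma rapid_finite a m : (forall k, (m <= k)%N -> a k = 0) -> rapid a.
Proof.
move=> am r r0; exists (\sum_(k < m) N (a k) * r ^+ k) => k.
have ge0 i : 0 <= N (a i) * r ^+ i by rewrite mulr_ge0 ?normc_ge0 ?exprn_ge0// ltW.
have [mk|km] := leqP m k; first by rewrite am// Normc.normc0 mul0r sumr_ge0.
by rewrite (bigD1 (Ordinal km))//= lerDl sumr_ge0.
Qed.

Lemma pser_finite a m : (forall k, (m <= k)%N -> a k = 0) -> pser (psum a m) a.
Proof.
move=> am; split; first exact: rapid_finite am.
move=> z; apply: (@cvgC_geometric _ _ _ (\sum_(k < m) 2 ^+ m * N (psum a k z - psum a m z))) => n.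
have t0 i : 0 <= 2 ^+ m * N (psum a i z - psum a m z) by rewrite mulr_ge0 ?normc_ge0 ?exprn_ge0.
have [mn|nm] := leqP m n.
  have -> : psum a n z = psum a m z.
    rewrite -(subnKC mn); elim: (n - m)%N => [|j IH]; first by rewrite addn0.
    by rewrite addnS psumS IH am ?leq_addr// mul0r addr0.
  by rewrite subrr Normc.normc0 mulr_ge0 ?exprn_ge0 ?sumr_ge0.
rewrite (bigD1 (Ordinal nm))//= mulrDl -[leLHS]addr0; apply: lerD; last first.
  by rewrite mulr_ge0 ?exprn_ge0 ?sumr_ge0.
rewrite mulrAC ler_peMl ?normc_ge0//.
by rewrite exprVn ler_pdivlMr ?exprn_gt0// mul1r ler_weXn2l ?ler1n// ltnW.
Qed.

Lemma pser_monomial m : pser (@monomial R m) (fun k => (k == m)%:R).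
Proof.
have H : forall k, (m.+1 <= k)%N -> (k == m)%:R = 0 :> C by move=> k /gtn_eqF ->.
have -> : @monomial R m = psum (fun k => (k == m)%:R) m.+1; last exact: pser_finite.
apply/funext => z; apply/esym.
rewrite psumS eqxx mul1r /psum big1 ?add0r// => i _.
by rewrite (ltn_eqF (ltn_ord i)) mul0r.
Qed.

Lemma pser_zero : pser (0 : C -> C) (fun=> 0).
Proof.
have -> : 0 = psum (fun=> 0 : C) 0 by apply/funext => z; rewrite /psum big_ord0.
exact: pser_finite.
Qed.

Definition dilate (r : R) f : C -> C := fun z => f (r%:C * z).

Lemma pser_dilate f a (r : R) : 0 < r -> pser f a -> pser (dilate r f) (fun k => a k * r%:C ^+ k).
Proof.
move=> r0 [ra fa]; split.
  move=> s s0; have [K KP] := ra (r * s) (mulr_gt0 r0 s0); exists K => k.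
  by rewrite Normc.normcM normcX normc_real ger0_norm ?(ltW r0)// -mulrA -exprMn.
move=> z; suff -> : (fun n => psum (fun k => a k * r%:C ^+ k) n z) = (fun n => psum a n (r%:C * z)) by exact: fa.
by apply/funext => n; apply: eq_bigr => k _; rewrite exprMn mulrA.
Qed.

End PowerSeriesLinear.

(** * The quasi-norm, continuity of the coefficients, and density of polynomials *)

Section FockDensity.
Variables (R : realType) (p alpha : R).
Hypothesis p_gt0 : 0 < p.
Hypothesis alpha_gt2 : 2 < alpha.
Local Notation C := R[i]^o.
Local Notation N := (@Normc.normc R).
Local Notation mu := (@lebesgue_measure R).
Local Notation RR := (measurableTypeR R * measurableTypeR R)%type.
Local Notation phi := (@radial_power R alpha).
Local Notation normp := (fock_normp p (@radial_power R alpha)).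
Local Notation fockS := (fock p (@radial_power R alpha)).
Local Notation wd := (wdensity p alpha).
Implicit Types (f g : C -> C) (w z : RR) (a b : nat -> C).

Let a0 : 0 < alpha. Proof. by apply: lt_trans alpha_gt2. Qed.
Let a1 : 1 < alpha. Proof. by apply: lt_trans alpha_gt2; rewrite ltr1n. Qed.

Lemma normp_ge0 f : (0 <= normp f)%E.
Proof. by rewrite fock_normpE; apply: plane_integral_ge0; exact: wdensity_ge0. Qed.

Lemma wdensityD f g w : wd (f + g) w <= 2 `^ p * (wd f w + wd g w).
Proof.
rewrite /wdensity -mulrDl mulrA; apply: ler_wpM2r; first exact: weight_ge0.
apply: le_trans (powR_addr_le p_gt0 (normc_ge0 _) (normc_ge0 _)).
by apply: ge0_ler_powR; rewrite ?nnegrE ?addr_ge0 ?normc_ge0 ?(ltW p_gt0)//; exact: normcD.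
Qed.

Lemma entire_linear f g c : entire_cderiv f -> entire_cderiv g -> entire_cderiv (c *: f + g).
Proof.
by move=> /entire_pser[a fa] /entire_pser[b gb]; exact: pser_entire (pser_linear c fa gb).
Qed.

Lemma entireD f g : entire_cderiv f -> entire_cderiv g -> entire_cderiv (f + g).
Proof. by move=> ef eg; rewrite -[f]scale1r; exact: entire_linear. Qed.

Lemma normpD f g : entire_cderiv f -> entire_cderiv g ->
  (normp (f + g)%R <= (2 `^ p)%:E * (normp f + normp g))%E.
Proof.
move=> ef eg; rewrite !fock_normpE.
have mf := measurable_wdensity p alpha ef; have mg := measurable_wdensity p alpha eg.
have fg0 w : 0 <= wd f w + wd g w by rewrite addr_ge0 ?wdensity_ge0.
rewrite -(plane_integralD mf mg (wdensity_ge0 p alpha f) (wdensity_ge0 p alpha g)).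
rewrite -plane_integralZ ?powR_ge0//; last exact: plane_measurableD.
apply: le_plane_integral.
- by apply: measurable_wdensity; exact: entireD.
- by apply: plane_measurableM; [exact: plane_measurable_cst|exact: plane_measurableD].
- exact: wdensity_ge0.
- by move=> w; exact: wdensityD.
Qed.

Lemma normpZ f (c : C) : entire_cderiv f -> normp (c *: f) = ((N c `^ p)%:E * normp f)%E.
Proof.
move=> ef; rewrite !fock_normpE -plane_integralZ ?powR_ge0//; first last.
- exact: wdensity_ge0.
- exact: measurable_wdensity.
congr plane_integral; apply/funext => w; rewrite /wdensity mulrA -powRM ?normc_ge0//.
by rewrite -Normc.normcM.
Qed.

Lemma fock_linear f g c : fockS f -> fockS g -> fockS (c *: f + g).
Proof.
move=> [/entireP ef fN] [/entireP eg gN]; split; first by apply/entireP; exact: entire_linear.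
have ecf : entire_cderiv (c *: f) by rewrite -[c *: f]addr0; apply: entire_linear => //; exact: pser_entire (pser_zero R).
have P0 (x : R) : (0 <= (x `^ p)%:E)%E by rewrite lee_fin powR_ge0.
apply: le_lt_trans (normpD ecf eg) _; apply: lte_mul_pinfty => //.
rewrite normpZ//; apply: lte_add_pinfty => //.
by apply: (lte_mul_pinfty (P0 (N c)) _ fN).
Qed.

Lemma fock_norm_lt f (e : R) : 0 < e -> ((fock_norm p phi f < e%:E)%E <-> (normp f < (e `^ p)%:E)%E).
Proof.
move=> e0; rewrite /fock_norm; have := normp_ge0 f.
case: (normp f) => [x| |]// x0; last by rewrite poweRyr// invr_eq0 gt_eqF.
rewrite poweR_EFin !lte_fin; rewrite lee_fin in x0.
have E (y : R) : 0 <= y -> y = (y `^ p) `^ p^-1 by move=> y0; rewrite -powRrM mulfV ?gt_eqF// powRr1.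
have pi0 : 0 < p^-1 by rewrite invr_gt0.
split=> h.
- rewrite ltNge; apply/negP => ex; move: h; rewrite ltNge => /negP; apply.
  rewrite (E e) ?(ltW e0)//; apply: ge0_ler_powR; rewrite ?nnegrE ?powR_ge0 ?(ltW pi0)//.
- rewrite (E e) ?(ltW e0)//; apply: gt0_ltr_powR; rewrite ?nnegrE ?powR_ge0//.
Qed.

(** Taylor coefficients depend continuously on the function; this makes the spaces of functions
    vanishing to a given order closed. *)
Lemma fock_coef_bound k : exists2 c : R, 0 <= c & forall f a (M : R), pser f a -> (normp f <= M%:E)%E ->
  N (a k) <= c * M `^ p^-1.
Proof.
have [D [K K0 KP]] := fock_growth p_gt0 alpha_gt2.
have pk := peak_gt0 alpha_gt2 k.
exists (expR 1 * K `^ p^-1 * k.+1%:R ^+ D.+1 / peak alpha k).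
  by rewrite divr_ge0 ?(ltW pk)// !mulr_ge0 ?expR_ge0 ?powR_ge0// exprn_ge0.
move=> f a M fa fM; have M0 : 0 <= M by rewrite -lee_fin; exact: le_trans (normp_ge0 f) fM.
have := growth_coef alpha_gt2 k fa (KP f M (pser_entire fa) fM).
rewrite powRM// => /le_trans; apply; rewrite le_eqVlt; apply/orP; left; apply/eqP; ring.
Qed.

(** Dominated convergence along an exhaustion of the plane by boxes. *)
Lemma plane_tail (F : RR -> R) (e : R) : plane_measurable F -> (forall w, 0 <= F w) ->
  (plane_integral F < +oo)%E -> 0 < e ->
  exists n, (plane_integral (fun w => (F w * \1_(~` box (0, 0) n%:R) w)%R) < e%:E)%E.
Proof.
move=> mF F0 Foo e0; pose f_ n w : \bar R := (F w * \1_(~` box (0, 0) n%:R) w)%:E.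
have mE : measurable_fun [set: RR] (EFin \o F) by exact/measurable_EFinP.
have mf n : measurable_fun [set: RR] (f_ n).
  apply/measurable_EFinP; apply: plane_measurableM => //.
  by apply: measurable_indic; apply: measurableC; exact: measurable_box.
have cf w : [set: RR] w -> f_ ^~ w @ \oo --> (cst 0%E w : \bar R).
  move=> _; have [n nP] := archimedean_nat (`|w.1| + `|w.2|).
  apply: cvg_near_cst; exists n.+1 => // m /= nm; rewrite /f_ indicE memNset ?mulr0//.
  apply; apply/boxP; rewrite !subr0.
  have nm' : n.+1%:R <= m%:R :> R by rewrite ler_nat.
  by split; apply: le_trans nm'; apply: le_trans nP; rewrite ?lerDl ?lerDr.
have iF : (mu \x mu)%E.-integrable setT (EFin \o F).
  apply/integrableP; split => //.
  by under eq_integral do rewrite gee0_abs ?lee_fin//.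
have leF n w : [set: RR] w -> (`|f_ n w| <= (EFin \o F) w)%E.
  move=> _; rewrite /f_ gee0_abs ?lee_fin ?mulr_ge0//.
  by rewrite ler_piMr// indicE lern1 leq_b1.
have H := @dominated_cvg _ RR R (mu \x mu)%E setT measurableT f_ (cst 0%E) (EFin \o F) mf cf (fun _ _ => isT) iF leF.
rewrite integral_cst//= mul0e in H.
have e0E : (0 < e%:E)%E by rewrite lte_fin.
have [n _ nP] := H _ (open_ereal_lt' e0E).
by exists n; exact: (nP n (leqnn n)).
Qed.

Lemma entireB f g : entire_cderiv f -> entire_cderiv g -> entire_cderiv (f - g).
Proof. by move=> ef eg; rewrite addrC -scaleN1r; exact: entire_linear. Qed.

Lemma pserB f g a b : pser f a -> pser g b -> pser (f - g) (fun k => a k - b k).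
Proof.
move=> fa gb; rewrite addrC -scaleN1r.
have -> : (fun k => a k - b k) = (fun k => -1 * b k + a k) by apply/funext => k; rewrite mulN1r addrC.
exact: pser_linear.
Qed.

Lemma dilate_pointwise f (rho : R) : 0 < rho -> entire_cderiv f -> exists2 K : R, 0 <= K &
  forall r (x : C), 0 <= r <= 1 -> N x <= rho -> N (f x - f (r%:C * x)) <= (1 - r) * K.
Proof.
move=> rho0 ef; have [a fa] := entire_pser ef; have ga := pser_derive fa.
have [K K0 KP] := pser_uniform ga rho0; exists (2 * rho * K); first by rewrite !mulr_ge0// ltW.
move=> r x /andP[r0 r1] xr.
have sc : segment_continuous (r%:C * x) x f^`().
  exact/continuous_segment_continuous/entire_continuous/(pser_entire ga).
rewrite -(@segment_FTC _ (r%:C * x) x f f^`()) //; last first.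
  move=> t _; apply: derivable_cderiv; exact: ((entireP f).2 ef).
have E : N (x - r%:C * x) = (1 - r) * N x.
  have -> : x - r%:C * x = (1 - r)%:C * x by rewrite real_complexB mulrBl mul1r.
  by rewrite Normc.normcM normc_real ger0_norm ?subr_ge0.
apply: le_trans (@segment_integral_bound _ _ _ _ K sc _) _; last first.
  rewrite E; have -> : (1 - r) * (2 * rho * K) = 2 * ((1 - r) * rho) * K by ring.
  apply: ler_wpM2r => //; apply: ler_wpM2l => //; apply: ler_wpM2l => //.
  by rewrite subr_ge0.
move=> t /andP[t0 t1]; have := KP (r%:C * x + t%:C * (x - r%:C * x)) 0%N.
rewrite expr0 mulr1 /psum big_ord0 subr0; apply.
have -> : r%:C * x + t%:C * (x - r%:C * x) = (r + t * (1 - r))%:C * x.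
  by rewrite real_complexD real_complexM real_complexB; ring.
rewrite Normc.normcM normc_real; apply: le_trans xr; rewrite ler_piMl ?normc_ge0//.
have h1 : 0 <= t * (1 - r) by rewrite mulr_ge0// subr_ge0.
have h2 : 0 <= (1 - t) * (1 - r) by rewrite mulr_ge0// subr_ge0.
by rewrite ger0_norm; lra.
Qed.

(** On a large box [f (r z)] is uniformly close to [f]. Outside it both densities are small: since
    [r < 1] the weight at [z] is at most the weight at [r z], so the tail of the dilated density is
    bounded by a rescaled tail of that of [f]. *)
Lemma dilate_normp f (e : R) : entire_cderiv f -> (normp f < +oo)%E -> 0 < e ->
  exists2 r : R, 0 < r < 1 & (normp (f - dilate r f)%R < e%:E)%E.
Proof.
move=> ef foo e0; have P0 : 0 < 2 `^ p :> R by exact: powR_gt0.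
(* The two tails together are at most [(1 + 4) * e1], the 4 being a bound of [r ^- 2] for
   [r >= 1/2]; this makes their share [e / 4]. *)
pose e1 := e / (2 `^ p * 20); have e10 : 0 < e1 by rewrite divr_gt0// mulr_gt0.
have mf := measurable_wdensity p alpha ef.
have f0 := wdensity_ge0 p alpha f.
rewrite fock_normpE in foo.
have [n0 n0P] := plane_tail mf f0 foo e10.
pose T w := wd f w * \1_(~` box (0, 0) n0%:R) w; rewrite -/T in n0P.
have T0 w : 0 <= T w by rewrite mulr_ge0.
have mT : plane_measurable T.
  by apply: plane_measurableM => //; apply: measurable_indic; apply: measurableC; exact: measurable_box.
(* Twice the size of the tail box: [r * z] with [r >= 1/2] still leaves the box of half-side [n0]
   when [z] leaves this one. *)
pose rho : R := 2 * n0%:R; have rho0 : 0 <= rho by rewrite mulr_ge0.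
have rho10 : 0 < 2 * rho + 1 by rewrite ltr_wpDl// mulr_ge0.
have [K K0 KP] := dilate_pointwise rho10 ef.
(* Chosen so that [q^p] times the area [4 * rho^2] is at most [e / 4]; adding 1 avoids division by
   0. *)
pose q := (e / (4 * (4 * rho ^+ 2 + 1))) `^ p^-1.
have q1 : 0 < 4 * rho ^+ 2 + 1 by rewrite ltr_wpDl// mulr_ge0// sqr_ge0.
have q0 : 0 < q by rewrite powR_gt0// divr_gt0// mulr_gt0.
have K1 : 0 < K + 1 by rewrite ltr_wpDl.
pose eta := Num.min (1 / 2) (q / (K + 1)).
have eta0 : 0 < eta by rewrite lt_min !divr_gt0.
have eta2 : eta <= 1 / 2 by rewrite ge_min lexx.
have etaq : eta * K <= q.
  apply: (@le_trans _ _ (q / (K + 1) * K)); first by apply: ler_wpM2r => //; rewrite ge_min lexx orbT.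
  by rewrite mulrAC ler_pdivrMr// ler_pM2l// lerDl.
pose r := 1 - eta; have r12 : 1 / 2 <= r by rewrite /r; lra.
have r0 : 0 < r by apply: lt_le_trans r12; rewrite divr_gt0.
have r1 : r < 1 by rewrite /r; lra.
exists r; first by rewrite r0.
have ed : entire_cderiv (dilate r f).
  by have [a fa] := entire_pser ef; exact: pser_entire (pser_dilate r0 fa).
pose Td w := T (r * w.1 + 0, r * w.2 + 0).
have Td0 w : 0 <= Td w by exact: T0.
have mTd : plane_measurable Td by exact: measurable_plane_affine.
have cb (b : R) : 0 <= b -> plane_measurable (fun w => b * \1_(box (0, 0) rho) w).
  by move=> b0; apply: plane_measurableM; [exact: plane_measurable_cst|exact: measurable_indic_box].
have qp : q `^ p = e / (4 * (4 * rho ^+ 2 + 1)).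
  by rewrite /q -powRrM mulVf ?gt_eqF// powRr1// ltW// divr_gt0// mulr_gt0.
have key w : wd (f - dilate r f) w <= q `^ p * \1_(box (0, 0) rho) w + 2 `^ p * (T w + Td w).
  have s0 : 0 <= 2 `^ p * (T w + Td w) by rewrite mulr_ge0 ?addr_ge0// ltW.
  rewrite indicE; have [wb|wb] := boolP (w \in box (0, 0) rho).
    have [b1 b2] := (boxP _ _ _).1 (set_mem wb); rewrite /= !subr0 in b1 b2.
    rewrite mulr1 -[leLHS]addr0; apply: lerD => //; rewrite /wdensity.
    apply: (@le_trans _ _ (N ((f - dilate r f) (zc w)) `^ p)).
      rewrite ler_piMr ?powR_ge0// /weight -expR0 ler_expR mulNr oppr_le0.
      by rewrite mulr_ge0 ?powR_ge0// ltW.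
    apply: ge0_ler_powR; rewrite ?nnegrE ?normc_ge0 ?(ltW p_gt0) ?(ltW q0)//.
    apply: le_trans etaq; have er : 1 - r = eta by rewrite /r subKr.
    rewrite -er; apply: KP.
      by rewrite (ltW r0) (ltW r1).
    by apply: le_trans (normc_le_ReIm _) _; rewrite /= mulr_natl mulr2n -addrA; apply: lerD => //; lra.
  rewrite mulr0 add0r; apply: le_trans (wdensityD _ _ _) _; apply: ler_wpM2l; first exact: ltW.
  have nb x : ~ box (0, 0) n0%:R x -> \1_(~` box (0, 0) n0%:R) x = 1 :> R.
    by move=> h; rewrite indicE mem_set.
  have nb0 : ~ box (0, 0) rho w by move=> h; move: wb; rewrite mem_set.
  apply: lerD.
    rewrite /T nb ?mulr1//.
    move=> /boxP[]/=; rewrite !subr0 => h1 h2; apply: nb0; apply/boxP; rewrite /= !subr0 /rho.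
    have := ler0n R n0; move: h1 h2; move: `|w.1| `|w.2| => *; split; lra.
  rewrite /Td /T nb ?mulr1; last first.
    move=> /boxP[]/=; rewrite !addr0 !subr0 !normrM (gtr0_norm r0) => h1 h2; apply: nb0; apply/boxP; rewrite /= !subr0 /rho.
    have hh (y : R) : 0 <= y -> r * y <= n0%:R -> y <= 2 * n0%:R.
      by move=> y0 ry; have : 1 / 2 * y <= r * y by [apply: ler_wpM2r]; lra.
    by split; apply: hh.
  have zr : zc (r * w.1 + 0, r * w.2 + 0) = r%:C * zc w.
    by apply/eqP; rewrite eq_complex/= !mul0r !addr0 subr0 !eqxx.
  rewrite /wdensity; have -> : N ((- dilate r f) (zc w)) = N (f (r%:C * zc w)) by rewrite -normcNC opprK.
  rewrite zr; apply: ler_wpM2l; first exact: powR_ge0.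
  rewrite /weight ler_expR !mulNr lerN2; apply: ler_wpM2l; first exact: ltW.
  rewrite zr Normc.normcM normc_real (gtr0_norm r0); apply: ge0_ler_powR; rewrite ?nnegrE ?mulr_ge0 ?normc_ge0 ?(ltW a0) ?(ltW r0)//.
  by rewrite ler_piMl ?normc_ge0// ltW.
have mS : plane_measurable (fun w => 2 `^ p * (T w + Td w)).
  by apply: plane_measurableM; [exact: plane_measurable_cst|exact: plane_measurableD].
have S0 w : 0 <= 2 `^ p * (T w + Td w) by rewrite mulr_ge0 ?addr_ge0// ltW.
have B0 w : 0 <= q `^ p * \1_(box (0, 0) rho) w :> R by rewrite mulr_ge0 ?powR_ge0.
rewrite fock_normpE; apply: le_lt_trans (le_plane_integral _ _ (wdensity_ge0 p alpha _) key) _.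
- by apply: measurable_wdensity; exact: entireB.
- by apply: plane_measurableD => //; apply: cb; exact: powR_ge0.
rewrite plane_integralD//; last by apply: cb; exact: powR_ge0.
rewrite plane_integralZ ?powR_ge0//; last exact: measurable_indic_box.
rewrite plane_integral_box// plane_integralZ ?(ltW P0)//; last 2 first.
- exact: plane_measurableD.
- by move=> w; rewrite addr_ge0.
rewrite plane_integralD// -EFinM.
have TdT : (plane_integral Td <= 4%:E * plane_integral T)%E.
  have rn : r != 0 by rewrite gt_eqF.
  rewrite [X in (4%:E * X)%E](@plane_integral_affine _ _ r 0 r 0)// -/Td muleA -EFinM (gtr0_norm r0).
  apply: lee_pemull; first exact: plane_integral_ge0.
  by rewrite lee_fin; have : 1 / 2 * (1 / 2) <= r * r by [apply: ler_pM; rewrite ?divr_ge0]; lra.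
have TJ := plane_integral_ge0 T0.
move: TdT n0P TJ (plane_integral_ge0 Td0).
case: (plane_integral T) => [J| |]//; case: (plane_integral Td) => [J'| |]//.
rewrite !lee_fin !lte_fin => h1 h2 h3 h4.
have s2 : 2 `^ p * (J + J') <= e / 4.
  apply: (@le_trans _ _ (2 `^ p * (5 * e1))); first by apply: ler_wpM2l; [exact: ltW|lra].
  by rewrite /e1 le_eqVlt; apply/orP; left; apply/eqP; field; rewrite gt_eqF.
have s1 : q `^ p * (4 * rho ^+ 2) <= e / 4.
  rewrite qp; have -> : e / (4 * (4 * rho ^+ 2 + 1)) * (4 * rho ^+ 2) = e / 4 * ((4 * rho ^+ 2) / (4 * rho ^+ 2 + 1)).
    by field; rewrite gt_eqF.
  rewrite ler_piMr ?divr_ge0 ?(ltW e0)// ler_pdivrMr// mul1r lerDl//.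
by move: s1 s2; move: (q `^ p * _) (2 `^ p * _) => *; lra.
Qed.

Lemma fact_shift_le k L M : (k + L <= M)%N -> ((k + L)`! <= M ^ L * k`!)%N.
Proof.
elim: L => [|L IH] kM; first by rewrite addn0 expn0 mul1n.
rewrite addnS factS expnS -mulnA; apply: leq_mul; first by rewrite -addnS.
by apply: IH; apply: leq_trans kM; rewrite leq_add2l.
Qed.

Lemma peak_shift_le k L : peak alpha (k + L) <= (k + L).+1%:R ^+ L * peak alpha k.
Proof.
have ia : 0 <= alpha^-1 by rewrite invr_ge0 ltW.
have ia1 : alpha^-1 <= 1 by rewrite invf_le1// ltW.
have aL : 1 <= alpha ^+ L by rewrite exprn_ege1// ltW.
have b1 : 1 <= (k + L).+1%:R ^+ L :> R by rewrite exprn_ege1// ler1n.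
have q0 n : 0 <= n`!%:R / alpha ^+ n by rewrite divr_ge0// exprn_ge0// ltW.
apply: (@le_trans _ _ (((k + L).+1%:R ^+ L) `^ alpha^-1 * peak alpha k)); last first.
  by apply: ler_wpM2r; [exact/ltW/peak_gt0|exact: ler1_powR].
rewrite /peak -powRM ?exprn_ge0//; apply: ge0_ler_powR => //; rewrite ?nnegrE.
- exact: q0.
- by rewrite mulr_ge0 ?exprn_ge0.
rewrite exprD invfM [in leRHS]mulrA [in leLHS]mulrA; apply: (@le_trans _ _ ((k + L)`!%:R / alpha ^+ k)).
  by rewrite ler_piMr ?divr_ge0 ?exprn_ge0 ?(ltW a0)// invf_le1// (lt_le_trans ltr01).
apply: ler_wpM2r; first by rewrite invr_ge0 exprn_ge0// ltW.
by rewrite -natrX -natrM ler_nat; exact: fact_shift_le.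
Qed.

(** With [q = expR (- t)], a single term of the exponential series dominates the polynomial. *)
Lemma poly_geometric (E : nat) (q : R) : 0 < q < 1 ->
  exists2 c : R, 0 <= c & forall k, (k + E)%:R ^+ E * q ^+ k <= c.
Proof.
move=> /andP[q0 q1]; have [t t0 qt] : exists2 t, 0 < t & q = expR (- t).
  by exists (- ln q); [rewrite oppr_gt0 ln_lt0// q0|rewrite opprK lnK].
exists (E`!%:R / t ^+ E * expR (E%:R * t)); first by rewrite mulr_ge0 ?expR_ge0// divr_ge0// exprn_ge0// ltW.
move=> k; have := exprn_le_fact E (mulr_ge0 (ler0n R (k + E)) (ltW t0)).
have tE : 0 < t ^+ E by rewrite exprn_gt0.
rewrite exprMn -ler_pdivlMr// => /(ler_wpM2r (exprn_ge0 k (ltW q0))) /le_trans; apply.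
rewrite le_eqVlt; apply/orP; left; apply/eqP.
rewrite {1}qt -expRM_natl natrD mulrDl expRD mulrN.
have e1 : expR (k%:R * t) * expR (- (k%:R * t)) = 1 by rewrite -expRD subrr expR0.
have -> : E`!%:R * (expR (k%:R * t) * expR (E%:R * t)) / t ^+ E * expR (- (k%:R * t)) =
  E`!%:R / t ^+ E * expR (E%:R * t) * (expR (k%:R * t) * expR (- (k%:R * t))) by ring.
by rewrite e1 mulr1.
Qed.

Lemma geometric_tail (q : R) n m : 0 < q < 1 ->
  \sum_(k < m) (if (k < n)%N then 0 else q ^+ k) <= q ^+ n / (1 - q).
Proof.
move=> /andP[q0 q1]; rewrite ler_pdivlMr ?subr_gt0//.
apply: (@le_trans _ _ (q ^+ n - q ^+ maxn m n)); last by rewrite gerBl exprn_ge0// ltW.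
elim: m => [|m IH]; first by rewrite big_ord0 mul0r max0n subrr.
rewrite big_ord_recr/= mulrDl; apply: le_trans (lerD IH (lexx _)) _.
have [mn|nm] := ltnP m n; first by rewrite mul0r addr0 (maxn_idPr mn).
by rewrite (maxn_idPl (leqW nm)) exprSr; lra.
Qed.

Lemma fock_le_real f : (normp f < +oo)%E -> exists M : R, (normp f <= M%:E)%E.
Proof. by move: (normp_ge0 f); case: (normp f) => // M _ _; exists M. Qed.

Lemma exists_decay_exponent : exists L : nat, 4 <= L%:R * p.
Proof. by have [n nP] := archimedean_nat (4 / p); exists n.+1; rewrite -ler_pdivrMr. Qed.

Lemma decay_normp_small (K e : R) L : 4 <= L%:R * p -> 0 <= K -> 0 < e -> exists2 d : R, 0 < d &
  forall f B, entire_cderiv f -> B <= d -> decay alpha f (K * B) L -> (normp f < e%:E)%E.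
Proof.
move=> Lp K0 e0; have [J J0 JP] := decay_normp alpha p_gt0 Lp.
have K1 : 0 < K + 1 by rewrite ltr_wpDl.
have J1 : 0 < J + 1 by rewrite ltr_wpDl.
pose q := (e / (J + 1)) `^ p^-1; have q0 : 0 < q by rewrite powR_gt0// divr_gt0.
exists (q / (K + 1)); first by rewrite divr_gt0.
move=> f B ef Bd fB; have fq : decay alpha f q L.
  move=> z; apply: le_trans (fB z) _; apply: ler_wpM2r; first exact: expR_ge0.
  apply: (@le_trans _ _ (K * (q / (K + 1)))); first exact: ler_wpM2l.
  by rewrite mulrA ler_pdivrMr// mulrC ler_pM2l// lerDl.
apply: le_lt_trans (JP f q ef fq) _; rewrite lte_fin /q -powRrM mulVf ?gt_eqF// powRr1 ?divr_ge0 ?(ltW e0) ?(ltW J1)//.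
by rewrite mulrA ltr_pdivrMr// mulrC ltr_pM2l// ltrDl.
Qed.

(** The coefficients of the dilation carry [r ^+ k], a geometric factor that overcomes all
    polynomial losses between norm and coefficients. *)
Lemma dilate_poly f a (r e : R) : pser f a -> (normp f < +oo)%E -> 0 < r < 1 -> 0 < e ->
  exists n, (normp (dilate r f - psum (fun k => a k * r%:C ^+ k) n)%R < e%:E)%E.
Proof.
move=> fa foo /andP[r0 r1] e0; pose b k := a k * r%:C ^+ k.
have [M fM] := fock_le_real foo.
have [D [K K0 KP]] := fock_growth p_gt0 alpha_gt2; have fG := KP f M (pser_entire fa) fM.
move: ((K * M) `^ p^-1) (powR_ge0 (K * M) p^-1) fG => G G0 fG.
have [L Lp] := exists_decay_exponent.
have [d d0 dP] := decay_normp_small Lp (decay_const_ge0 alpha_gt2 L) e0.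
(* [r ^+ k] is shared out: one factor [q ^+ k] absorbs the polynomials in [k], the other makes the
   tail converge. *)
pose q := Num.sqrt r; have q0 : 0 < q by rewrite sqrtr_gt0.
have qq : r = q * q by rewrite -expr2 sqr_sqrtr// ltW.
have q1 : q < 1 by rewrite ltNge; apply/negP => h; move: r1; rewrite qq ltNge mulr_ege1.
have q01 : 0 < q < 1 by rewrite q0.
pose E := (D.+1 + L)%N.
have [c c0 cP] := poly_geometric E q01.
have [c' c'0 c'P] := poly_geometric 1 q01.
pose C0 := expR 1 * G * c; have C00 : 0 <= C0 by rewrite !mulr_ge0 ?expR_ge0.
have qs : 0 < 1 - q by rewrite subr_gt0.
(* Since [(n + 1) q^n] is bounded by [c'], this [n] brings the tail [C0 * q^n / (1 - q)] below the
   threshold [d]. *)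
have [n nP] := archimedean_nat (C0 * c' / ((1 - q) * d)).
exists n; have ag : forall k, (n <= k)%N -> (fun k => if (k < n)%N then b k else 0) k = 0.
  by move=> k nk; rewrite ltnNge nk.
have gE : psum b n = psum (fun k => if (k < n)%N then b k else 0) n.
  by apply/funext => z; apply: eq_bigr => k _; rewrite ltn_ord.
have := pserB (pser_dilate r0 fa) (pser_finite ag); rewrite -gE -/b => H.
apply: (dP _ (C0 * q ^+ n / (1 - q)) (pser_entire H)).
  rewrite ler_pdivrMr//; apply: (@le_trans _ _ (C0 * (c' / n.+1%:R))).
    apply: ler_wpM2l => //; rewrite ler_pdivlMr// mulrC.
    by have := c'P n; rewrite addn1 expr1.
  move: nP; rewrite ler_pdivrMr ?mulr_gt0// => nP; rewrite mulrA ler_pdivrMr//.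
  by apply: le_trans nP _; rewrite mulrC [d * _]mulrC.
apply: (pser_decay alpha_gt2 H) => m.
apply: (@le_trans _ _ (\sum_(k < m) C0 * (if (k < n)%N then 0 else q ^+ k))); last first.
  by rewrite -mulr_sumr -mulrA; apply: ler_wpM2l => //; exact: geometric_tail.
apply: ler_sum => k _; case: ifP => kn; first by rewrite subrr Normc.normc0 mul0r mulr0.
rewrite subr0 /b Normc.normcM normcX normc_real (gtr0_norm r0).
have pk := peak_gt0 alpha_gt2 k.
apply: (@le_trans _ _ ((expR 1 * G * k.+1%:R ^+ D.+1 / peak alpha k) * r ^+ k * ((k + L).+1%:R ^+ L * peak alpha k))).
  apply: ler_pM.
  - by rewrite mulr_ge0 ?normc_ge0// exprn_ge0// ltW.
  - exact/ltW/peak_gt0.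
  - by apply: ler_wpM2r; [rewrite exprn_ge0// ltW|exact: (growth_coef alpha_gt2 k fa fG)].
  - exact: peak_shift_le.
have -> : expR 1 * G * k.+1%:R ^+ D.+1 / peak alpha k * r ^+ k * ((k + L).+1%:R ^+ L * peak alpha k) =
   expR 1 * G * (k.+1%:R ^+ D.+1 * (k + L).+1%:R ^+ L * q ^+ k) * q ^+ k.
  by rewrite qq exprMn; move: (expR 1) (_ ^+ D.+1) (_ ^+ L) (q ^+ k) => *; field; rewrite gt_eqF.
apply: ler_wpM2r; first by rewrite exprn_ge0// ltW.
apply: ler_wpM2l; first by rewrite mulr_ge0// expR_ge0.
apply: le_trans (cP k); apply: ler_wpM2r; first by rewrite exprn_ge0// ltW.
rewrite /E exprD; apply: ler_pM; rewrite ?exprn_ge0//; apply: lerXn2r; rewrite ?nnegrE ?ler_nat//.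
  by rewrite -addn1 leq_add2l.
by rewrite -addnS leq_add2l addSn ltnS leq_addl.
Qed.

(** The approximating coefficients are multiples of those of [f], so the polynomials vanish at 0 at
    least to the order of [f]; this serves the vanishing subspaces as well as the whole space. *)
Lemma fock_density f a (e : R) : pser f a -> (normp f < +oo)%E -> 0 < e ->
  exists n b, (forall k, a k = 0 -> b k = 0) /\ (normp (f - psum b n)%R < e%:E)%E.
Proof.
move=> fa foo e0; have P0 : 0 < 2 `^ p :> R by exact: powR_gt0.
have e1 : 0 < e / (2 `^ p * 2) by rewrite divr_gt0// mulr_gt0.
have ef := pser_entire fa.
have [r r01 rP] := dilate_normp ef foo e1.
have [n nP] := dilate_poly fa foo r01 e1.
have r0 : 0 < r by case/andP: r01.
exists n, (fun k => a k * r%:C ^+ k); split; first by move=> k ->; rewrite mul0r.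
have ed := pser_entire (pser_dilate r0 fa).
have ep : entire_cderiv (psum (fun k => a k * r%:C ^+ k) n).
  pose b k := if (k < n)%N then a k * r%:C ^+ k else 0.
  have -> : psum (fun k => a k * r%:C ^+ k) n = psum b n.
    by apply/funext => z; apply: eq_bigr => k _; rewrite /b ltn_ord.
  by apply: (@pser_entire _ _ b); apply: pser_finite => k nk; rewrite /b ltnNge nk.
have -> : (f - psum (fun k => a k * r%:C ^+ k) n)%R =
  (f - dilate r f) + (dilate r f - psum (fun k => a k * r%:C ^+ k) n) by rewrite addrA subrK.
apply: le_lt_trans (normpD (entireB ef ed) (entireB ed ep)) _.
move: rP nP (normp_ge0 (f - dilate r f)) (normp_ge0 (dilate r f - psum (fun k => a k * r%:C ^+ k) n)).
case: (normp (f - dilate r f)) => [x| |]//; case: (normp (dilate r f - _)) => [y| |]//.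
rewrite !lte_fin !lee_fin => h1 h2 h3 h4.
apply: (@lt_le_trans _ _ (2 `^ p * (e / (2 `^ p * 2) + e / (2 `^ p * 2)))).
  by rewrite ltr_pM2l//; lra.
by rewrite le_eqVlt; apply/orP; left; apply/eqP; field; rewrite gt_eqF.
Qed.

End FockDensity.

(** * The weights omega and their convolution *)

Section FactorialWeights.
Variables (R : realType) (alpha : R).
Hypothesis alpha_gt2 : 2 < alpha.

Let a0 : 0 < alpha. Proof. by apply: lt_trans alpha_gt2. Qed.
Let a1 : 1 < alpha. Proof. by apply: lt_trans alpha_gt2; rewrite ltr1n. Qed.

(** The growth exponent of [omega k.+1 / omega k], above 1/2 because [alpha > 2]. *)
Let s := 1 - alpha^-1.

Let ia2 : alpha^-1 < 2^-1. Proof. by rewrite ltf_pV2 ?posrE. Qed.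

Let ia0 : 0 < alpha^-1. Proof. by rewrite invr_gt0. Qed.

Let s0 : 0 < s. Proof. by rewrite /s; move: ia2; lra. Qed.

(* The operator V shifts z^k / k!, and in the basis z^k / k! the growth of the coefficients
   of a function of the Fock space is governed by omega. *)
Definition omega k : R := k`!%:R / peak alpha k.

Lemma omega_gt0 k : 0 < omega k.
Proof. by rewrite divr_gt0 ?peak_gt0// ltr0n fact_gt0. Qed.

Let rho k : R := k%:R `^ s * alpha `^ alpha^-1.

Let omegaS k : omega k.+1 = rho k.+1 * omega k.
Proof.
have k0 : 0 <= k.+1%:R :> R by [].
have kn : k.+1%:R != 0 :> R by rewrite pnatr_eq0.
have ap : 0 < alpha `^ alpha^-1 by exact: powR_gt0.
have kp : 0 < k.+1%:R `^ alpha^-1 :> R by rewrite powR_gt0// ltr0n.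
have E : peak alpha k.+1 = k.+1%:R `^ alpha^-1 / alpha `^ alpha^-1 * peak alpha k.
  have av : 0 <= alpha^-1 by exact: ltW.
  have -> : (alpha `^ alpha^-1)^-1 = alpha^-1 `^ alpha^-1.
    by rewrite -powRN -mulN1r powRrM powR_inv1// ltW.
  rewrite /peak -!powRM ?mulr_ge0 ?invr_ge0 ?exprn_ge0 ?(ltW a0)//; congr (_ `^ _).
  by rewrite factS natrM exprS; field; rewrite !gt_eqF// exprn_gt0.
have ke : k.+1%:R = k.+1%:R `^ s * k.+1%:R `^ alpha^-1 :> R.
  by rewrite -powRD ?kn ?implybT// /s subrK powRr1.
rewrite /omega E factS natrM {1}ke /rho; move: (peak_gt0 alpha_gt2 k) => pk.
by field; rewrite !gt_eqF.
Qed.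

Let rho_ge k : k%:R `^ s <= rho k.
Proof.
rewrite /rho ler_peMr ?powR_ge0// -(powRr0 alpha); apply: ler_powR; exact: ltW.
Qed.

Let nat_powR_le i j : (i <= j)%N -> i%:R `^ s <= j%:R `^ s :> R.
Proof. by move=> ij; apply: ge0_ler_powR; rewrite ?nnegrE ?ler_nat ?(ltW s0). Qed.

Let rho_le i j : (i <= j)%N -> rho i <= rho j.
Proof. by move=> ij; apply: ler_wpM2r; [exact: powR_ge0|exact: nat_powR_le]. Qed.

Let rho_ge0 i : 0 <= rho i. Proof. by rewrite mulr_ge0 ?powR_ge0. Qed.

(** Log-convexity, because the quotients [rho] increase: among products with a given sum of indices
    the most unequal pair is largest. *)
Lemma omega_convex c x y : omega (c + x) * omega (c + y) <= omega c * omega (c + x + y).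
Proof.
elim: x => [|x IH]; first by rewrite addn0.
rewrite addnS addSn !omegaS -mulrA [leRHS]mulrCA; apply: ler_pM => //.
- by rewrite mulr_ge0 ?(ltW (omega_gt0 _)).
- by apply: rho_le; rewrite ltnS leq_addr.
Qed.

Lemma omega_shift k i j : (j <= k)%N -> (j.+1%:R `^ s) ^+ i * omega k <= omega (k + i).
Proof.
move=> jk; elim: i => [|i IH]; first by rewrite expr0 mul1r addn0.
rewrite addnS omegaS exprS -mulrA; apply: ler_pM => //.
- by rewrite mulr_ge0 ?exprn_ge0 ?powR_ge0 ?(ltW (omega_gt0 _)).
- by apply: le_trans (rho_ge _); apply: nat_powR_le; rewrite ltnS (leq_trans jk)// leq_addr.
Qed.

(** Each step of the index multiplies [omega] by at least [j.+1 ^ s], so more than [D / s] steps pay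
    for a polynomial of degree [D]. *)
Lemma omega_absorb D : exists i, forall k j, (j <= k)%N -> j.+1%:R ^+ D * omega k <= omega (k + i).
Proof.
have [n nP] := archimedean_nat (D%:R / s); exists n.+1 => k j jk.
apply: le_trans (omega_shift n.+1 jk); apply: ler_wpM2r; first exact/ltW/omega_gt0.
rewrite -powR_mulrn// -powR_mulrn ?powR_ge0// -powRrM; apply: ler_powR; first by rewrite ler1n.
by rewrite mulrC -ler_pdivrMr.
Qed.

Lemma sum_indic_ord m (i0 : nat) : \sum_(i < m) (i == i0 :> nat)%:R <= 1 :> R.
Proof.
elim: m => [|m IH]; first by rewrite big_ord0.
rewrite big_ord_recr/=; have [e|ne] := eqVneq m i0; last by rewrite addr0.
rewrite big1 ?add0r// => i _; rewrite -e.
by rewrite ltn_eqF.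
Qed.

(** The terms [i = 0] and [i = m] are smaller than [omega (T + m.+2)] by a factor [m^(- s)]. The
    others are, by log-convexity, smaller by [m^(- 2 s)], and there are at most [m + 1] of them.
    Both contributions are of order at most [m^(1 - 2 s)], as [s < 1]. *)
Lemma omega_convolution T m :
  \sum_(i < m.+1) omega (T + i.+1) * omega (T + (m.+1 - i)) <=
  (2 * omega T.+1 + omega T.+2) * m.+1%:R `^ (1 - 2 * s) * omega (T + m.+2).
Proof.
pose x : R := m.+1%:R; have x1 : 1 <= x by rewrite /x ler1n.
have x0 : 0 < x by exact: lt_le_trans x1.
have xn : x != 0 by rewrite gt_eqF.
pose y := x `^ s; have y0 : 0 < y by exact: powR_gt0.
pose U := omega (T + m.+2); have U0 : 0 < U := omega_gt0 _.
have [A AE] : exists A, A = omega T.+1 * (y^-1 * U) by exists (omega T.+1 * (y^-1 * U)).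
have [B BE] : exists B, B = omega T.+2 * ((y ^+ 2)^-1 * U) by exists (omega T.+2 * ((y ^+ 2)^-1 * U)).
have og k : 0 <= omega k by exact/ltW/omega_gt0.
have A0 : 0 <= A by rewrite AE; apply: mulr_ge0; [exact: og|apply: mulr_ge0; [by rewrite invr_ge0 ltW|exact: ltW]].
have B0 : 0 <= B by rewrite BE; apply: mulr_ge0; [exact: og|apply: mulr_ge0; [by rewrite invr_ge0 exprn_ge0// ltW|exact: ltW]].
have hA : omega T.+1 * omega (T + m.+1) <= A.
  rewrite AE; apply: ler_wpM2l; first exact/ltW/omega_gt0.
  rewrite ler_pdivlMl//; have := @omega_shift (T + m.+1) 1 m (leq_trans (leqnSn m) (leq_addl T _)).
  by rewrite expr1 addn1 -addnS.
have hB : omega T.+2 * omega (T + m) <= B.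
  rewrite BE; apply: ler_wpM2l; first exact/ltW/omega_gt0.
  rewrite ler_pdivlMl ?exprn_gt0//; have := @omega_shift (T + m) 2 m (leq_addl T _).
  by rewrite addn2 /U !addnS.
(* The indicators pick out the two exceptional terms; [B] bounds each of the remaining ones and is
   added throughout. *)
have term (i : 'I_m.+1) : omega (T + i.+1) * omega (T + (m.+1 - i)) <=
    (i == 0%N :> nat)%:R * A + ((i == m :> nat)%:R * A + B).
  have im : (i <= m)%N by rewrite -ltnS.
  have [i0|i0] := eqVneq (i : nat) 0%N.
    rewrite i0 mul1r subn0 addn1; apply: le_trans hA _.
    by rewrite lerDl addr_ge0// mulr_ge0.
  rewrite mul0r add0r; have [em|nem] := eqVneq (i : nat) m.
    by rewrite em mul1r subSnn addn1 mulrC; apply: le_trans hA _; rewrite lerDl.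
  rewrite mul0r add0r; apply: le_trans hB.
  have i1 : (0 < i)%N by rewrite lt0n.
  have im1 : (i < m)%N by rewrite ltn_neqAle nem.
  have -> : (T + i.+1 = T.+2 + i.-1)%N by rewrite !addSnnS prednK.
  have -> : (T + (m.+1 - i) = T.+2 + (m - i.+1))%N by rewrite !addSnnS subnSK// subSn.
  apply: le_trans (omega_convex _ _ _) _.
  by rewrite -addnA !addSnnS -addSn -addnS prednK// subnSK// subnKC.
apply: le_trans (ler_sum _ (fun i _ => term i)) _.
rewrite !big_split/= -!mulr_suml sumr_const card_ord.
have iA i0 : (\sum_(i < m.+1) (i == i0 :> nat)%:R) * A <= A.
  by rewrite -[leRHS]mul1r; apply: ler_wpM2r => //; exact: sum_indic_ord.
apply: le_trans (lerD (iA 0%N) (lerD (iA m) (lexx _))) _.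
rewrite -[B *+ _]mulr_natl -/x.
have e2 : x * (y ^+ 2)^-1 = x `^ (1 - 2 * s).
  rewrite powRD ?xn ?implybT// powRr1 ?(ltW x0)// powRN; congr (_ * _^-1).
  by rewrite -(powR_mulrn 2 (ltW y0)) /y -powRrM mulrC.
have e1 : y^-1 <= x `^ (1 - 2 * s).
  by rewrite /y -powRN; apply: ler_powR => //; rewrite /s; move: ia0; lra.
have -> : x * B = omega T.+2 * x `^ (1 - 2 * s) * U by rewrite -e2 BE; ring.
have hA' : A <= omega T.+1 * x `^ (1 - 2 * s) * U.
  rewrite AE -mulrA; apply: ler_wpM2l; first exact/ltW/omega_gt0.
  by apply: ler_wpM2r => //; exact: ltW.
rewrite -/x -/U; have -> : (2 * omega T.+1 + omega T.+2) * x `^ (1 - 2 * s) * U =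
  omega T.+1 * x `^ (1 - 2 * s) * U + (omega T.+1 * x `^ (1 - 2 * s) * U + omega T.+2 * x `^ (1 - 2 * s) * U) by ring.
by apply: lerD => //; apply: lerD.
Qed.

Lemma omega_convolution_small T (e : R) : 0 < e -> exists m0, forall m, (m0 <= m)%N ->
  \sum_(i < m.+1) omega (T + i.+1) * omega (T + (m.+1 - i)) <= e * omega (T + m.+2).
Proof.
move=> e0; pose c := 2 * omega T.+1 + omega T.+2.
have c0 : 0 < c by apply: addr_gt0; [apply: mulr_gt0 => //|]; exact: omega_gt0.
(* This is where the hypothesis [2 < alpha] acts: the exponent [1 - 2 s] is negative. *)
pose d := 2 * s - 1; have d0 : 0 < d by rewrite /d /s; move: ia2; lra.
have [n nP] := archimedean_nat ((c / e) `^ d^-1); exists n => m nm.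
apply: le_trans (omega_convolution T m) _; apply: ler_wpM2r; first exact/ltW/omega_gt0.
have -> : 1 - 2 * s = - d by rewrite /d opprB.
have h : c / e <= m.+1%:R `^ d.
  have -> : c / e = ((c / e) `^ d^-1) `^ d by rewrite -powRrM mulVf ?gt_eqF// powRr1// divr_ge0 ?(ltW c0) ?(ltW e0).
  apply: ge0_ler_powR; rewrite ?nnegrE ?powR_ge0 ?(ltW d0)//.
  by apply: le_trans nP _; rewrite ler_nat.
have m0 : 0 < m.+1%:R `^ d :> R by rewrite powR_gt0// ltr0n.
by rewrite powRN -/c ler_pdivrMr// mulrC -ler_pdivrMr.
Qed.

End FactorialWeights.

(** * The reciprocal of a formal power series *)

Section ConvolutionInverse.
Variable R : realType.
Local Notation C := R[i]^o.
Local Notation N := (@Normc.normc R).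

(** Each coefficient depends on all earlier ones, so the recursion carries the whole list and stays
    structural. *)
Fixpoint conv_inverse_seq (b : nat -> C) (n : nat) : seq C :=
  if n is m.+1 then let t := conv_inverse_seq b m in
    rcons t (- (b 0%N)^-1 * \sum_(k < m.+1) t`_k * b (m.+1 - k)%N)
  else [:: (b 0%N)^-1].

Definition conv_inverse b n : C := (conv_inverse_seq b n)`_n.

Lemma size_conv_inverse_seq b n : size (conv_inverse_seq b n) = n.+1.
Proof. by elim: n => [//|n IH] /=; rewrite size_rcons IH. Qed.

Lemma nth_conv_inverse_seq b n k : (k <= n)%N -> (conv_inverse_seq b n)`_k = conv_inverse b k.
Proof.
elim: n => [|n IH]; first by rewrite leqn0 => /eqP ->.
rewrite leq_eqVlt => /predU1P[->//|kn] /=; rewrite nth_rcons size_conv_inverse_seq kn.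
exact: IH.
Qed.

Lemma conv_inverseS b n : conv_inverse b n.+1 =
  - (b 0%N)^-1 * \sum_(k < n.+1) conv_inverse b k * b (n.+1 - k)%N.
Proof.
rewrite /conv_inverse/= nth_rcons size_conv_inverse_seq ltnn eqxx; congr (_ * _).
by apply: eq_bigr => k _; rewrite nth_conv_inverse_seq// -ltnS.
Qed.

Lemma conv_inverse_sum b m : b 0%N != 0 ->
  \sum_(k < m.+1) conv_inverse b k * b (m - k)%N = (m == 0%N)%:R.
Proof.
move=> b0; case: m => [|m]; first by rewrite big_ord_recl big_ord0 addr0 mulVf.
rewrite big_ord_recr/= subnn conv_inverseS mulrAC mulNr mulVf// mulN1r subrr//.
Qed.

End ConvolutionInverse.

(** * Recovering monomials from the iterates of V on one function *)

Section VolterraApproximation.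
Variables (R : realType) (p alpha : R).
Hypothesis p_gt0 : 0 < p.
Hypothesis alpha_gt2 : 2 < alpha.
Local Notation C := R[i]^o.
Local Notation N := (@Normc.normc R).
Local Notation normp := (fock_normp p (@radial_power R alpha)).
Local Notation om := (omega alpha).
Implicit Types (f g : C -> C) (a b c : nat -> C).

Let om_gt0 k : 0 < om k. Proof. exact: omega_gt0. Qed.
Let om_ge0 k : 0 <= om k. Proof. exact/ltW. Qed.

Lemma iter_vcoef a j q :
  iter j (@vcoef R) a q = if (q < j)%N then 0 else (q - j)`!%:R / q`!%:R * a (q - j)%N.
Proof.
have fn n : (n`!%:R : C) != 0 by rewrite pnatr_eq0 -lt0n fact_gt0.
elim: j q => [|j IH] q; first by rewrite subn0 mulfV// mul1r.
rewrite iterS /vcoef; case: q => [//|q]; rewrite IH ltnS; case: ifP => _; first by rewrite mul0r.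
by rewrite subSS factS natrM invfM; move: (q.+1%:R^-1) (q`!%:R^-1) => *; ring.
Qed.

Lemma pser_iter_volterra f a j : pser f a -> pser (iter j (@volterra R) f) (iter j (@vcoef R) a).
Proof. by move=> fa; elim: j => [//|j IH]; exact: pser_volterra. Qed.

Lemma pser_sum n c (g : nat -> C -> C) (h : nat -> nat -> C) : (forall k, pser (g k) (h k)) ->
  pser (\sum_(k < n) c k *: g k) (fun q => \sum_(k < n) c k * h k q).
Proof.
move=> gh; elim: n => [|n IH].
  rewrite big_ord0; have -> : (fun q => \sum_(k < 0) c k * h k q) = fun=> 0.
    by apply/funext => q; rewrite big_ord0.
  exact: pser_zero.
rewrite big_ord_recr/= addrC; have := pser_linear (c n) (gh n) IH; congr (pser _ _).
by apply/funext => q; rewrite big_ord_recr/= addrC.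
Qed.

(** The factor [k!] passes to the basis [z^k / k!]. The polynomial loss of [growth_coef] is hidden
    in the index shift [i], which leaves a clean bound by [omega]. *)
Lemma borel_bound f a m : pser f a -> (normp f < +oo)%E -> exists i, exists2 B : R, 0 <= B &
  forall j, N ((m + j)`!%:R * a (m + j)%N) <= B * om (m + i + j).
Proof.
move=> fa foo; have [M fM] := fock_le_real foo.
have [D [K K0 KP]] := fock_growth p_gt0 alpha_gt2; have fG := KP f M (pser_entire fa) fM.
move: ((K * M) `^ p^-1) (powR_ge0 (K * M) p^-1) fG => G G0 fG.
have [i iP] := omega_absorb alpha_gt2 D.+1; exists i, (expR 1 * G); first by rewrite mulr_ge0 ?expR_ge0.
move=> j; rewrite Normc.normcM normc_nat.
apply: (@le_trans _ _ ((m + j)`!%:R * (expR 1 * G * (m + j).+1%:R ^+ D.+1 / peak alpha (m + j)))).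
  by apply: ler_wpM2l => //; exact: (growth_coef alpha_gt2 _ fa fG).
have -> : (m + j)`!%:R * (expR 1 * G * (m + j).+1%:R ^+ D.+1 / peak alpha (m + j)) =
   expR 1 * G * ((m + j).+1%:R ^+ D.+1 * om (m + j)) by rewrite /omega; ring.
apply: ler_wpM2l; first by rewrite mulr_ge0 ?expR_ge0.
by rewrite addnAC; exact: iP.
Qed.

Lemma sum_ord_widen (F : nat -> R) n m : (n <= m)%N -> (forall k, 0 <= F k) ->
  \sum_(k < n) F k <= \sum_(k < m) F k.
Proof.
move=> nm F0; rewrite -(subnKC nm) big_split_ord/= lerDl.
by apply: sumr_ge0 => i _.
Qed.

(** The term [k = 0] is set apart: it is of full size [omega (T + m.+2)], but involves only the
    fixed number [c 0]. The bound [K] for the other coefficients is multiplied by the small [e]. *)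
Lemma conv_sum_bound b c (B K e : R) T m : 0 <= B -> 0 <= K ->
  (forall j, N (b j) <= B * om (T + j)) -> (forall k, (k <= m.+1)%N -> N (c k) <= K * om (T + k)) ->
  \sum_(i < m.+1) om (T + i.+1) * om (T + (m.+1 - i)) <= e * om (T + m.+2) ->
  \sum_(k < m.+2) N (c k) * N (b (m.+2 - k)%N) <= (N (c 0%N) * B + K * B * e) * om (T + m.+2).
Proof.
move=> B0 K0 bB cK oe; rewrite big_ord_recl/= subn0 mulrDl; apply: lerD.
  by rewrite -mulrA; apply: ler_wpM2l; first exact: normc_ge0.
apply: (@le_trans _ _ (K * B * (\sum_(i < m.+1) om (T + i.+1) * om (T + (m.+1 - i))))); last first.
  by rewrite -[leRHS]mulrA; apply: ler_wpM2l => //; exact: mulr_ge0.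
rewrite mulr_sumr; apply: ler_sum => i _; rewrite /bump/= add1n subSS.
have -> : K * B * (om (T + i.+1) * om (T + (m.+1 - i))) =
  (K * om (T + i.+1)) * (B * om (T + (m.+1 - i))) by ring.
by apply: ler_pM; rewrite ?normc_ge0// cK.
Qed.

(** A bootstrap: from some index on, the recursion returns at most half of the assumed constant plus
    a fixed amount [K1 / 2], so that a large enough constant reproduces itself. [S] takes care of
    the finitely many first coefficients. *)
Lemma conv_inverse_bound b (B : R) T : 0 <= B -> b 0%N != 0 -> (forall j, N (b j) <= B * om (T + j)) ->
  exists2 K : R, 0 <= K & forall k, N (conv_inverse b k) <= K * om (T + k).
Proof.
move=> B0 b0 bB; pose be := N (b 0%N); have be0 : 0 < be by rewrite normc_gt0.
have {B0}B0 : 0 < B.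
  rewrite lt_neqAle B0 andbT eq_sym; apply: contraTneq be0 => Bz.
  by have := bB 0%N; rewrite Bz mul0r -leNgt.
(* After division by [be] the recursion multiplies the constant by [B * e / be], which is 1/2 for
   this [e]. *)
have e0 : 0 < be / (2 * B) by rewrite divr_gt0// mulr_gt0.
have [m0 m0P] := omega_convolution_small alpha_gt2 T e0.
pose S := \sum_(k < m0.+2) N (conv_inverse b k) / om (T + k).
have S0 : 0 <= S by apply: sumr_ge0 => k _; rewrite divr_ge0 ?normc_ge0.
pose K1 := 2 * (N (conv_inverse b 0) * B / be).
have K10 : 0 <= K1 by rewrite !mulr_ge0 ?normc_ge0 ?invr_ge0 ?(ltW B0) ?(ltW be0).
exists (S + K1); first by rewrite addr_ge0.
move=> k; have [n kn] := ubnP k; elim: n k kn => // n IH k; rewrite ltnS => kn.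
have [km|mk] := ltnP k m0.+2.
  rewrite -ler_pdivrMr//; apply: (@le_trans _ _ S); last by rewrite lerDl.
  rewrite /S (bigD1 (Ordinal km))//= lerDl; apply: sumr_ge0 => i _.
  by rewrite divr_ge0 ?normc_ge0.
have [m km m0m] : exists2 m, k = m.+2 & (m0 <= m)%N.
  by case: k mk {kn} => [//|[//|m]] mk; exists m.
rewrite km in kn *; rewrite conv_inverseS Normc.normcM.
have -> : N (- (b 0%N)^-1) = be^-1.
  by rewrite normcNC Normc.normcV.
rewrite ler_pdivrMl//; apply: le_trans (normc_sum _ _ _) _.
under eq_bigr do rewrite Normc.normcM.
have cb := @conv_sum_bound b (conv_inverse b) B (S + K1) _ T m (ltW B0) (addr_ge0 S0 K10) bB _ (m0P m m0m).
apply: le_trans (cb _) _; first by move=> j jm; apply: IH; exact: leq_ltn_trans jm kn.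
rewrite [leRHS]mulrA; apply: ler_wpM2r => //.
have -> : (S + K1) * B * (be / (2 * B)) = (S + K1) * be / 2 by field; rewrite gt_eqF.
have -> : N (conv_inverse b 0) * B = K1 * be / 2 by rewrite /K1; field; rewrite gt_eqF.
have := mulr_ge0 S0 (ltW be0).
by rewrite mulrDl mulrDr [be * S]mulrC [be * K1]mulrC; move: (S * be) (K1 * be) => *; lra.
Qed.

(** Telescoping with [1/m - 1/(m+1)], which exceeds [1/(m+1)^2]. *)
Lemma inverse_square_tail W n Q : (0 < n)%N ->
  \sum_(q < Q) (if (q < W + n)%N then 0 else ((q - W).+1%:R ^+ 2)^-1) <= n%:R^-1 :> R.
Proof.
move=> n0; apply: (@le_trans _ _ (n%:R^-1 - (maxn Q (W + n) - W)%:R^-1)); last by rewrite gerBl invr_ge0.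
elim: Q => [|Q IH]; first by rewrite big_ord0 max0n addKn subrr.
rewrite big_ord_recr/=; apply: le_trans (lerD IH (lexx _)) _.
have [QW|WQ] := ltnP Q (W + n)%N; first by rewrite addr0 (maxn_idPr QW).
rewrite (maxn_idPl (leqW WQ)) subSn; last by apply: leq_trans WQ; exact: leq_addr.
have : (n <= Q - W)%N by rewrite leq_subRL//; apply: leq_trans WQ; exact: leq_addr.
move: (Q - W)%N => m nm; have m0 : 0 < m%:R :> R by rewrite ltr0n (leq_trans n0).
have m1 : 0 < m.+1%:R :> R by [].
have key : (m.+1%:R ^+ 2)^-1 <= m%:R^-1 - m.+1%:R^-1 :> R.
  have -> : m%:R^-1 - m.+1%:R^-1 = (m.+1%:R * m%:R)^-1 :> R.
    by rewrite -[m.+1%:R]natr1; field; rewrite natr1 !gt_eqF.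
  rewrite lef_pV2 ?posrE ?exprn_gt0 ?mulr_gt0// expr2; apply: ler_wpM2l => //.
  by rewrite ler_nat.
by move: key; move: (n%:R^-1) (m%:R^-1) (m.+1%:R^-1) (_^-1) => *; lra.
Qed.

Lemma sum_ord_trunc (F : nat -> C) m n : (m < n)%N ->
  \sum_(k < n) (if (k <= m)%N then F k else 0) = \sum_(k < m.+1) F k.
Proof.
move=> mn; rewrite -(subnKC mn) big_split_ord/= [X in _ + X]big1 ?addr0; last first.
  by move=> i _; rewrite addSn ltnNge -ltnS ltnS leq_addr.
by apply: eq_bigr => i _; rewrite -ltnS ltn_ord.
Qed.

(* With z^k / k! as basis, V is the shift and f corresponds to a sequence b; the partial sums
   of c(V) f, where c is the convolution inverse of b, converge to a monomial after finitely many
   further applications of V. *)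
Lemma volterra_approx f a m : pser f a -> (normp f < +oo)%E -> a m != 0 ->
  (forall k, (k < m)%N -> a k = 0) -> exists J, forall e : R, 0 < e -> exists n c,
  (normp ((m + J)`!%:R^-1 *: @monomial R (m + J) -
     \sum_(k < n) c k *: iter (J + k) (@volterra R) f)%R < e%:E)%E.
Proof.
move=> fa foo am0 amz; have [i0 [B B0 bB]] := borel_bound m fa foo.
pose b j : C := (m + j)`!%:R * a (m + j)%N; pose T := (m + i0)%N.
have b0 : b 0%N != 0 by rewrite /b addn0 mulf_neq0// pnatr_eq0 -lt0n fact_gt0.
have {}bB j : N (b j) <= B * om (T + j) by exact: bB.
have [K K0 cK] := conv_inverse_bound B0 b0 bB.
pose c := conv_inverse b.
have [L Lp] := exists_decay_exponent p_gt0.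
(* [L] powers pay for the index shift of [peak] that [pser_decay] demands, and the two others leave
   a summable [1 / (j+1)^2]. *)
have [i iP] := omega_absorb alpha_gt2 L.+2.
pose J := (i0 + i)%N; pose W := (m + J)%N.
have WT : W = (T + i)%N by rewrite /W /J addnA.
exists J => e e0.
have [d d0 dP] := decay_normp_small alpha p_gt0 Lp (decay_const_ge0 alpha_gt2 L) e0.
have [m0 m0P] := omega_convolution_small alpha_gt2 T ltr01.
pose C1 := N (c 0%N) * B + K * B * 1.
have C10 : 0 <= C1 by rewrite addr_ge0 ?mulr_ge0 ?normc_ge0.
pose C3 := C1 * (W + L).+1%:R ^+ L.
have C30 : 0 <= C3 by rewrite mulr_ge0 ?exprn_ge0.
have [n1 n1P] := archimedean_nat (C3 / d).
(* [n1] makes the tail small; [m0] and the offset 2 ensure that every index [j >= n] has the form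
   [j' + 2] with [m0 <= j'], as [conv_sum_bound] requires. *)
pose n := (n1 + m0).+2; exists n, c; rewrite -/W.
have H := pserB (pser_linear (W`!%:R^-1) (pser_monomial R W) (pser_zero R)) (pser_sum n c (fun k => pser_iter_volterra (J + k) fa)).
rewrite addr0 in H.
pose E q : C := W`!%:R^-1 * (q == W)%:R + 0 - \sum_(k < n) c k * iter (J + k) (@vcoef R) a q.
rewrite -/E in H.
have low q : (q < W)%N -> E q = 0.
  move=> qW; rewrite /E (ltn_eqF qW) mulr0 add0r big1 ?subrr// => k _.
  rewrite iter_vcoef; case: ifP => [_|/negbT]; first by rewrite mulr0.
  rewrite -leqNgt => jq; rewrite amz ?mulr0// ltn_subLR//.
  by apply: leq_trans qW _; rewrite /W addnAC [(m + J)%N]addnC leq_addr.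
have coefE k (j : nat) : iter (J + k) (@vcoef R) a (W + j)%N = (W + j)`!%:R^-1 * (if (k <= j)%N then b (j - k)%N else 0).
  rewrite iter_vcoef /W; case: (leqP k j) => kj.
    have -> : (m + J + j < J + k)%N = false.
      by rewrite ltnNge -addnA addnCA leq_add2l (leq_trans kj)// leq_addl.
    have -> : (m + J + j - (J + k) = m + (j - k))%N by rewrite [(m + J)%N]addnC -addnA subnDl addnBA.
    by rewrite /b; move: (_^-1) => x; ring.
  case: ifP => [_|/negbT]; first by rewrite mulr0.
  rewrite -leqNgt => jq; rewrite amz ?mulr0// ltn_subLR//.
  by rewrite -[(m + J + j)%N]addnA [(m + (J + j))%N]addnC ltn_add2r ltn_add2l.
have sumE (j : nat) : \sum_(k < n) c k * iter (J + k) (@vcoef R) a (W + j)%N =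
    (W + j)`!%:R^-1 * \sum_(k < n) (if (k <= j)%N then c k * b (j - k)%N else 0).
  rewrite mulr_sumr; apply: eq_bigr => k _; rewrite coefE.
  by case: ifP => _; rewrite ?mulr0// mulrCA.
(* Below index [W + n] the truncation is invisible: the sum is the full convolution of [c] and [b],
   which is 1 at index 0 and 0 elsewhere. *)
have mid (j : nat) : (j < n)%N -> E (W + j)%N = 0.
  move=> jn; rewrite /E sumE (@sum_ord_trunc (fun k => c k * b (j - k)%N))//.
  rewrite conv_inverse_sum// addr0 -[X in (_ == X)]addn0 eqn_add2l.
  by have [->|_] := eqVneq j 0%N; rewrite ?addn0 ?mulr0 subrr.
(* From [W + n] on only a truncated convolution is left, and the bounds on [b] and [c] apply to it
   term by term. *)
have high (j : nat) : (n <= j)%N -> N (E (W + j)%N) <= (W + j)`!%:R^-1 * (C1 * om (T + j)).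
  move=> nj; rewrite /E sumE -[X in (_ == X)]addn0 eqn_add2l.
  have -> : (j == 0%N) = false by rewrite eqn0Ngt (leq_trans _ nj).
  rewrite mulr0 add0r sub0r normcNC Normc.normcM Normc.normcV normc_nat.
  apply: ler_wpM2l; first by rewrite invr_ge0.
  have -> : \sum_(k < n) (if (k <= j)%N then c k * b (j - k)%N else 0) = \sum_(k < n) c k * b (j - k)%N.
    by apply: eq_bigr => k _; rewrite (leq_trans (ltnW (ltn_ord k))).
  apply: le_trans (normc_sum _ _ _) _; under eq_bigr do rewrite Normc.normcM.
  apply: le_trans (sum_ord_widen (F := fun k => N (c k) * N (b (j - k)%N)) nj _) _.
    by move=> k; rewrite mulr_ge0 ?normc_ge0.
  have [j' je jm] : exists2 j', j = j'.+2 & (m0 <= j')%N.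
    case: j nj => [//|[//|j']] nj; exists j' => //.
    by apply: leq_trans (leq_addl n1 m0) _; rewrite -2!ltnS.
  rewrite je; apply: conv_sum_bound => //.
  by rewrite mul1r; have := m0P j' jm; rewrite mul1r.
apply: (dP _ (C3 / n%:R) (pser_entire H)).
  have n0 : 0 < n%:R :> R by rewrite ltr0n.
  rewrite ler_pdivrMr// mulrC -ler_pdivrMr//; apply: le_trans n1P _.
  by rewrite ler_nat /n ltnS (leq_trans (leq_addr m0 _))// leqnSn.
apply: (pser_decay alpha_gt2 H) => Q.
apply: (@le_trans _ _ (\sum_(q < Q) C3 * (if (q < W + n)%N then 0 else ((q - W).+1%:R ^+ 2)^-1))); last first.
  by rewrite -mulr_sumr; apply: ler_wpM2l => //; exact: inverse_square_tail.
apply: ler_sum => -[q /= _] _; have [qW|Wq] := ltnP q (W + n)%N.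
  have -> : E q = 0.
    have [h|h] := ltnP q W; first exact: low.
    by rewrite -(subnKC h); apply: mid; rewrite ltn_subLR.
  by rewrite Normc.normc0 mul0r mulr0.
have WQ : (W <= q)%N by apply: leq_trans Wq; exact: leq_addr.
rewrite -(subnKC WQ); have : (n <= q - W)%N by rewrite leq_subRL.
move: (q - W)%N => j nj; rewrite addKn.
have pk := peak_gt0 alpha_gt2 (W + j); have j1 : 0 < j.+1%:R :> R by [].
have fk : 0 < (W + j)`!%:R :> R by rewrite ltr0n fact_gt0.
apply: (@le_trans _ _ (((W + j)`!%:R^-1 * (C1 * om (T + j))) * ((W + j + L).+1%:R ^+ L * peak alpha (W + j)))).
  apply: ler_pM; rewrite ?normc_ge0//; [exact/ltW/peak_gt0|exact: high|exact: peak_shift_le].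
have hW : (W + j + L).+1%:R <= (W + L).+1%:R * j.+1%:R :> R.
  rewrite -natrM ler_nat mulnS mulSn addnAC -addSn leq_add2l.
  by rewrite leq_addr.
have hom : om (T + j) * j.+1%:R ^+ L.+2 <= om (W + j).
  by rewrite WT addnAC mulrC; apply: iP; exact: leq_addl.
have -> : (W + j)`!%:R^-1 * (C1 * om (T + j)) * ((W + j + L).+1%:R ^+ L * peak alpha (W + j)) =
   C1 * (W + j + L).+1%:R ^+ L * om (T + j) / om (W + j).
  by rewrite [om (W + j)]/omega; move: (om (T + j)) (_ ^+ L) => *; field; rewrite !gt_eqF.
rewrite ler_pdivrMr//.
apply: (@le_trans _ _ (C1 * ((W + L).+1%:R * j.+1%:R) ^+ L * om (T + j))).
  apply: ler_wpM2r => //; apply: ler_wpM2l => //.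
  by apply: lerXn2r; rewrite ?nnegrE// mulr_ge0.
have -> : C1 * ((W + L).+1%:R * j.+1%:R) ^+ L * om (T + j) = C3 * (j.+1%:R ^+ L * om (T + j)).
  by rewrite exprMn /C3; ring.
rewrite -[leRHS]mulrA; apply: ler_wpM2l => //.
by rewrite ler_pdivlMl ?exprn_gt0// mulrA -exprD mulrC.
Qed.

End VolterraApproximation.

(** * Vanishing subspaces and the classification *)

Section InvariantSubspaces.
Variables (R : realType) (p alpha : R).
Hypothesis p_gt0 : 0 < p.
Hypothesis alpha_gt2 : 2 < alpha.
Local Notation C := R[i]^o.
Local Notation N := (@Normc.normc R).
Local Notation phi := (@radial_power R alpha).
Local Notation normp := (fock_normp p phi).
Local Notation fockS := (fock p phi).
Local Notation vanishing := (fock_vanishing p phi).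
Local Notation V := (@volterra R).
Local Notation mono := (@monomial R).
Implicit Types (f g h : C -> C) (a b c : nat -> C) (M : set (C -> C)).

Lemma pser_eq f g a : pser f a -> pser g a -> f = g.
Proof.
move=> [_ fa] [_ ga]; apply/funext => z.
by apply: (cvg_unique _ (fa z) (ga z)); exact: norm_hausdorff.
Qed.

Lemma fock_pser f : fockS f -> exists a, pser f a.
Proof. by move=> [/entireP /entire_pser]. Qed.

Lemma fock_monomial m : fockS (mono m).
Proof.
have em := pser_entire (pser_monomial R m); split; first exact/entireP.
have [L Lp] := exists_decay_exponent p_gt0.
have [J J0 JP] := decay_normp alpha p_gt0 Lp.
apply: le_lt_trans (JP _ (decay_const alpha L * peak alpha (m + L)) em _) _; last by rewrite ltry.
by move=> z; rewrite /monomial normcX; exact: (monomial_decay alpha_gt2 m L (normc_ge0 z)).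
Qed.

Lemma submod_closedP M : submod_closed [in M] <->
  M 0 /\ forall (c : C) f g, M f -> M g -> M (c *: f + g).
Proof.
split=> [[M0 ML]|[M0 ML]].
  split; first by move: M0; rewrite inE.
  by move=> c f g Mf Mg; have := ML c f g (mem_set Mf) (mem_set Mg); rewrite inE.
split; first by rewrite inE.
by move=> c f g /set_mem Mf /set_mem Mg; apply: mem_set; exact: ML.
Qed.

Lemma fock0 : fockS 0.
Proof.
split; first exact/entireP/(pser_entire (pser_zero R)).
rewrite -(scale0r (mono 0)) normpZ; last exact: pser_entire (pser_monomial R 0).
by rewrite Normc.normc0 powR0 ?gt_eqF// mul0e ltry.
Qed.

Lemma closure_limit M f : fock_closure p phi M `<=` M -> fockS f ->
  (forall e : R, 0 < e -> exists2 g, M g & (normp (f - g)%R < e%:E)%E) -> M f.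
Proof.
move=> cM ff fM; apply: cM; split => // e e0.
have [g Mg gP] := fM (e `^ p) (powR_gt0 _ e0); exists g => //.
exact/(fock_norm_lt alpha p_gt0 _ e0).
Qed.

Lemma vanishing_coefP n f a : pser f a -> (vanishing n f <-> fockS f /\ forall k, (k < n)%N -> a k = 0).
Proof.
move=> fa; have E k : (f^`(k) 0 = 0) <-> (a k = 0).
  rewrite (pser_coef k fa); split=> [/eqP|->]; last by rewrite mulr0.
  by rewrite mulf_eq0 pnatr_eq0 -[_ == 0%N]negbK -lt0n fact_gt0/= => /eqP.
by split=> -[ff fz]; split => // k kn; apply/E; exact: fz.
Qed.

Lemma vanishing_closed n : closed_subspace p phi (vanishing n).
Proof.
split.
- by move=> f [].
- apply/submod_closedP; split; first by apply/(vanishing_coefP n (pser_zero R)); split => //; exact: fock0.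
  move=> c f g fn gn; have [a fa] := fock_pser fn.1; have [b gb] := fock_pser gn.1.
  apply/(vanishing_coefP n (pser_linear c fa gb)); split; first exact: fock_linear fn.1 gn.1.
  move=> k kn; rewrite ((vanishing_coefP n fa).1 fn).2// ((vanishing_coefP n gb).1 gn).2//.
  by rewrite mulr0 addr0.
- move=> f [ff fcl]; have [a fa] := fock_pser ff; apply/(vanishing_coefP n fa); split => // k kn.
  (* The coefficients below [n] are continuous and vanish on the approximants, hence on the
     limit. *)
  have [c c0 cP] := fock_coef_bound p_gt0 alpha_gt2 k.
  apply/eqP; rewrite -normc_eq0 eq_le normc_ge0 andbT; apply: (@le0_of_eps _ _ c) => e e0.
  have [g gn /(fock_norm_lt alpha p_gt0 _ e0) /ltW fg] := fcl e e0.
  have [b gb] := fock_pser gn.1; have := cP _ _ _ (pserB fa gb) fg.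
  rewrite ((vanishing_coefP n gb).1 gn).2// subr0 -powRrM mulfV ?gt_eqF// powRr1//.
  exact: ltW.
Qed.

Lemma vanishing_volterra n f : vanishing n f -> vanishing n (V f).
Proof.
move=> fn; have [a fa] := fock_pser fn.1; apply/(vanishing_coefP n (pser_volterra fa)).
split; first exact: volterra_fock fn.1.
move=> [//|k] kn /=; rewrite ((vanishing_coefP n fa).1 fn).2 ?mul0r//.
exact: ltnW.
Qed.

Lemma vanishing_monomial n k : (n <= k)%N -> vanishing n (mono k).
Proof.
move=> nk; apply/(vanishing_coefP n (pser_monomial R k)); split; first exact: fock_monomial.
by move=> j jn; rewrite ltn_eqF// (leq_trans jn).
Qed.

Lemma vanishing_proper n : (0 < n)%N -> proper_invariant_subspace p phi (vanishing n).
Proof.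
move=> n0; split; [exact: vanishing_closed|exact: vanishing_volterra| |].
- move=> E; have := vanishing_monomial (leqnn n); rewrite E /= => /(congr1 (@^~ 1)).
  by rewrite /monomial expr1n => /eqP; rewrite oner_eq0.
- move=> E; have := fock_monomial 0; rewrite -E => /(vanishing_coefP n (pser_monomial R 0))[_ /(_ 0%N n0)].
  by move=> /eqP; rewrite eqxx oner_eq0.
Qed.

Lemma submod_sum M (n : nat) (F : 'I_n -> C -> C) : submod_closed [in M] ->
  (forall k, M (F k)) -> M (\sum_(k < n) F k).
Proof.
move=> /submod_closedP[M0 ML] MF; apply: big_ind => //.
by move=> f g Mf Mg; rewrite -[f]scale1r; exact: ML.
Qed.

Lemma psum_monomial b n : psum b n = \sum_(k < n) b k *: mono k.
Proof.
apply/funext => z; rewrite fct_sumE; apply: eq_bigr => k _ //.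
Qed.

Lemma psum_submod M b n : submod_closed [in M] -> (forall k, b k != 0 -> M (mono k)) -> M (psum b n).
Proof.
move=> sM bM; rewrite psum_monomial; apply: submod_sum => // k.
have [M0 ML] := (submod_closedP M).1 sM.
have [->|bk] := eqVneq (b k) 0; first by rewrite scale0r.
by rewrite -[_ *: _]addr0; apply: ML => //; exact: bM.
Qed.

Lemma vanishing_span n : vanishing n =
  fock_closure p phi (linear_span [set mono k | k in [set k : nat | (n <= k)%N]]).
Proof.
apply/seteqP; split=> f.
- move=> fn; split; first exact: fn.1.
  move=> e e0; have [a fa] := fock_pser fn.1.
  have [m [b [bz mP]]] := fock_density p_gt0 alpha_gt2 fa fn.1.2 (powR_gt0 p e0).
  exists (psum b m); last exact/(fock_norm_lt alpha p_gt0 _ e0).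
  (* For [k < n] the coefficient is 0, and [maxn n k] only names some monomial of the generating
     set. *)
  exists m, (fun k : 'I_m => b k), (fun k : 'I_m => mono (maxn n k)); split.
    by move=> k; exists (maxn n k) => //=; exact: leq_maxl.
  rewrite psum_monomial; apply: eq_bigr => k _.
  have [kn|//] := ltnP k n.
  by rewrite bz ?scale0r// ((vanishing_coefP n fa).1 fn).2.
- move=> [ff fcl]; have [_ sn cn] := vanishing_closed n; apply: cn; split => // e /fcl[g gs ge].
  exists g; last exact: ge.
  case: gs => m [c [u [us ->]]].
  have [v0 vL] := (submod_closedP _).1 sn.
  apply: submod_sum => // k; rewrite -[_ *: _]addr0; apply: vL => //.
  by have [j nj <-] := us k; exact: vanishing_monomial.
Qed.

Lemma volterra_monomial m : V (mono m) = m.+1%:R^-1 *: mono m.+1.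
Proof.
rewrite -[RHS]addr0; apply: (pser_eq (pser_volterra (pser_monomial R m))).
have := pser_linear (m.+1%:R^-1) (pser_monomial R m.+1) (pser_zero R); congr (pser _ _).
apply/funext => -[|k] /=; first by rewrite mulr0 addr0.
rewrite addr0 eqSS; have [->|_] := eqVneq k m; first by rewrite mulr1 mul1r.
by rewrite mulr0 mul0r.
Qed.

Lemma submod_iter_volterra M f j : (forall g, M g -> M (V g)) -> M f -> M (iter j V f).
Proof. by move=> MV Mf; elim: j => [//|j IH]; exact: MV. Qed.

Lemma submod_scale M (c : C) f : submod_closed [in M] -> M f -> M (c *: f).
Proof. by move=> /submod_closedP[M0 ML] Mf; rewrite -[_ *: _]addr0; exact: ML. Qed.

(** [volterra_approx] puts one monomial into the closure of the iterates of [f]; by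
    [volterra_monomial], [V] then produces all higher ones. *)
Lemma invariant_monomials M f a n : closed_subspace p phi M -> (forall g, M g -> M (V g)) ->
  M f -> pser f a -> a n != 0 -> (forall k, (k < n)%N -> a k = 0) ->
  exists J, forall k, (n + J <= k)%N -> M (mono k).
Proof.
move=> [Mfock sM cM] MV Mf fa an az.
have [J JP] := volterra_approx p_gt0 alpha_gt2 fa (Mfock _ Mf).2 an az; exists J.
have fact_neq0 : ((n + J)`!%:R : C) != 0 by rewrite pnatr_eq0 -lt0n fact_gt0.
have base : M (mono (n + J)).
  have -> : mono (n + J) = (n + J)`!%:R *: ((n + J)`!%:R^-1 *: mono (n + J)).
    by rewrite scalerA mulfV// scale1r.
  apply: submod_scale => //; apply: (closure_limit cM).
    by rewrite -[_ *: _]addr0; apply: fock_linear => //; [exact: fock_monomial|exact: fock0].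
  move=> e /JP[m [c cP]]; exists (\sum_(k < m) c k *: iter (J + k) V f) => //.
  by apply: submod_sum => // k; apply: submod_scale => //; exact: submod_iter_volterra.
move=> k nk; rewrite -(subnKC nk); elim: (k - (n + J))%N => [|j IH]; first by rewrite addn0.
have j0 : ((n + J + j).+1%:R : C) != 0 by rewrite pnatr_eq0.
rewrite addnS; have -> : mono (n + J + j).+1 = (n + J + j).+1%:R *: V (mono (n + J + j)).
  by rewrite volterra_monomial scalerA mulfV// scale1r.
by apply: submod_scale => //; exact: MV.
Qed.

Lemma vanishing_sub_of_monomials M n : closed_subspace p phi M ->
  (forall k, (n <= k)%N -> M (mono k)) -> vanishing n `<=` M.
Proof.
move=> [_ sM cM] Mm f fn; apply: (closure_limit cM fn.1) => e e0.
have [a fa] := fock_pser fn.1.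
have [m [b [bz mP]]] := fock_density p_gt0 alpha_gt2 fa fn.1.2 e0.
exists (psum b m) => //; apply: psum_submod => // k bk; apply: Mm; rewrite leqNgt.
by apply: contraNN bk => kn; apply/eqP/bz; exact: ((vanishing_coefP n fa).1 fn).2.
Qed.

(** [V^d f] vanishes exactly to order [n + d], so a suitable multiple removes the coefficient of
    that index from [h]; the remainder vanishes to order [n + d + 1] and is in [M] already. *)
Lemma vanishing_descent M f a n d : closed_subspace p phi M -> (forall g, M g -> M (V g)) ->
  M f -> pser f a -> a n != 0 -> (forall k, (k < n)%N -> a k = 0) ->
  vanishing (n + d) `<=` M -> vanishing n `<=` M.
Proof.
move=> [Mfock sM cM] MV Mf fa an az; elim: d => [|d IH]; first by rewrite addn0.
move=> vM; apply: IH => h hv; have [b hb] := fock_pser hv.1.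
have ga := pser_iter_volterra d fa; set g := iter d V f in ga.
have Mg : M g by exact: submod_iter_volterra.
pose q := iter d (@vcoef R) a (n + d)%N.
have q0 : q != 0.
  rewrite /q iter_vcoef ltnNge leq_addl/= addnK mulf_neq0//.
have [M0 ML] := (submod_closedP M).1 sM.
have -> : h = (b (n + d)%N / q) *: g + (- (b (n + d)%N / q) *: g + h).
  by rewrite addrA -scalerDl subrr scale0r add0r.
apply: ML => //; apply: vM; apply/(vanishing_coefP _ (pser_linear _ ga hb)).
split; first by apply: fock_linear => //; [exact: Mfock|exact: hv.1].
have bz := ((vanishing_coefP (n + d) hb).1 hv).2.
move=> k; rewrite addnS ltnS leq_eqVlt => /predU1P[->|knd].
  by rewrite -/q mulNr divfK// addNr.
rewrite (bz k knd) addr0 iter_vcoef; case: ifP => [_|/negbT]; first by rewrite mulr0.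
by rewrite -leqNgt => dk; rewrite az ?mulr0// ltn_subLR// addnC.
Qed.

(** [n] is the least index at which some member has a non-zero coefficient. A member that realizes
    it has order exactly [n], as the descent requires. The two exclusions in properness give the
    existence of [n] and its positivity. *)
Lemma proper_invariant_vanishing M : proper_invariant_subspace p phi M ->
  exists2 n : nat, (0 < n)%N & M = vanishing n.
Proof.
move=> [clM MV M0 Mfull]; have [Mfock sM cM] := clM.
pose P n := exists f a, [/\ M f, pser f a & a n != 0].
have exP : exists n, `[< P n >].
  apply: contrapT => nP; apply: M0; apply/seteqP; split=> f /=; last first.
    by move=> ->; have [] := (submod_closedP M).1 sM.
  move=> Mf; have [a fa] := fock_pser (Mfock f Mf); apply: (pser_eq fa).
  have -> : a = fun=> 0; last exact: pser_zero.
  apply/funext => k; apply/eqP/negPn/negP => ak; apply: nP; exists k; apply/asboolP.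
  by exists f, a.
case: (ex_minnP exP) => n /asboolP[f [a [Mf fa an]]] nmin.
have low g b k : M g -> pser g b -> (k < n)%N -> b k = 0.
  move=> Mg gb; apply: contraTeq => bk; rewrite -leqNgt; apply: nmin; apply/asboolP.
  by exists g, b.
have az k : (k < n)%N -> a k = 0 by exact: low Mf fa.
have ME : M = vanishing n.
  apply/seteqP; split=> g.
    move=> Mg; have fg := Mfock g Mg; have [b gb] := fock_pser fg.
    by apply/(vanishing_coefP n gb); split => // k; exact: low Mg gb.
  have [J JP] := invariant_monomials clM MV Mf fa an az.
  exact: (vanishing_descent clM MV Mf fa an az (vanishing_sub_of_monomials clM JP)).
exists n => //; rewrite lt0n; apply/negP => /eqP n0; apply: Mfull.
rewrite ME n0; apply/seteqP; split=> g; first by case.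
by move=> fg; split.
Qed.

End InvariantSubspaces.

Theorem corollary30 (R : realType) (p alpha : R)
    (p_gt0 : 0 < p) (alpha_gt2 : 2 < alpha) :
  (forall M : set (R[i]^o -> R[i]^o),
     proper_invariant_subspace p (radial_power alpha) M <->
     exists2 N : nat, (0 < N)%N & M = fock_vanishing p (radial_power alpha) N)
  /\
  (forall N : nat, (0 < N)%N ->
     fock_vanishing p (radial_power alpha) N =
     fock_closure p (radial_power alpha)
       (linear_span [set @monomial R k | k in [set k : nat | (N <= k)%N]])).
Proof.
split=> [M|n _]; last exact: vanishing_span.
split=> [|[n n0 ->]]; first exact: proper_invariant_vanishing.
exact: vanishing_proper.
Qed.
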